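(* Let $E$ be a Polish space and let $A \subseteq C_b(E)\times C_b(E)$ be a linear operator such that the martingale problem for $A$ is well-posed; for $x\in E$ let $\mathbb{P}_x \in \mathcal{P}(D_E(\mathbb{R}^+))$ be the solution with $X(0)=x$ $\mathbb{P}_x$-almost surely, and assume that $x\mapsto \mathbb{P}_x$ is continuous for the weak topology on $\mathcal{P}(D_E(\mathbb{R}^+))$. For $\lambda>0$ and $h\in C_b(E)$ set $$R(\lambda)h(x)=\sup_{\mathbb{Q}\in\mathcal{P}(D_E(\mathbb{R}^+))}\left\{\int_0^\infty\left(\int h(X(t))\,\mathbb{Q}(dX)-S_t(\mathbb{Q}\,|\,\mathbb{P}_x)\right)\tau_\lambda(dt)\right\},$$ and $R(0)h=h$, and for $t\ge0$ set $V(t)h(x)=\log\mathbb{E}_x\left[e^{h(X(t))}\right]$, where $\mathbb{E}_x$ is expectation under $\mathbb{P}_x$. Then for each $h\in C_b(E)$ and $t\ge 0$ we have $$\lim_{m\to\infty}R\left(\frac{t}{m}\right)^m h=V(t)h$$ for the strict topology on $C_b(E)$.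
   Context: $C_b(E)$: bounded continuous real functions on $E$, with supremum norm $\|\cdot\|$. $\mathbb{R}^+=[0,\infty)$. $D_E(\mathbb{R}^+)$: Skorokhod space of right-continuous trajectories $X:\mathbb{R}^+\to E$ with left limits, with the usual Skorokhod topology. $\mathcal{P}(\mathcal{X})$: Borel probability measures on $\mathcal{X}$, with the weak topology. $\mathcal{F}_t=\sigma(X(s)\,|\,s\le t)$ on $D_E(\mathbb{R}^+)$. Martingale problem: for $\nu\in\mathcal{P}(E)$, $\mathbb{P}\in\mathcal{P}(D_E(\mathbb{R}^+))$ solves the martingale problem for $(A,\nu)$ if $\mathbb{P}\circ X(0)^{-1}=\nu$ and for all $f$ in the domain of $A$ the process $f(X(t))-f(X(0))-\int_0^t Af(X(s))\,ds$ is a martingale for $(\mathcal{F}_t)$ under $\mathbb{P}$. It is well-posed if there is exactly one solution for every $\nu\in\mathcal{P}(E)$. Relative entropy: $S(\nu\,|\,\mu)=\int\log\frac{d\nu}{d\mu}\,d\nu$ if $\nu\ll\mu$, and $+\infty$ otherwise; $S_t(\mathbb{Q}\,|\,\mathbb{P})$ is the relative entropy of the restrictions of $\mathbb{Q},\mathbb{P}$ to $\mathcal{F}_t$. $\tau_\lambda(dt)=\mathbf{1}_{\{t\ge0\}}\lambda^{-1}e^{-t/\lambda}\,dt$. Under these assumptions $R(\lambda)$ maps $C_b(E)$ into $C_b(E)$, so the $m$-fold composition $R(t/m)^m$ is defined. Strict topology: generated by the semi-norms $f\mapsto\sup_n a_n\sup_{x\in K_n}|f(x)|$, with $a_n\ge0$,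 $a_n\to0$ and $K_n\subseteq E$ compact. A sequence $f_n$ converges strictly to $f$ iff $\sup_n\|f_n\|<\infty$ and $\sup_{x\in K}|f_n(x)-f(x)|\to0$ for every compact $K\subseteq E$. *)

(* Defs.v *)
From HB Require Import structures.
From mathcomp Require Import all_boot all_order all_algebra.
From mathcomp Require Import all_classical all_reals all_analysis.
From mathcomp Require Import lra.

Set Implicit Arguments.
Unset Strict Implicit.
Unset Printing Implicit Defensive.
Import Order.TTheory GRing.Theory Num.Theory.
Import numFieldNormedType.Exports.
Local Open Scope classical_set_scope.
Local Open Scope ring_scope.

Definition separable (T : topologicalType) : Prop :=
  exists2 S : set T, countable S & dense S.

Definition borel (T : ptopologicalType) : measurableType (@open T).-sigma :=
  g_sigma_algebraType (@open T).

Section Cb.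
Context (R : realType) (T : topologicalType).

Definition bounded_continuous : {pred T -> R} :=
  mem [set f : T -> R | continuous f /\ bounded_fun f].

Record Cb : Type := MkCb {
  Cb_fun :> T -> R ;
  Cb_funP : Cb_fun \in bounded_continuous }.

HB.instance Definition _ := [isSub for Cb_fun].
HB.instance Definition _ := [Choice of Cb by <:].

Lemma bounded_continuous_submod : submod_closed bounded_continuous.
Proof.
split.
  rewrite inE; split; first exact: cst_continuous.
  by exists 0; split => // M M0 x _; rewrite /= normr0 ltW.
move=> a f g; rewrite !inE => -[cf [A [Ar fA]]] [cg [B [Br gB]]]; split.
  move=> x; apply: (@cvgD _ R^o); last exact: cg.
  by apply: (@cvgM _ _ (nbhs x)); [exact: cvg_cst|exact: cf].
exists (`|a| * (`|A| + 1) + (`|B| + 1)); split; first exact: num_real.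
move=> M /ltW lM x _ /=; apply: le_trans lM.
apply: (le_trans (ler_normD _ _)); apply: lerD.
  rewrite /= normrM; apply: ler_wpM2l => //; apply: fA => //.
  by rewrite (le_lt_trans (ler_norm A))// ltrDl.
by apply: gB => //; rewrite (le_lt_trans (ler_norm B))// ltrDl.
Qed.

HB.instance Definition _ :=
  GRing.isSubmodClosed.Build R (T -> R) bounded_continuous
    bounded_continuous_submod.
HB.instance Definition _ := [SubChoice_isSubLmodule of Cb by <:].
HB.instance Definition _ := isPointed.Build Cb 0.

(* f |-> sup_n a_n sup_(x in K_n) |f x|; all suprema are of bounded sets when
   f is bounded and a_n --> 0, and the supremum over an empty K_n is 0 *)
Definition strict_seminorm (a : nat -> R) (K : nat -> set T) (f : T -> R) : R :=
  sup [set a n * sup [set `|f x| | x in K n] | n in [set: nat]].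

Definition strict_admissible (a : nat -> R) (K : nat -> set T) : Prop :=
  [/\ forall n, 0 <= a n, a n @[n --> \oo] --> (0 : R) &
      forall n, compact (K n)].

(* subbase: the open balls of the admissible seminorms *)
HB.instance Definition _ := @isSubBaseTopological.Build Cb
  (Cb * ((nat -> R) * (nat -> set T)) * R)%type
  [set i | strict_admissible i.1.2.1 i.1.2.2 /\ 0 < i.2]
  (fun i => [set g : Cb |
     strict_seminorm i.1.2.1 i.1.2.2 (g - i.1.1 : Cb) < i.2]).

End Cb.
Arguments Cb R T : clear implicits.

Section prob_weak.
Context (R : realType) (T : ptopologicalType).

Definition prob_integral (P : probability (borel T) R) :
    {ptws (Cb R T) -> R} :=
  fun f => \int[P]_(x in [set: borel T]) f x.

Definition prob_weak : Type := initial_topology prob_integral.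
HB.instance Definition _ :=
  Topological.copy prob_weak (initial_topology prob_integral).

End prob_weak.

Section Skorokhod.
Context (R : realType) (E : pseudoPMetricType R).

(* A trajectory indexed by [0, +oo[ is represented by its extension to R that
   is constant on ]-oo, 0]: this extension is unique. *)
Record skorokhod : Type := MkSkorokhod {
  traj :> R -> E ;
  traj_neg : forall t, t < 0 -> traj t = traj 0 ;
  traj_rcont : forall t, 0 <= t -> traj s @[s --> t^'+] --> traj t ;
  traj_llim : forall t, 0 < t -> cvg (traj s @[s --> t^'-]) }.

HB.instance Definition _ := gen_eqMixin skorokhod.
HB.instance Definition _ := gen_choiceMixin skorokhod.

Definition skorokhod_cst (x : E) : skorokhod.
Proof.
apply: (@MkSkorokhod (fun=> x)) => //.
- by move=> t _; exact: cvg_cst.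
- by move=> t _; apply/cvg_ex; exists x; exact: cvg_cst.
Defined.
HB.instance Definition _ := isPointed.Build skorokhod (skorokhod_cst point).

(* strictly increasing bijections of [0, +oo[ *)
Definition time_change (l : R -> R) : Prop :=
  set_bij `[0, +oo[ `[0, +oo[ l /\
  {in `[0, +oo[ &, {homo l : s t / s < t}}.

(* Ethier--Kurtz, Markov Processes, Proposition 3.5.3 (c): X_n --> X in the
   Skorokhod topology iff, for all T and all e > 0, X_n is eventually in
   skorokhod_nbhd X T e; the time change may depend on T. The topology does not
   depend on the metric chosen among those compatible with the topology of E. *)
Definition skorokhod_nbhd (X : skorokhod) (T e : R) : set skorokhod :=
  [set Y | exists2 l, time_change l & forall t, 0 <= t <= T ->
     `|l t - t| < e /\ ball (X (l t)) e (Y t)].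

Definition skorokhod_open : set (set skorokhod) :=
  [set U | forall X, U X -> exists T e, 0 < e /\ skorokhod_nbhd X T e `<=` U].

Let skorokhod_openT : skorokhod_open setT.
Proof. by move=> X _; exists 0, 1; split. Qed.

Let skorokhod_openI : setI_closed skorokhod_open.
Proof.
move=> U V oU oV X [/oU[T [e [e0 TU]]] /oV[S [d [d0 SV]]]].
exists (Num.max T S), (Num.min e d); split; first by rewrite lt_min e0.
move=> Y [l tl lY]; split; [apply: TU|apply: SV]; exists l => // t /andP[t0 tT].
- have [|ltd XY] := lY t; first by rewrite t0 le_max tT.
  split; first by rewrite (lt_le_trans ltd)// ge_min lexx.
  by apply: le_ball XY; rewrite ge_min lexx.
- have [|ltd XY] := lY t; first by rewrite t0 le_max tT orbT.
  split; first by rewrite (lt_le_trans ltd)// ge_min lexx orbT.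
  by apply: le_ball XY; rewrite ge_min lexx orbT.
Qed.

Let skorokhod_open_bigU (I : Type) (f : I -> set skorokhod) :
  (forall i, skorokhod_open (f i)) -> skorokhod_open (\bigcup_i f i).
Proof.
move=> of_ X [i _ /of_[T [e [e0 Tf]]]]; exists T, e; split => //.
by move=> Y /Tf fY; exists i.
Qed.

HB.instance Definition _ := isOpenTopological.Build skorokhod
  skorokhod_openT skorokhod_openI skorokhod_open_bigU.

Lemma skorokhod_openE : (open : set (set skorokhod)) = skorokhod_open.
Proof. by []. Qed.

(* generators of sigma(X(s) | s <= t) *)
Definition coord_gen (t : R) : set (set skorokhod) :=
  [set A | exists2 s : R, 0 <= s <= t & exists2 B : set (borel E),
     measurable B & A = [set X : skorokhod | B (X s)]].

Definition coord_filtration (t : R) : set (set skorokhod) :=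
  <<s coord_gen t >>.

Definition skorokhod_upto (t : R) :
    measurableType (coord_gen t).-sigma :=
  g_sigma_algebraType (coord_gen t).

Lemma closed_coord (s e : R) (F : set E) : 0 <= s -> closed F ->
  closed [set X : skorokhod | forall u, s < u < s + e -> F (X u)].
Proof.
move=> s0 cF; rewrite -openC skorokhod_openE.
move=> X /existsNP[u /not_implyP[/andP[su ue] FXu]].
have [d /= d0 dF] : nbhs_ball (X u) (~` F).
  by rewrite nbhs_ballE; apply: open_nbhs_nbhs; split; rewrite ?openC.
pose eps := Num.min d (Num.min (u - s) (s + e - u)).
have eps0 : 0 < eps by rewrite !lt_min d0 !subr_gt0 su.
exists (u + eps), eps; split => // Y [l [lbij lmono] lY] /= FY.
have [_ _ /(_ u)[]] := lbij.
  by rewrite /= in_itv/= andbT ltW// (le_lt_trans s0).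
move=> t; rewrite /= in_itv/= andbT => t0 ltu.
have T0 : 0 <= u + eps by rewrite addr_ge0// ltW// (le_lt_trans s0).
have tT : t <= u + eps.
  rewrite leNgt; apply/negP => Tt.
  have := lmono (u + eps) t; rewrite !in_itv/= !andbT T0 t0.
  move=> /(_ isT isT Tt); rewrite ltu => lu.
  have [] := lY (u + eps); first by rewrite T0 lexx.
  by rewrite ltr_norml => /andP[+ _] _; lra.
have [] := lY t; first by rewrite t0 tT.
rewrite ltu => ute XY; have : (~` F) (Y t).
  by apply: dF; apply: le_ball XY; rewrite ge_min lexx.
apply; apply: FY.
move: ute; rewrite ltr_norml !lt_min => /andP[].
move: (ge_min (u - s) d (Num.min (u - s) (s + e - u))).
have : eps <= u - s by rewrite !ge_min lexx orbT.
have : eps <= s + e - u by rewrite !ge_min lexx !orbT.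
by move=> *; apply/andP; split; lra.
Qed.

Lemma coord_open (s : R) (U : set E) : 0 <= s -> open U ->
  [set X : skorokhod | U (X s)] = \bigcup_n [set X : skorokhod |
    forall u, s < u < s + n.+1%:R^-1 ->
      closure [set x | ball x n.+1%:R^-1 `<=` U] (X u)].
Proof.
move=> s0 oU; apply/seteqP; split => [X UXs|X [n _ XU]] /=.
  have [e /= e0 eU] : nbhs_ball (X s) U.
    by rewrite nbhs_ballE; exact: open_nbhs_nbhs.
  have e20 : 0 < e / 2 by rewrite divr_gt0.
  have : \forall u \near s^'+, ball (X s) (e / 2) (X u).
    by have /cvg_ballP := @traj_rcont X s s0; exact.
  move=> [d /= d0 dX].
  have m0 : 0 < Num.min (e / 2) d by rewrite lt_min e20.
  have [n nm] : exists n, n.+1%:R^-1 < Num.min (e / 2) d.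
    have [n _ /(_ _ (leqnn n))/= h] := near_infty_natSinv_lt (PosNum m0).
    by exists n.
  exists n => // u /andP[su un]; apply: subset_closure => y /= Xuy; apply: eU.
  rewrite [e]splitr; apply: (@ball_triangle _ _ (X u)).
    apply: dX => //=; rewrite ltr_norml; move: nm; rewrite lt_min => /andP[_ nd].
    by move: n.+1%:R^-1 un nd => z un zd; apply/andP; split; lra.
  by apply: le_ball Xuy; rewrite ltW//; move: nm; rewrite lt_min => /andP[].
have n0 : 0 < n.+1%:R^-1 :> R by rewrite invr_gt0.
have : closure [set x | ball x n.+1%:R^-1 `<=` U] (X s).
  have := @traj_rcont X s s0; apply: closed_cvg; first exact: closed_closure.
  near=> u; apply: XU; apply/andP; split; first by near: u; exact: nbhs_right_gt.
  by near: u; apply: nbhs_right_lt; rewrite ltrDl.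
move=> /(_ (ball (X s) n.+1%:R^-1)) []; first exact: nbhsx_ballx.
by move=> y [/= yU Xsy]; apply/yU/ball_sym.
Unshelve. all: by end_near. Qed.

Lemma measurable_coord (s : R) : 0 <= s ->
  measurable_fun setT (fun X : borel skorokhod => (X : skorokhod) s : borel E).
Proof.
move=> s0; apply: (@measurability _ _ _ (borel E) _ _ (@open E)) => //.
move=> _ [U oU <-]; rewrite setTI [X in measurable X]coord_open//.
apply: bigcup_measurable => n _; rewrite -[X in measurable X]setCK.
apply: measurableC; apply: sub_sigma_algebra; rewrite openC.
by apply: closed_coord => //; exact: closed_closure.
Qed.

Definition to_upto (t : R) (X : borel skorokhod) : skorokhod_upto t := X.

Lemma measurable_to_upto (t : R) : measurable_fun setT (to_upto t).
Proof.
apply: (@measurability _ _ _ (skorokhod_upto t) _ _ (coord_gen t)) => //.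
move=> _ [_ [s /andP[s0 _] [B mB ->]] <-].
exact: (measurable_coord s0 measurableT mB).
Qed.

HB.instance Definition _ (t : R) :=
  isMeasurableFun.Build _ _ _ _ (to_upto t) (@measurable_to_upto t).

(* the restriction of P to sigma(X(s) | s <= t) *)
Definition restr_upto (t : R) (P : probability (borel skorokhod) R) :
    probability (skorokhod_upto t) R :=
  distribution P (to_upto t).

End Skorokhod.

Section relative_entropy.
Local Open Scope charge_scope.
Local Open Scope ereal_scope.

Definition relative_entropy d (T : measurableType d) (R : realType)
    (nu mu : probability T R) : \bar R :=
  if `[< nu `<< mu >]
  then \int[nu]_x lne (('d (charge_of_finite_measure nu) '/d mu) x)
  else +oo.

Definition relative_entropy_upto (R : realType) (E : pseudoPMetricType R)
    (t : R) (Q P : probability (borel (skorokhod E)) R) : \bar R :=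
  relative_entropy (restr_upto t Q) (restr_upto t P).

End relative_entropy.

(* E[M t | F s] = M s is spelled out as the defining property of conditional
   expectation, M s being F s-measurable and integrable *)
Definition martingale d (T : measurableType d) (R : realType)
    (P : probability T R) (F : R -> set (set T)) (M : R -> T -> R) : Prop :=
  (forall t, 0 <= t ->
     (forall B : set R, measurable B -> F t (M t @^-1` B)) /\
     P.-integrable [set: T] (EFin \o M t)) /\
  (forall s t, 0 <= s -> s <= t -> forall A, F s A ->
     \int[P]_(x in A) M t x = \int[P]_(x in A) M s x).

Section martingale_problem.
Context (R : realType) (E : pseudoPMetricType R).
Local Notation D := (borel (skorokhod E)).

(* A is the graph of the operator *)
Definition linear_operator (A : set (Cb R E * Cb R E)) : Prop :=
  [/\ A 0,
      forall (a : R) u v, A u -> A v -> A (a *: u + v) &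
      forall f g g', A (f, g) -> A (f, g') -> g = g'].

Definition martingale_process (f g : Cb R E) (t : R) (X : D) : R :=
  let X' : skorokhod E := X in
  f (X' t) - f (X' 0) - \int[lebesgue_measure]_(s in `[0, t]) g (X' s).

Definition solves_martingale_problem (A : set (Cb R E * Cb R E))
    (nu : probability (borel E) R) (P : probability D R) : Prop :=
  (forall B : set (borel E), measurable B ->
     P [set X : skorokhod E | B (X 0)] = nu B) /\
  (forall f g, A (f, g) ->
     martingale P (@coord_filtration R E) (martingale_process f g)).

(* A measure is a function on all sets, hence uniqueness is up to equality on
   the measurable ones. *)
Definition well_posed (A : set (Cb R E * Cb R E)) : Prop :=
  forall nu : probability (borel E) R,
    (exists P, solves_martingale_problem A nu P) /\
    (forall P Q, solves_martingale_problem A nu P ->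
       solves_martingale_problem A nu Q ->
       forall B, measurable B -> P B = Q B).

End martingale_problem.

Section resolvent.
Context (R : realType) (E : pseudoPMetricType R).
Variable (P : E -> probability (borel (skorokhod E)) R).

(* exponential_pdf lambda^-1 t = lambda^-1 * expR (- t / lambda) for 0 <= t *)
Definition resolvent_ereal (lambda : R) (h : E -> R) (x : E) : \bar R :=
  ereal_sup [set (\int[lebesgue_measure]_(t in `[0%R, +oo[)
      (('E_Q[fun X => h ((X : skorokhod E) t)]
          - relative_entropy_upto t Q (P x))
       * (exponential_pdf lambda^-1 t)%:E))%E
    | Q in [set: probability (borel (skorokhod E)) R]].

(* the supremum lies between - ||h|| and ||h|| when h is in C_b(E) *)
Definition resolvent (lambda : R) (h : E -> R) : E -> R :=
  if lambda == 0 then h else fun x => fine (resolvent_ereal lambda h x).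

Definition semigroup (t : R) (h : E -> R) (x : E) : R :=
  ln (fine 'E_(P x)[fun X => expR (h ((X : skorokhod E) t))]).

End resolvent.

(* Main.v *)
From HB Require Import structures.
From mathcomp Require Import all_boot all_order all_algebra.
From mathcomp Require Import all_classical all_reals all_analysis.
From mathcomp Require Import measurable_realfun giry lra ring.
Require Import Defs.

Set Implicit Arguments.
Unset Strict Implicit.
Unset Printing Implicit Defensive.
Import Order.TTheory GRing.Theory Num.Theory.
Import numFieldNormedType.Exports.
Local Open Scope classical_set_scope.
Local Open Scope ring_scope.

(** Write [S_t] for the transition semigroup and [L_c g] for the integral of [S_s g]
    against the exponential law of rate [c = 1/lambda]. Uniqueness gives the Markov
    property, and the weak continuity of [x |-> P_x] makes [S_t g x] jointly continuous in
    [(t, x)]: a trajectory jumps at almost no time, and the Markov property excludes jumps at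
    a fixed time.

    A function [f] equals [R(lambda) h] as soon as
    [exp (f (X t) - f (X 0) - c \int_0^t (f - h) (X s) ds)] has mean 1 under every [P_x]:
    the Gibbs variational principle gives [R(lambda) h <= f], and the measure with this density,
    stopped at late times, is nearly optimal. For positive [k], [f = log L_c k] is of this
    form with [h = f - 1 + k exp (- f)]; the equation for arbitrary [h] is solved by a
    contraction built from these explicit solutions.

    The same exponential means make [R(lambda)] monotone, additive on constants and midpoint
    convex, with [R(lambda) h <= log L_c (exp h)], the error being quadratic in
    [log L_c (exp h) - h]. Since [(L_c)^m g --> S_t g] for [c = m / t] (a Chebyshev bound for
    sums of exponential times), the upper bound for [R(t/m)^m h] follows, and the lower one
    for [u = log L_b (exp h)], where [S_s (exp u) - exp u] is linear in [s]. Convexity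
    carries it to [h] through [2 R^m u <= R^m h + R^m (2 u - h)] as [b --> oo]. *)

(** * Integrals of bounded measurable functions *)

(** The regularity of R(lambda) h cannot be read off a supremum over measures, so a candidate f has
    to be produced first. At rate c the explicit candidates ask for k = exp(f) (1 + h - f), which is
    positive only while f - h < 1. The same construction at the rate a = c (1 + 2 H), with H a bound
    for |h|, asks instead for k = exp(f) (1 - (c/a)(f - h)). This is positive whenever |f| <= H, and
    its logarithm contracts strictly in f.

    The lower bound loses at each of m steps the square of a one-step increment. For general h that
    increment has no rate; for u = log L_b exp h it is O(1/m), so the total loss is O(1/m).

    Returning from u to h is the delicate point: as b grows, u tends to h only pointwise, and the
    contraction of R(lambda) in the supremum norm gives nothing. Convexity bounds R^m h below by 2
    R^m u - R^m (2 u - h). It remains that V(t) u and V(t)(2 u - h) be close to V(t) h at the given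
    point, and dominated convergence under P_x is enough for that. *)

Section bounded_measurable.
Context d (T : measurableType d) (R : realType).
Implicit Types f g : T -> R.

(** Such functions are integrable for every finite measure, so linearity, monotonicity and Fubini
    carry no further side condition. *)
Definition bmfun f := measurable_fun setT f /\ exists C, forall x, `|f x| <= C.

Lemma bmfun_cst (a : R) : bmfun (fun=> a).
Proof. by split => //; exists `|a|. Qed.

Lemma bmfun_ge0 f : bmfun f -> exists2 C, 0 <= C & forall x, `|f x| <= C.
Proof.
move=> [_ [C fC]]; exists `|C| => // x.
by rewrite (le_trans (fC x))// ler_norm.
Qed.

Lemma bmfunD f g : bmfun f -> bmfun g -> bmfun (fun x => f x + g x).
Proof.
move=> [mf [A fA]] [mg [B gB]]; split; first exact: measurable_funD.
by exists (A + B) => x; rewrite (le_trans (ler_normD _ _))// lerD.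
Qed.

Lemma bmfunN f : bmfun f -> bmfun (fun x => - f x).
Proof.
move=> [mf [A fA]]; split; first exact: measurableT_comp.
by exists A => x; rewrite normrN.
Qed.

Lemma bmfunB f g : bmfun f -> bmfun g -> bmfun (fun x => f x - g x).
Proof. by move=> bf bg; apply: bmfunD => //; exact: bmfunN. Qed.

Lemma bmfunM f g : bmfun f -> bmfun g -> bmfun (fun x => f x * g x).
Proof.
move=> [mf [A fA]] [mg [B gB]]; split; first exact: measurable_funM.
exists (A * B) => x; rewrite normrM.
by apply: ler_pM => //; apply: le_trans (fA x).
Qed.

Lemma bmfunZ (a : R) f : bmfun f -> bmfun (fun x => a * f x).
Proof. by move=> bf; apply: bmfunM => //; exact: bmfun_cst. Qed.

Lemma bmfun_norm f : bmfun f -> bmfun (fun x => `|f x|).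
Proof.
move=> [mf [A fA]]; split; first exact: measurableT_comp.
by exists A => x; rewrite normr_id.
Qed.

Lemma bmfun_exp f : bmfun f -> bmfun (fun x => expR (f x)).
Proof.
move=> [mf [A fA]]; split; first exact: measurableT_comp.
exists (expR A) => x; rewrite ger0_norm ?expR_ge0// ler_expR.
exact: le_trans (ler_norm _) (fA x).
Qed.

Lemma bmfun_indic (A : set T) : measurable A -> bmfun (\1_A).
Proof.
move=> mA; split; first exact: measurable_indic.
by exists 1 => x; rewrite indicE; case: (_ \in _); rewrite ?normr1 ?normr0.
Qed.

Lemma bmfun_lim (f_ : nat -> T -> R) f (C : R) : (forall n, measurable_fun setT (f_ n)) ->
  (forall n x, `|f_ n x| <= C) -> (forall x, f_ n x @[n --> \oo] --> f x) ->
  bmfun f.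
Proof.
move=> mf fC ff; split; first by apply: measurable_fun_cvg => //; exact: mf.
exists C => x; have : (fun n => `|f_ n x|) @ \oo --> `|f x|.
  exact: (@cvg_norm _ _ _ _ _ _ _ (ff x)).
apply: (closed_cvg (fun z => z <= C)); first exact: closed_le.
exact: nearW.
Qed.

End bounded_measurable.

Lemma bmfun_comp d1 d2 (T1 : measurableType d1) (T2 : measurableType d2)
    (R : realType) (f : T2 -> R) (g : T1 -> T2) :
  bmfun f -> measurable_fun setT g -> bmfun (fun x => f (g x)).
Proof.
move=> [mf [A fA]] mg; split; first exact: (measurableT_comp mf mg).
by exists A.
Qed.

Section integral_finite_measure.
Context d (T : measurableType d) (R : realType).
Variable mu : {finite_measure set T -> \bar R}.
Implicit Types f g : T -> R.

Definition mass : R := fine (mu setT).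

Lemma bmfun_integrable f : bmfun f -> mu.-integrable setT (EFin \o f).
Proof.
move=> [mf [C fC]]; apply: measurable_bounded_integrable => //.
  exact: fin_num_fun_lty.
exists C; split; first exact: num_real.
by move=> M CM x _ /=; rewrite (le_trans (fC x))// ltW.
Qed.
Hint Resolve bmfun_integrable : core.

Lemma integral_bmfun f : bmfun f ->
  (\int[mu]_x (f x)%:E)%E = (\int[mu]_x f x)%:E.
Proof. by move=> bf; rewrite fineK//; apply: integrable_fin_num => //; exact: bmfun_integrable. Qed.

Lemma RintD f g : bmfun f -> bmfun g ->
  \int[mu]_x (f x + g x) = \int[mu]_x f x + \int[mu]_x g x.
Proof. by move=> bf bg; rewrite RintegralD//; exact: bmfun_integrable. Qed.

Lemma RintB f g : bmfun f -> bmfun g ->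
  \int[mu]_x (f x - g x) = \int[mu]_x f x - \int[mu]_x g x.
Proof. by move=> bf bg; rewrite RintegralB//; exact: bmfun_integrable. Qed.

Lemma RintZ (a : R) f : bmfun f ->
  \int[mu]_x (a * f x) = a * \int[mu]_x f x.
Proof. by move=> bf; rewrite RintegralZl//; exact: bmfun_integrable. Qed.

Lemma Rint_cst (a : R) : \int[mu]_x a = a * mass.
Proof. by rewrite Rintegral_cst. Qed.

Lemma le_Rint f g : bmfun f -> bmfun g -> (forall x, f x <= g x) ->
  \int[mu]_x f x <= \int[mu]_x g x.
Proof. by move=> bf bg fg; apply: le_Rintegral => //; exact: bmfun_integrable. Qed.

Lemma Rint_norm_le f (C : R) : bmfun f -> (forall x, `|f x| <= C) ->
  `|\int[mu]_x f x| <= C * mass.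
Proof.
move=> bf fC; apply: le_trans (le_normr_Rintegral _ _) _ => //.
  exact: bmfun_integrable.
by rewrite -Rint_cst; apply: le_Rint => //; [exact: bmfun_norm|exact: bmfun_cst].
Qed.

Lemma Rint_le f (C : R) : bmfun f -> (forall x, f x <= C) ->
  \int[mu]_x f x <= C * mass.
Proof.
by move=> bf fC; rewrite -Rint_cst; apply: le_Rint => //; exact: bmfun_cst.
Qed.

Lemma Rint_ge f (C : R) : bmfun f -> (forall x, C <= f x) ->
  C * mass <= \int[mu]_x f x.
Proof.
by move=> bf fC; rewrite -Rint_cst; apply: le_Rint => //; exact: bmfun_cst.
Qed.

Lemma bounded_cvg_Rint (f_ : nat -> T -> R) f (C : R) (N : set T) :
  (forall n, measurable_fun setT (f_ n)) -> measurable_fun setT f ->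
  (forall n x, `|f_ n x| <= C) -> mu.-negligible N ->
  (forall x, ~ N x -> f_ n x @[n --> \oo] --> f x) ->
  \int[mu]_x f_ n x @[n --> \oo] --> \int[mu]_x f x.
Proof.
move=> mf_ mf fC negN ff.
have [] := @dominated_convergence _ _ _ mu setT measurableT
  (fun n x => (f_ n x)%:E) (EFin \o f) (cst C%:E).
- by move=> n; exact/measurable_EFinP.
- exact/measurable_EFinP.
- apply: negligibleS negN => x /= /not_implyP[_ h]; apply: contrapT => Nx.
  by apply: h; apply: cvg_EFin; [exact: nearW|exact: ff].
- exact: (bmfun_integrable (bmfun_cst _ _)).
- by apply: aeW => x n _ /=; rewrite lee_fin.
move=> intf _; rewrite -[X in _ --> X](@fineK _ (\int[mu]_x (EFin \o f) x)%E); last first.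
  exact: integrable_fin_num.
move=> /fine_cvgP[_ h].
suff -> : (fun n => \int[mu]_x f_ n x) = fine \o (fun n => \int[mu]_x (f_ n x)%:E)%E.
  by apply: h.
by [].
Qed.

Lemma bounded_cvg_RintT (f_ : nat -> T -> R) f (C : R) :
  (forall n, measurable_fun setT (f_ n)) ->
  (forall n x, `|f_ n x| <= C) ->
  (forall x, f_ n x @[n --> \oo] --> f x) ->
  \int[mu]_x f_ n x @[n --> \oo] --> \int[mu]_x f x.
Proof.
move=> mf_ fC ff; apply: (bounded_cvg_Rint (C := C) (N := set0)) => //.
  exact: (bmfun_lim mf_ fC ff).1.
exact: negligible_set0.
Qed.

End integral_finite_measure.

Lemma mass_probability d (T : measurableType d) (R : realType)
  (P : probability T R) : mass P = 1.
Proof. by rewrite /mass -[X in fine (X _)]/(P : set T -> \bar R) probability_setT. Qed.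

Section fubini_finite_measure.
Context d1 d2 (T1 : measurableType d1) (T2 : measurableType d2) (R : realType).
Variables (mu : {finite_measure set T1 -> \bar R})
  (nu : {finite_measure set T2 -> \bar R}).
Variable f : T1 * T2 -> R.
Hypothesis bf : bmfun f.

Let int_f : (mu \x nu)%E.-integrable setT (EFin \o f).
Proof.
have [mf _] := bf; have [C C0 fC] := bmfun_ge0 bf.
apply/integrable12ltyP; first exact/measurable_EFinP.
apply: (@le_lt_trans _ _ (\int[mu]_x (C%:E * nu setT))%E); last first.
  rewrite integral_cst// lte_mul_pinfty//.
  - by rewrite mule_ge0// lee_fin.
  - by rewrite fin_numM// fin_num_measure.
  - exact: fin_num_fun_lty.
have mabs : measurable_fun setT (abse \o (EFin \o f)).
  by apply: measurableT_comp => //; exact/measurable_EFinP.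
apply: ge0_le_integral => //.
- by move=> x _; exact: integral_ge0.
- apply: (@measurable_fun_fubini_tonelli_F _ _ _ _ _ nu (abse \o (EFin \o f))) => //.
  by move=> z; exact: abse_ge0.
- move=> x _; rewrite -integral_cst//; apply: ge0_le_integral => //.
  + by apply: (measurableT_comp mabs); exact: pair1_measurable.
  + by move=> y _; rewrite lee_fin.
Qed.

Let mf : measurable_fun setT (EFin \o f).
Proof. by apply/measurable_EFinP; exact: bf.1. Qed.

Lemma bmfun_section x : bmfun (fun y => f (x, y)).
Proof. by apply: bmfun_comp => //; exact: pair1_measurable. Qed.

Lemma bmfun_section2 y : bmfun (fun x => f (x, y)).
Proof. by apply: bmfun_comp => //; exact: pair2_measurable. Qed.

Lemma bmfun_Rint : bmfun (fun x => \int[nu]_y f (x, y)).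
Proof.
have [C C0 fC] := bmfun_ge0 bf; split; last first.
  by exists (C * mass nu) => x; apply: Rint_norm_le => //; exact: bmfun_section.
apply/measurable_EFinP; rewrite [X in measurable_fun _ X](_ : _ =
    (fun x => \int[nu]_y (f (x, y))%:E))%E.
  exact: (measurable_fubini_F int_f).
by apply/funext => x /=; rewrite integral_bmfun//; exact: bmfun_section.
Qed.

Lemma bmfun_Rint2 : bmfun (fun y => \int[mu]_x f (x, y)).
Proof.
have [C C0 fC] := bmfun_ge0 bf; split; last first.
  by exists (C * mass mu) => x; apply: Rint_norm_le => //; exact: bmfun_section2.
apply/measurable_EFinP; rewrite [X in measurable_fun _ X](_ : _ =
    (fun y => \int[mu]_x (f (x, y))%:E))%E.
  exact: (measurable_fubini_G int_f).
by apply/funext => x /=; rewrite integral_bmfun//; exact: bmfun_section2.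
Qed.

Lemma Rint_Fubini :
  \int[mu]_x \int[nu]_y f (x, y) = \int[nu]_y \int[mu]_x f (x, y).
Proof.
apply: EFin_inj.
rewrite -integral_bmfun; last exact: bmfun_Rint.
rewrite -integral_bmfun; last exact: bmfun_Rint2.
under eq_integral => x _.
  by rewrite -integral_bmfun; [over|exact: bmfun_section].
under [RHS]eq_integral => x _.
  by rewrite -integral_bmfun; [over|exact: bmfun_section2].
exact: (Fubini int_f).
Qed.

End fubini_finite_measure.

(** * Measures given by a density *)

Section density_measure.
Context d (T : measurableType d) (R : realType).
Variables (mu : {sigma_finite_measure set T -> \bar R}) (w : T -> R).

(** The two proofs are arguments so that the term itself determines the canonical structures of
    measure and of finite measure. *)
Definition density_measure (w_ge0 : forall x, 0 <= w x)
    (w_int : mu.-integrable setT (EFin \o w)) (A : set T) : \bar R :=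
  (\int[mu]_(x in A) (w x)%:E)%E.

Hypotheses (w_ge0 : forall x, 0 <= w x)
  (w_int : mu.-integrable setT (EFin \o w)).
Local Notation nu := (density_measure w_ge0 w_int).

Let nu0 : nu set0 = 0%E.
Proof. exact: integral_set0. Qed.

Let nu_ge0 A : (0 <= nu A)%E.
Proof. by apply: integral_ge0 => x _; rewrite lee_fin. Qed.

Let nu_add : semi_sigma_additive nu.
Proof.
apply: semi_sigma_additive_nng_induced; first exact: measurable_int w_int.
by move=> x; rewrite lee_fin.
Qed.

HB.instance Definition _ := isMeasure.Build _ _ _ nu nu0 nu_ge0 nu_add.

Let nu_fin : fin_num_fun nu.
Proof. by move=> A mA; apply: integrable_fin_num => //; exact: integrableS w_int. Qed.

HB.instance Definition _ := Measure_isFinite.Build _ _ _ nu nu_fin.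

Lemma density_measure_dominates : nu `<< mu.
Proof.
apply/null_content_dominatesP => A mA A0.
apply: null_set_integral => //.
by apply: measurable_funTS; exact: measurable_int w_int.
Qed.

Lemma Radon_Nikodym_density :
  ae_eq mu setT (Radon_Nikodym (charge_of_finite_measure nu) mu) (EFin \o w).
Proof.
have nm := density_measure_dominates.
apply: integral_ae_eq => //; first exact: (@Radon_Nikodym_integrable _ _ _ (charge_of_finite_measure nu) mu nm).
  exact: measurable_int w_int.
by move=> B _ mB; rewrite -(@Radon_Nikodym_integral _ _ _ (charge_of_finite_measure nu) mu).
Qed.

Lemma Rint_density (f : T -> R) : bmfun f ->
  \int[nu]_x f x = \int[mu]_x (f x * w x).
Proof.
move=> bf; have nm := density_measure_dominates.
rewrite /Rintegral -(Radon_Nikodym_change_of_variables nm)//; last first.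
  exact: bmfun_integrable.
have mf : measurable_fun setT (EFin \o f) by apply/measurable_EFinP; exact: bf.1.
congr fine; apply: ae_eq_integral => //.
- exact: emeasurable_funM.
- rewrite [X in measurable_fun _ X](_ : _ = (EFin \o f) \* (EFin \o w))%E//.
  by apply: emeasurable_funM => //; exact: measurable_int w_int.
- rewrite [X in ae_eq _ _ _ X](_ : _ = (EFin \o f) \* (EFin \o w))%E//.
  by apply: ae_eqe_mul2l; exact: Radon_Nikodym_density.
Qed.

End density_measure.

(** * Lebesgue measure on an interval and the exponential law *)

Section time_measures.
Context (R : realType).
Local Notation time := (measurableTypeR R).
Local Notation leb := (@lebesgue_measure R).

Let indic_itv_ge0 (a b : R) (x : time) : 0 <= (\1_(`[a, b]) x : R).
Proof. by rewrite indicE. Qed.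

Let indic_itv_int (a b : R) :
  leb.-integrable [set: time] (EFin \o (\1_(`[a, b] : set time) : time -> R)).
Proof.
exact: integrable_indic_itv.
Qed.

(** Packaged as a finite measure on the whole line, so that the lemmas on bounded measurable
    functions and Fubini apply to integrals over an interval. *)
Definition lebesgue_itv (a b : R) : set time -> \bar R :=
  density_measure (@indic_itv_ge0 a b) (indic_itv_int a b).
HB.instance Definition _ (a b : R) := FiniteMeasure.on (lebesgue_itv a b).

Lemma lebesgue_itv_dominates (a b : R) : lebesgue_itv a b `<< leb.
Proof. exact: density_measure_dominates. Qed.

Lemma Rint_lebesgue_itv (a b : R) (f : time -> R) : bmfun f ->
  \int[lebesgue_itv a b]_x f x = \int[leb]_(x in `[a, b]) f x.
Proof.
move=> bf; rewrite (Rint_density _ _ bf) [RHS]Rintegral_mkcond.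
by apply: eq_Rintegral => x _; rewrite patchE indicE; case: (_ \in _); rewrite ?mulr1 ?mulr0.
Qed.

Lemma mass_lebesgue_itv (a b : R) : a <= b -> mass (lebesgue_itv a b) = b - a.
Proof.
move=> ab; rewrite -[mass _]mul1r -Rint_cst Rint_lebesgue_itv; last exact: bmfun_cst.
rewrite Rintegral_cst//= mul1r lebesgue_measure_itv/= lte_fin.
by case: ltgtP ab => //= ->; rewrite subrr.
Qed.

Definition exp_pdf (c : {posnum R}) : time -> R := exponential_pdf c%:num.

Let exp_pdf_ge0 c x : 0 <= exp_pdf c x.
Proof. exact: exponential_pdf_ge0. Qed.

Let exp_pdf_int c : leb.-integrable setT (EFin \o exp_pdf c).
Proof. exact: integrable_exponential_pdf. Qed.

Definition exp_law (c : {posnum R}) : set time -> \bar R :=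
  density_measure (@exp_pdf_ge0 c) (exp_pdf_int c).
HB.instance Definition _ (c : {posnum R}) := FiniteMeasure.on (exp_law c).

Lemma exp_law_dominates c : exp_law c `<< leb.
Proof. exact: density_measure_dominates. Qed.

Lemma mass_exp_law c : mass (exp_law c) = 1.
Proof. rewrite /mass /= /exp_law /density_measure /=; apply: (congr1 fine (integral_exponential_pdf _)).
by []. Qed.

Lemma Rint_exp_law c (f : time -> R) : bmfun f ->
  \int[exp_law c]_x f x = \int[leb]_x (f x * exponential_pdf c%:num x).
Proof. exact: Rint_density. Qed.

End time_measures.

(** * Tools for building and comparing probability measures *)

Section extension_lemmas.
Context d (T : measurableType d) (R : realType).

Lemma probability_Rint (P : probability T R) (A : set T) : measurable A ->
  P A = (\int[P]_x \1_A x)%:E.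
Proof.
move=> mA; rewrite -(integral_bmfun P (bmfun_indic R mA)) integral_indic//.
by rewrite setIT.
Qed.

Lemma Rint_indic (mu : {finite_measure set T -> \bar R}) (A : set T) (f : T -> R) :
  \int[mu]_(x in A) f x = \int[mu]_x (\1_A x * f x).
Proof.
rewrite Rintegral_mkcond; apply: eq_Rintegral => x _.
by rewrite patchE indicE; case: (x \in A); rewrite ?mul1r ?mul0r.
Qed.

Lemma integral_setE (mu : {finite_measure set T -> \bar R}) (A : set T) (f : T -> R) :
  measurable A -> bmfun f ->
  (\int[mu]_(x in A) (f x)%:E = (\int[mu]_x (\1_A x * f x))%:E)%E.
Proof.
move=> mA bf; rewrite -Rint_indic fineK//; apply: integrable_fin_num => //.
exact: integrableS (bmfun_integrable mu bf).
Qed.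

Lemma eq_measure_Rint (mu nu : {finite_measure set T -> \bar R}) (f : T -> R) :
  (forall A, measurable A -> mu A = nu A) -> \int[mu]_x f x = \int[nu]_x f x.
Proof. by move=> e; congr fine; apply: eq_measure_integral => A mA _; exact: e. Qed.

End extension_lemmas.

Lemma Rint_pushforward d1 d2 (T1 : measurableType d1) (T2 : measurableType d2)
    (R : realType) (mu : {finite_measure set T1 -> \bar R}) (phi : T1 -> T2) (f : T2 -> R) :
  measurable_fun setT phi -> bmfun f ->
  fine (\int[pushforward mu phi]_y (f y)%:E)%E = \int[mu]_x f (phi x).
Proof.
move=> mphi bf; rewrite integral_pushforward//.
- exact/measurable_EFinP/bf.1.
- apply: (bmfun_integrable mu).
  exact: bmfun_comp bf mphi.
Qed.

Section probability_of_measure.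
Context d (T : measurableType d) (R : realType) (m : {measure set T -> \bar R}).

Definition probability_of_measure (m1 : m setT = 1%E) : set T -> \bar R := m.

Hypothesis m1 : m setT = 1%E.
Local Notation Q := (probability_of_measure m1).

Let Q0 : Q set0 = 0%E. Proof. exact: measure0. Qed.

Let Q_ge0 A : (0 <= Q A)%E. Proof. exact: measure_ge0. Qed.

Let Q_add : semi_sigma_additive Q. Proof. exact: measure_semi_sigma_additive. Qed.

HB.instance Definition _ := isMeasure.Build _ _ _ Q Q0 Q_ge0 Q_add.
HB.instance Definition _ := Measure_isProbability.Build _ _ _ Q m1.

End probability_of_measure.

(** Serves twice: with a normalised indicator as weight it gives the conditional laws of the Markov
    property, with an exponential weight the nearly optimal measure of the resolvent. *)
Lemma ex_density_pushforward d1 d2 (T1 : measurableType d1) (T2 : measurableType d2)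
    (R : realType) (P : probability T1 R) (w : T1 -> R) (phi : T1 -> T2) :
  bmfun w -> (forall x, 0 <= w x) -> \int[P]_x w x = 1 ->
  measurable_fun setT phi ->
  exists Q : probability T2 R, forall f : T2 -> R, bmfun f ->
    \int[Q]_y f y = \int[P]_x (w x * f (phi x)).
Proof.
move=> bw w0 w1 mphi.
pose nu := density_measure w0 (bmfun_integrable P bw).
pose m : {measure set T2 -> \bar R} :=
  measure_function_pushforward__canonical__measure_function_Measure nu mphi.
have m1 : m setT = 1%E.
  by rewrite /m/= /pushforward preimage_setT /nu /density_measure/= integral_bmfun// w1.
exists (probability_of_measure m1) => f bf.
rewrite -[LHS]/(fine (\int[pushforward nu phi]_y (f y)%:E)%E).
rewrite Rint_pushforward// Rint_density; last exact: bmfun_comp bf mphi.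
by apply: eq_Rintegral => x _; rewrite mulrC.
Qed.

(* It suffices to compare the integrals against events, since both sides are then
   integrals of [Z] against the same finite measure (once the [Y]'s are made nonnegative). *)
Lemma Rint_sub_sigma d1 d2 (T1 : measurableType d1) (T2 : measurableType d2)
    (R : realType) (P : {finite_measure set T1 -> \bar R}) (phi : T1 -> T2)
    (Y1 Y2 : T1 -> R) (Z : T2 -> R) :
  measurable_fun setT phi -> bmfun Y1 -> bmfun Y2 -> bmfun Z ->
  (forall A, measurable A ->
    \int[P]_x (\1_A (phi x) * Y1 x) = \int[P]_x (\1_A (phi x) * Y2 x)) ->
  \int[P]_x (Z (phi x) * Y1 x) = \int[P]_x (Z (phi x) * Y2 x).
Proof.
move=> mphi b1 b2 bZ Y12.
have [C1 C10 Y1C] := bmfun_ge0 b1; have [C2 C20 Y2C] := bmfun_ge0 b2.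
pose C := C1 + C2.
have ge0 (Y : T1 -> R) (B : R) : B <= C -> (forall x, `|Y x| <= B) -> forall x, 0 <= Y x + C.
  move=> BC YB x; have := YB x; rewrite ler_norml => /andP[+ _]; lra.
have h1 : forall x, 0 <= Y1 x + C by apply: ge0 Y1C; rewrite lerDl.
have h2 : forall x, 0 <= Y2 x + C by apply: ge0 Y2C; rewrite lerDr.
have bc1 : bmfun (fun x => Y1 x + C) by apply: bmfunD => //; exact: bmfun_cst.
have bc2 : bmfun (fun x => Y2 x + C) by apply: bmfunD => //; exact: bmfun_cst.
pose n1 := density_measure h1 (bmfun_integrable P bc1).
pose n2 := density_measure h2 (bmfun_integrable P bc2).
have split (Z' : T2 -> R) (Y : T1 -> R) : bmfun Z' -> bmfun Y ->
    \int[P]_x (Z' (phi x) * (Y x + C)) = \int[P]_x (Z' (phi x) * Y x) + \int[P]_x (C * Z' (phi x)).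
  move=> bZ' bY; rewrite -RintD//.
  - by apply: eq_Rintegral => x _; rewrite mulrDr [C * _]mulrC.
  - by apply: bmfunM => //; exact: bmfun_comp mphi.
  - by apply: bmfunZ; exact: bmfun_comp mphi.
suff : \int[P]_x (Z (phi x) * (Y1 x + C)) = \int[P]_x (Z (phi x) * (Y2 x + C)).
  by rewrite !split// => /addIr.
rewrite -(Rint_density h1 (bmfun_integrable P bc1)); last exact: bmfun_comp mphi.
rewrite -(Rint_density h2 (bmfun_integrable P bc2)); last exact: bmfun_comp mphi.
rewrite -(Rint_pushforward n1 mphi bZ) -(Rint_pushforward n2 mphi bZ); congr fine.
apply: (eq_measure_integral
  (measure_function_pushforward__canonical__measure_function_Measure n2 mphi)) => A mA _ /=.
rewrite /pushforward /= /density_measure.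
have mA' : measurable (phi @^-1` A) by rewrite -[X in measurable X]setTI; exact: mphi.
have bA := bmfun_indic R mA.
have e (Y : T1 -> R) : bmfun Y ->
    (\int[P]_(x in phi @^-1` A) (Y x + C)%:E = (\int[P]_x (\1_A (phi x) * (Y x + C)))%:E)%E.
  by move=> bY; rewrite integral_setE//; apply: bmfunD => //; exact: bmfun_cst.
by rewrite !e// !split// Y12.
Qed.

(** * Translation of Lebesgue measure and lack of memory *)

Section lebesgue_translation.
Context (R : realType).
Local Notation time := (measurableTypeR R).
Local Notation leb := (@lebesgue_measure R).

Let lebesgue_itv_lty (a b : R) : (leb (`[a, b]%classic : set time) < +oo)%E.
Proof.
have := lebesgue_measure_itv `[a, b]; rewrite /= => ->.
by case: ifP => _; rewrite ?ltry// -EFinD ltry.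
Qed.

Lemma measurable_shift (s : R) : measurable_fun [set: time] (fun x : time => x + s : time).
Proof.
have h : measurable_fun setT (fun x : R => x + s).
  by apply: measurable_funD => //; exact: measurable_id.
exact: h.
Qed.

Let shift_measure (s : R) : {measure set time -> \bar R} :=
  measure_function_pushforward__canonical__measure_function_Measure leb (measurable_shift s).

Lemma lebesgue_measure_shift (s : R) (A : set time) : measurable A ->
  leb ((fun x => x + s) @^-1` A) = leb A.
Proof.
move=> mA; apply/esym.
apply: (@lebesgue_measure_unique R (shift_measure s)) mA => _ [[a b] _ <-] /=.
rewrite /pushforward.
rewrite [X in _ = leb X](_ : _ = `]a - s, b - s]%classic); last first.
  by apply/seteqP; split => x /=; rewrite !in_itv/= ltrBlDr lerBrDr.
rewrite !lebesgue_measure_itv/= !lte_fin ltrD2r.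
by case: ifP => // _; rewrite -!EFinB opprD addrACA subrr addr0.
Qed.

Lemma Rint_lebesgue_shift (s : R) (D : set time) (f : time -> R) :
  measurable D -> measurable_fun setT f -> leb.-integrable D (EFin \o f) ->
  \int[leb]_(x in D) f x = \int[leb]_(x in (fun x => x + s) @^-1` D) f (x + s).
Proof.
move=> mD mf intf; rewrite /Rintegral.
have mfs : measurable_fun [set: time] (EFin \o f) by exact/measurable_EFinP.
have eqm (E : set time) : measurable E -> E `<=` D ->
    leb E = (shift_measure s : {measure set time -> \bar R}) E.
  by move=> mE _; exact/esym/lebesgue_measure_shift.
have mD' : measurable ((fun x => x + s) @^-1` D : set time).
  by rewrite -[X in measurable X]setTI; exact: measurable_shift.
congr fine.
rewrite (eq_measure_integral (shift_measure s)) ?integral_pushforward//.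
- exact: measurable_shift.
- apply/integrableP; split.
    by apply: measurable_funTS; apply: (measurableT_comp mfs); exact: measurable_shift.
  move/integrableP : intf => [_]; apply: le_lt_trans.
  rewrite [leRHS](eq_measure_integral (shift_measure s))//.
  rewrite ge0_integral_pushforward//; first exact: measurable_shift.
  by apply: measurable_funTS; exact: measurableT_comp.
Qed.

Lemma Rint_itv_shift (s a b : R) (f : time -> R) : bmfun f ->
  \int[leb]_(x in `[a + s, b + s]) f x = \int[leb]_(x in `[a, b]) f (x + s).
Proof.
move=> bf; rewrite (@Rint_lebesgue_shift s)//; last 2 first.
- exact: bf.1.
- have [mf [C fC]] := bf; apply: measurable_bounded_integrable => //.
  + exact: lebesgue_itv_lty.
  + exact: measurable_funTS.
  + exists C; split; first exact: num_real.
    by move=> M CM x _ /=; rewrite (le_trans (fC x))// ltW.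
rewrite (_ : _ @^-1` _ = `[a, b]%classic)//.
by apply/seteqP; split => x /=; rewrite !in_itv/= !lerD2r.
Qed.

Lemma bmfun_integrable_itv (a b : R) (f : time -> R) : bmfun f ->
  leb.-integrable `[a, b] (EFin \o f).
Proof.
move=> [mf [C fC]]; apply: measurable_bounded_integrable => //.
- exact: lebesgue_itv_lty.
- exact: measurable_funTS.
- exists C; split; first exact: num_real.
  by move=> M CM x _ /=; rewrite (le_trans (fC x))// ltW.
Qed.

Lemma Rint_itv_cat (a b c : R) (f : time -> R) : a <= b -> b <= c -> bmfun f ->
  \int[leb]_(x in `[a, c]) f x =
  \int[leb]_(x in `[a, b]) f x + \int[leb]_(x in `[b, c]) f x.
Proof.
move=> ab bc bf; apply/eqP; rewrite addrC -subr_eq; apply/eqP.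
rewrite Rintegral_itvB ?bnd_simp//; last exact: bmfun_integrable_itv.
rewrite Rintegral_itv_obnd_cbnd//.
apply: (integrableS _ _ _ (bmfun_integrable_itv b c bf)) => //.
exact: subset_itv_oc_cc.
Qed.

Lemma Rint_itv_norm_le (a b C : R) (f : time -> R) : a <= b -> bmfun f ->
  (forall x, a <= x <= b -> `|f x| <= C) -> `|\int[leb]_(x in `[a, b]) f x| <= C * (b - a).
Proof.
move=> ab bf fC; apply: le_trans (le_normr_Rintegral _ _) _ => //.
  exact: bmfun_integrable_itv.
rewrite (_ : b - a = fine (leb `[a, b]%classic)); last first.
  rewrite lebesgue_measure_itv/= lte_fin.
  by case: ltgtP ab => //= ->; rewrite subrr.
rewrite -Rintegral_cst//; apply: le_Rintegral => //.
- exact/(bmfun_integrable_itv _ _ (bmfun_norm bf)).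
- exact/(bmfun_integrable_itv a b (bmfun_cst _ _)).
Qed.

Lemma integrableM_pdf (c : {posnum R}) (f g : time -> R) : bmfun f ->
  leb.-integrable setT (EFin \o g) ->
  leb.-integrable setT (EFin \o (fun s => f s * g s)).
Proof.
move=> [mf [C fC]] ig.
apply: (@le_integrable _ _ _ leb setT _ _ (fun s => (C%:E * (g s)%:E))%E) => //.
- apply/measurable_EFinP; apply: measurable_funM => //.
  by apply/measurable_EFinP; exact: measurable_int ig.
- move=> x _ /=; rewrite lee_fin !normrM; apply: ler_wpM2r => //.
  exact: le_trans (fC x) (ler_norm _).
- exact: integrableZl.
Qed.

(** Lack of memory: an exponential time exceeds [d] with probability exp(- c d), and its excess over
    [d] is then exponential of the same rate. *)
Lemma exp_law_shift (c : {posnum R}) (d : R) (f : time -> R) : 0 <= d -> bmfun f ->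
  \int[exp_law c]_s f s =
  \int[leb]_(s in `[0, d]) (c%:num * expR (- c%:num * s) * f s) +
  expR (- c%:num * d) * \int[exp_law c]_s f (s + d).
Proof.
move=> d0 bf.
have bfd : bmfun (fun s : time => f (s + d)).
  by apply: bmfun_comp => //; exact: measurable_shift.
rewrite (Rint_exp_law _ bf) (Rint_exp_law _ bfd).
have ipdf : leb.-integrable setT (EFin \o exponential_pdf c%:num).
  exact: integrable_exponential_pdf.
have ifp := integrableM_pdf c bf ipdf.
rewrite -RintegralZl//; last exact: integrableM_pdf.
rewrite [LHS](_ : _ = \int[leb]_(x in `]-oo, d[) (f x * exponential_pdf c%:num x) +
    \int[leb]_(x in `[d, +oo[) (f x * exponential_pdf c%:num x)); last first.
  rewrite -Rintegral_setU//.
  - by rewrite -itv_bndbnd_setU// set_itvE.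
  - by rewrite -itv_bndbnd_setU// set_itvE.
  - rewrite disj_set2E; apply/eqP/seteqP; split => x //= -[].
    by rewrite !in_itv/= andbT leNgt => ->.
congr (_ + _).
- rewrite Rintegral_itv_bndo_bndc; last exact: integrableS ifp.
  rewrite [LHS]Rintegral_mkcond [RHS]Rintegral_mkcond; apply: eq_Rintegral => x _.
  rewrite !patchE /exponential_pdf patchE !mem_setE !in_itv/= andbT.
  by have [x0|x0] := leP 0 x; rewrite ?andbF ?mulr0 ?if_same//=; case: ifP => // _; rewrite mulrC.
- rewrite (@Rint_lebesgue_shift d)//; last 2 first.
  + apply: measurable_funM; first exact: bf.1.
    exact: measurable_exponential_pdf.
  + exact: integrableS ifp.
  rewrite (_ : _ @^-1` _ = `[0, +oo[%classic); last first.
    by apply/seteqP; split => x /=; rewrite !in_itv/= !andbT lerDr.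
  rewrite [LHS]Rintegral_mkcond; apply: eq_Rintegral => x _.
  rewrite !patchE /exponential_pdf !patchE !mem_setE !in_itv/= !andbT.
  have [x0|x0] := leP 0 x; last by rewrite !mulr0.
  by rewrite addr_ge0// mulrDr expRD; ring.
Qed.

End lebesgue_translation.

(** A rational fits between each point of [A] and all later points of [A]; distinct points receive
    distinct rationals. *)
Lemma countable_isolated (R : realType) (A : set R) :
  (forall t, A t -> exists2 e : R, 0 < e & forall s, A s -> t < s -> t + e <= s) ->
  countable A.
Proof.
move=> iso.
have [f Pf] : {f : R -> rat & forall t, A t -> t < ratr (f t) /\
    forall s, A s -> t < s -> ratr (f t) < s}.
  have /choice[f Pf] : forall t, exists q : rat, A t -> t < ratr q /\
      forall s, A s -> t < s -> ratr q < s.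
    move=> t; have [At|nAt] := pselect (A t); last by exists 0 => /nAt.
    have [e e0 eA] := iso t At.
    have [q] := @rat_in_itvoo R t (t + e) ltac:(by rewrite ltrDl).
    rewrite in_itv/= => /andP[tq qe].
    by exists q => _; split => // s As /(eA s As); exact: lt_le_trans.
  by exists f.
apply/countable_injP; exists (pickle \o f) => s t /set_mem As /set_mem At /=.
move=> /(pcan_inj pickleK) fst.
have [s1 s2] := Pf _ As; have [t1 t2] := Pf _ At.
have [st|ts|//] := ltgtP s t.
- by have := s2 _ At st; rewrite fst => /(lt_trans t1); rewrite ltxx.
- by have := t2 _ As ts; rewrite -fst => /(lt_trans s1); rewrite ltxx.
Qed.

(** * The Skorokhod topology *)

Section time_change.
Context (R : realType).
Implicit Types l k : R -> R.

Lemma time_changeP l : time_change l <->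
  [/\ forall t, 0 <= t -> 0 <= l t,
      forall s t, 0 <= s -> s < t -> l s < l t &
      forall u, 0 <= u -> exists2 t, 0 <= t & l t = u].
Proof.
split=> [[[l1 l2 l3] l4]|[l1 l2 l3]]; split.
- by move=> t t0; have := l1 t; rewrite /= !in_itv/= !andbT; exact.
- by move=> s t s0 st; apply: l4 => //; rewrite in_itv/= andbT// (le_trans s0)// ltW.
- move=> u u0; have [|t] := l3 u; first by rewrite /= in_itv/= andbT.
  by rewrite /= in_itv/= andbT => t0 <-; exists t.
- split.
  + by move=> t; rewrite /= !in_itv/= !andbT; exact: l1.
  + move=> s t; rewrite !inE/= !in_itv/= !andbT => s0 t0 lst.
    have [st|ts|//] := ltgtP s t.
    * by have := l2 _ _ s0 st; rewrite lst ltxx.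
    * by have := l2 _ _ t0 ts; rewrite lst ltxx.
  + move=> u; rewrite /= in_itv/= andbT => /l3[t t0 <-].
    by exists t => //=; rewrite in_itv/= andbT.
- by move=> s t; rewrite !in_itv/= !andbT => s0 t0; exact: l2.
Qed.

Lemma time_change_ge0 l t : time_change l -> 0 <= t -> 0 <= l t.
Proof. by move=> /time_changeP[+ _ _]; exact. Qed.

Lemma time_change_lt l s t : time_change l -> 0 <= s -> 0 <= t -> (l s < l t) = (s < t).
Proof.
move=> /time_changeP[_ h _] s0 t0; apply/idP/idP => [|st]; last exact: h.
apply: contraPT; rewrite -leNgt le_eqVlt => /predU1P[->|ts]; first by rewrite ltxx.
by apply/negP; rewrite -leNgt ltW// h.
Qed.

Lemma time_change_le l s t : time_change l -> 0 <= s -> 0 <= t -> (l s <= l t) = (s <= t).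
Proof. by move=> tl s0 t0; rewrite !leNgt time_change_lt. Qed.

Lemma time_change0 l : time_change l -> l 0 = 0.
Proof.
move=> tl; have [_ _ /(_ 0 (lexx _))[t t0 lt0]] := (time_changeP l).1 tl.
apply/eqP; rewrite eq_le time_change_ge0// andbT -[leRHS]lt0.
by rewrite time_change_le.
Qed.

Lemma time_change_id : time_change (@id R).
Proof. by apply/time_changeP; split => // u u0; exists u. Qed.

Lemma time_change_comp l k : time_change l -> time_change k -> time_change (l \o k).
Proof.
move=> tl tk; apply/time_changeP; split => /=.
- by move=> t t0; rewrite !time_change_ge0.
- move=> s t s0 st; have t0 : 0 <= t by rewrite (le_trans s0)// ltW.
  by rewrite !time_change_lt// time_change_ge0.
- move=> u u0.
  have [_ _ /(_ u u0)[t t0 <-]] := (time_changeP l).1 tl.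
  by have [_ _ /(_ t t0)[s s0 <-]] := (time_changeP k).1 tk; exists s.
Qed.

Lemma time_change_inv l : time_change l ->
  exists2 k, time_change k & forall u, 0 <= u -> l (k u) = u.
Proof.
move=> tl; have [l1 l2 l3] := (time_changeP l).1 tl.
have /choice[k Pk] : forall u, exists t, 0 <= u -> 0 <= t /\ l t = u.
  move=> u; have [u0|u0] := leP 0 u; last by exists 0.
  by have [t t0 <-] := l3 u u0; exists t.
exists k; last by move=> u /Pk[].
apply/time_changeP; split.
- by move=> t /Pk[].
- move=> s t s0 st; have t0 : 0 <= t by rewrite (le_trans s0)// ltW.
  have [ks ls] := Pk _ s0; have [kt lt] := Pk _ t0.
  by rewrite -(time_change_lt tl)// ls lt.
- move=> u u0; exists (l u); first exact: l1.
  have [klu lklu] := Pk _ (l1 _ u0).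
  by apply/eqP; rewrite eq_le -(time_change_le tl)// -[X in _ && X](time_change_le tl)// lklu lexx.
Qed.

End time_change.

Section skorokhod_neighborhoods.
Context (R : realType) (E : pseudoPMetricType R).
Local Notation D := (skorokhod E).
Implicit Types X Y Z : D.

Lemma traj_max X t : X t = X (Num.max 0 t).
Proof. by have [//|t0] := leP 0 t; rewrite traj_neg. Qed.

Lemma skorokhod_nbhd_self X T e : 0 < e -> skorokhod_nbhd X T e X.
Proof.
move=> e0; exists id; first exact: time_change_id.
by move=> t _; rewrite subrr normr0; split => //; exact: ballxx.
Qed.

Lemma skorokhod_nbhdS X T T' e e' : T' <= T -> e <= e' ->
  skorokhod_nbhd X T e `<=` skorokhod_nbhd X T' e'.
Proof.
move=> TT ee Y [l tl lY]; exists l => // t /andP[t0 tT].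
have [|h1 h2] := lY t; first by rewrite t0 (le_trans tT).
by split; [exact: lt_le_trans ee|exact: le_ball h2].
Qed.

(** The inverse time change serves. The horizon shrinks by [e] so that the inverse maps it below
    [T]: otherwise [l T] would lie below [T - e], although [l] moves [T] by less than [e]. *)
Lemma skorokhod_nbhd_sym X Y T e : 0 < e -> skorokhod_nbhd X T e Y ->
  skorokhod_nbhd Y (T - e) e X.
Proof.
move=> e0 [l tl lY]; have [k tk lk] := time_change_inv tl.
exists k => // u /andP[u0 uT]; have ku0 := time_change_ge0 tk u0.
have [kuT|Tku] := leP (k u) T.
  have [|] := lY (k u); first by rewrite ku0 kuT.
  by rewrite lk// distrC => h1 /ball_sym.
exfalso; have T0 : 0 <= T by lra.
have [|+ _] := lY T; first by rewrite T0 lexx.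
have := time_change_lt tl T0 ku0; rewrite Tku lk// => lTu.
rewrite ltr_norml => /andP[+ _]; lra.
Qed.

Lemma skorokhod_nbhd_trans X Y Z S T a b : T + b <= S ->
  skorokhod_nbhd X S a Y -> skorokhod_nbhd Y T b Z ->
  skorokhod_nbhd X T (a + b) Z.
Proof.
move=> TS [k tk kY] [l tl lZ]; exists (k \o l) => [|t /andP[t0 tT]].
  exact: time_change_comp.
have [|lt YZ] := lZ t; first by rewrite t0.
have [|kl XY] := kY (l t).
  rewrite time_change_ge0//= (le_trans _ TS)//.
  by move: lt; rewrite ltr_norml => /andP[_]; lra.
split; last exact: ball_triangle XY YZ.
by rewrite /= -(subrKA (l t)) (le_lt_trans (ler_normD _ _))// ltrD.
Qed.

Definition skorokhod_cvg (Y_ : nat -> D) X :=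
  forall T e, 0 < e -> \forall n \near \oo, skorokhod_nbhd X T e (Y_ n).

Lemma skorokhod_cvg_open (Y_ : nat -> D) X (U : set D) :
  skorokhod_cvg Y_ X -> open U -> U X -> \forall n \near \oo, U (Y_ n).
Proof.
move=> YX; rewrite skorokhod_openE => oU /oU[T [e [e0 TU]]].
by near do apply: TU; exact: YX.
Unshelve. all: by end_near. Qed.

(** The neighbourhoods with horizon [n] and tolerance 1/(n+1) are cofinal at each trajectory, so
    openness is sequential. Continuity of a functional can then be proved by dominated
    convergence. *)
Lemma skorokhod_openP (U : set D) :
  (forall X (Y_ : nat -> D), skorokhod_cvg Y_ X -> U X -> exists n, U (Y_ n)) -> open U.
Proof.
move=> seqU; rewrite skorokhod_openE => X UX; apply: contrapT => noU.
have /choice[Y_ PY] : forall n : nat, exists Y, skorokhod_nbhd X n%:R n.+1%:R^-1 Y /\ ~ U Y.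
  move=> n; apply: contrapT => h; apply: noU; exists n%:R, n.+1%:R^-1.
  split; first by rewrite invr_gt0.
  by move=> Y nY; apply: contrapT => UY; apply: h; exists Y.
have [||n] := seqU X Y_; [|by []|by case: (PY n)].
move=> T e e0; near=> n; have [+ _] := PY n; apply: skorokhod_nbhdS.
- by near: n; exact: nbhs_infty_ger.
- by apply: ltW; near: n; exact: (near_infty_natSinv_lt (PosNum e0)).
Unshelve. all: by end_near. Qed.

Lemma skorokhod_continuousP (F : D -> R) : continuous F <->
  (forall X (Y_ : nat -> D), skorokhod_cvg Y_ X -> F (Y_ n) @[n --> \oo] --> F X).
Proof.
split=> [cF X Y_ YX V|seqF].
  move=> /(cF X); rewrite nbhsE => -[U [oU UX] UV].
  by have := skorokhod_cvg_open YX oU UX; apply: filterS => n /UV.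
apply/continuousP => V oV; apply: skorokhod_openP => X Y_ YX VX.
have [|N _ NV] := seqF _ _ YX V; first by apply: open_nbhs_nbhs.
by exists N; apply: NV => /=.
Qed.

Definition continuity_time X t := X s @[s --> t] --> X t.

(** The extension of a trajectory is constant on the left of 0, so right continuity at 0 is
    two-sided. *)
Lemma continuity_time_le0 X t : t <= 0 -> continuity_time X t.
Proof.
move=> t0; apply/cvg_ballP => e e0.
have : \forall u \near (0 : R)^'+, ball (X 0) e (X u).
  by have /cvg_ballP := @traj_rcont _ _ X 0 (lexx _); exact.
move=> [d /= d0 dX]; exists d => //= s ts; rewrite traj_max (traj_max X s).
have -> : Num.max 0 t = 0 by apply/max_idPl.
have [s0|s0] := leP s 0; first exact: ballxx.
apply: dX => //=; move: ts => /=.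
by rewrite !ltr_norml => /andP[? ?]; apply/andP; split; lra.
Qed.

(** Jumps exceeding a fixed size are isolated from the right: just after [t] the path stays within
    half that size of [X t], hence every later point nearby has a whole neighbourhood of small
    increments. *)
Lemma countable_jumps X : countable [set t | ~ continuity_time X t].
Proof.
pose J n := [set t : R | ~ exists2 e : R, 0 < e &
  forall s, `|t - s| < e -> ball (X t) n.+1%:R^-1 (X s)].
apply: (@sub_countable _ _ _ (\bigcup_n J n)).
  apply: subset_card_le => t /= nc; apply: contrapT => nJ; apply: nc.
  apply/cvg_ballP => e e0.
  have [n _ /(_ _ (leqnn n))/= ne] := near_infty_natSinv_lt (PosNum e0).
  have : exists2 d : R, 0 < d & forall s, `|t - s| < d -> ball (X t) n.+1%:R^-1 (X s).
    by apply: contrapT => h; apply: nJ; exists n.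
  move=> [d d0 dX]; exists d => //= s /dX; apply: le_ball; exact: ltW.
apply: bigcup_countable => // n _; apply: countable_isolated => t Jt.
have t0 : 0 <= t.
  rewrite leNgt; apply/negP => t0; apply: Jt.
  have /cvg_ballP/(_ n.+1%:R^-1) := @continuity_time_le0 X t (ltW t0).
  by rewrite invr_gt0 => /(_ (ltr0Sn _ _))[d /= d0 dX]; exists d.
pose r : R := n.+1%:R^-1 / 2.
have r0 : 0 < r by rewrite divr_gt0// invr_gt0.
have : \forall u \near t^'+, ball (X t) r (X u).
  by have /cvg_ballP := @traj_rcont _ _ X t t0; exact.
move=> [d /= d0 dX]; exists d => // s Js ts; rewrite leNgt; apply/negP => std.
apply: Js; exists (Num.min (s - t) (t + d - s)).
  by rewrite lt_min !subr_gt0 ts.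
move=> u; rewrite lt_min !ltr_norml => /andP[/andP[u1 u2] /andP[u3 u4]].
rewrite [n.+1%:R^-1]splitr; apply: (@ball_triangle _ _ (X t)).
  apply: ball_sym; apply: dX => //=; rewrite ltr_norml; apply/andP; split; lra.
by apply: dX => /=; rewrite ?ltr_norml; [apply/andP; split; lra|lra].
Qed.

Lemma jumps_negligible X : (@lebesgue_measure R).-negligible [set t | ~ continuity_time X t].
Proof.
exists [set t | ~ continuity_time X t]; split => //; last first.
  exact: countable_lebesgue_measure0 (countable_jumps X).
exact: countable_measurable (countable_jumps X).
Qed.

Lemma skorokhod_nbhd_local X t e : 0 < e -> continuity_time X t ->
  exists T d, 0 < d /\ forall Y s, skorokhod_nbhd X T d Y -> `|t - s| < d -> ball (X t) e (Y s).
Proof.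
move=> e0 /cvg_ballP/(_ (e / 2)); rewrite divr_gt0// => /(_ isT)[d /= d0 dX].
(* Two displacements share the tolerance [d]: from [t] to [s], and from [s] to its image under the
   time change. Likewise two distances share [e]. *)
pose a := Num.min (d / 2) (e / 2).
have a0 : 0 < a by rewrite lt_min !divr_gt0.
exists (`|t| + a), a; split => // Y s [l tl lY] ts.
rewrite (traj_max Y) [e]splitr.
have ad : a <= d / 2 by rewrite ge_min lexx.
have [|ls] := lY (Num.max 0 s).
  rewrite le_max lexx/= ge_max addr_ge0//= ?(ltW a0)//.
  move: ts; rewrite ltr_norml => /andP[? ?]; have := ler_norm t; lra.
move=> XY; apply: (@ball_triangle _ _ (X (l (Num.max 0 s)))); last first.
  by apply: le_ball XY; rewrite ge_min lexx orbT.
have [s0|s0] := leP 0 s.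
  apply: dX => /=; rewrite -(subrKA s) (le_lt_trans (ler_normD _ _))//.
  move: ls ts; rewrite (max_idPr s0) (distrC (l s)) => ls ts; lra.
rewrite (time_change0 tl) -[X 0](@traj_neg _ _ X s)//; apply: dX => /=; lra.
Qed.

Lemma skorokhod_cvg_pt (Y_ : nat -> D) X (t_ : nat -> R) t :
  skorokhod_cvg Y_ X -> continuity_time X t -> t_ n @[n --> \oo] --> t ->
  Y_ n (t_ n) @[n --> \oo] --> X t.
Proof.
move=> YX ct tt; apply/cvg_ballP => e e0.
have [T [d [d0 h]]] := skorokhod_nbhd_local e0 ct.
near=> n; apply: h; first by near: n; exact: YX.
by near: n; move/cvgr_dist_lt : tt; exact.
Unshelve. all: by end_near. Qed.

End skorokhod_neighborhoods.

Section Cb_facts.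
Context (R : realType) (T : topologicalType).

Lemma Cb_intro (f : T -> R) : continuous f -> (exists C, forall x, `|f x| <= C) ->
  f \in @bounded_continuous R T.
Proof.
move=> cf [C fC]; rewrite inE; split => //.
exists C; split; first exact: num_real.
by move=> M CM x _; rewrite /= (le_trans (fC x))// ltW.
Qed.

Lemma Cb_continuous (f : Cb R T) : continuous f.
Proof. by have := Cb_funP f; rewrite inE => -[]. Qed.

Lemma Cb_bounded (f : Cb R T) : exists2 C, 0 <= C & forall x, `|f x| <= C.
Proof.
have := Cb_funP f; rewrite inE => -[_ [M [_ fM]]].
exists (`|M| + 1) => [|x]; first by rewrite addr_ge0.
by apply: fM => //; rewrite (le_lt_trans (ler_norm M))// ltrDl.
Qed.

End Cb_facts.

Lemma continuous_borel (R : realType) (T : ptopologicalType) (f : T -> R) :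
  continuous f -> measurable_fun setT (f : borel T -> R).
Proof.
move=> /continuousP cf.
apply: (measurability (@RGenOpens.G R)); first exact: RGenOpens.measurableE.
by move=> _ [_ [a [b ->]] <-]; rewrite setTI; apply: sub_sigma_algebra; apply: cf; exact: interval_open.
Qed.

Lemma Cb_bmfun (R : realType) (T : ptopologicalType) (f : Cb R T) :
  bmfun (f : borel T -> R).
Proof.
split; first by apply: continuous_borel; exact: Cb_continuous.
by have [C _ fC] := Cb_bounded f; exists C.
Qed.

(** * Joint measurability of right-continuous processes *)

Section joint_measurability.
Context d (T : measurableType d) (R : realType).
Local Notation time := (measurableTypeR R).

Definition right_continuous (f : R -> R) := forall s, f u @[u --> s^'+] --> f s.

(** Adding 1 to the floor puts the grid point strictly to the right of [s], where right continuity
    applies. *)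
Let grid (n : nat) (s : R) : R := (Num.floor (n.+1%:R * s) + 1)%:~R / n.+1%:R.

Let grid_gt n s : s < grid n s.
Proof.
by rewrite /grid ltr_pdivlMr ?ltr0n// mulrC floorD1_gt.
Qed.

Let grid_le n s : grid n s <= s + n.+1%:R^-1.
Proof.
rewrite /grid ler_pdivrMr ?ltr0n// mulrDl mulVf ?pnatr_eq0//.
by rewrite intrD lerD2r mulrC floor_le_tmp.
Qed.

Let grid_cvg (f : R -> R) s : f u @[u --> s^'+] --> f s ->
  f (grid n s) @[n --> \oo] --> f s.
Proof.
move=> rf; apply/cvgrPdist_lt => e e0.
have /cvgrPdist_lt/(_ e e0)[r /= r0 rX] := rf.
near=> n; apply: rX => //=; rewrite ltr_norml.
have := grid_gt n s; have := grid_le n s.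
have : n.+1%:R^-1 < r by near: n; exact: (near_infty_natSinv_lt (PosNum r0)).
move: (grid n s) n.+1%:R^-1 => g z ? ? ?; apply/andP; split; lra.
Unshelve. all: by end_near. Qed.

Let measurable_grid n (f : time * T -> R) : (forall s, measurable_fun setT (fun x => f (s, x))) ->
  measurable_fun setT (fun z : time * T => f (grid n z.1, z.2)).
Proof.
move=> mf _ B mB; rewrite setTI.
rewrite [X in measurable X](_ : _ = \bigcup_(k : int)
  ([set s : time | Num.floor (n.+1%:R * s) = k] `*`
   ((fun x => f ((k + 1)%:~R / n.+1%:R, x)) @^-1` B))); last first.
  apply/seteqP; split=> [[s x] /= Bf|[s x] [k _ [/= <-]]//].
  by exists (Num.floor (n.+1%:R * s)).
apply: countable_bigcupT_measurable => // k; apply: measurableX.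
- rewrite [X in measurable X](_ : _ = `[k%:~R / n.+1%:R, (k + 1)%:~R / n.+1%:R[%classic).
    exact: measurable_itv.
  apply/seteqP; split => s /=; rewrite in_itv/= ler_pdivrMr ?ltr0n// ltr_pdivlMr ?ltr0n//.
    by move=> <-; rewrite mulrC floor_le_tmp floorD1_gt.
  by rewrite [n.+1%:R * s]mulrC => h; apply/eqP; rewrite floor_eq.
- by rewrite -[X in measurable X]setTI; exact: mf.
Qed.

Lemma measurable_rcont (f : time * T -> R) :
  (forall s, measurable_fun setT (fun x => f (s, x))) ->
  (forall x, right_continuous (fun s => f (s, x))) ->
  measurable_fun setT f.
Proof.
move=> mf rf; apply: (@measurable_fun_cvg _ _ _ _
  (fun n (z : time * T) => f (grid n z.1, z.2))).
- by move=> n; exact: measurable_grid.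
- by move=> [s x] _ /=; apply: (grid_cvg (f := fun s => f (s, x))); exact: rf.
Qed.

End joint_measurability.

Lemma right_continuous_measurable (R : realType) (f : R -> R) :
  right_continuous f -> measurable_fun setT (f : measurableTypeR R -> R).
Proof.
move=> rf; have h : measurable_fun setT (fun z : measurableTypeR R * unit => f z.1).
  by apply: measurable_rcont => // s; exact: measurable_cst.
rewrite (_ : f = (fun z : measurableTypeR R * unit => f z.1) \o (fun s => (s, tt)))//.
by apply: (measurableT_comp h); exact: pair2_measurable.
Qed.

(** Evaluation at a fixed time is not continuous on trajectories, while averages over a time
    interval are; this limit passes from the latter to the former. *)
Lemma cvg_right_average (R : realType) (f : measurableTypeR R -> R) (s : R) : bmfun f ->
  f u @[u --> s^'+] --> f s ->
  n.+1%:R * \int[lebesgue_itv s (s + n.+1%:R^-1)]_u f u @[n --> \oo] --> f s.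
Proof.
move=> bf rf; apply/cvgrPdist_le => e e0.
have /cvgrPdist_le/(_ e e0)[d /= d0 dX] := rf.
near=> n; have nd : n.+1%:R^-1 < d.
  by near: n; exact: (near_infty_natSinv_lt (PosNum d0)).
have n0 : 0 < n.+1%:R^-1 :> R by rewrite invr_gt0.
have sn : s <= s + n.+1%:R^-1 by rewrite lerDl ltW.
have -> : f s = n.+1%:R * \int[lebesgue_itv s (s + n.+1%:R^-1)]_u f s.
  by rewrite Rint_cst mass_lebesgue_itv// addrC addKr mulrCA divff ?mulr1// pnatr_eq0.
rewrite -mulrBr -RintB//; last exact: bmfun_cst.
rewrite normrM ger0_norm// mulrC -ler_pdivlMr ?ltr0n//.
rewrite Rint_lebesgue_itv; last by apply: bmfunB => //; exact: bmfun_cst.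
have -> : e / n.+1%:R = e * (s + n.+1%:R^-1 - s) by rewrite addrC addKr.
apply: Rint_itv_norm_le => //; first by apply: bmfunB => //; exact: bmfun_cst.
move=> u /andP[su un]; have [us|su'] := leP u s.
  have -> : u = s by apply/eqP; rewrite eq_le us.
  by rewrite subrr normr0 ltW.
apply: dX => //=; rewrite ltr_norml.
by move: n.+1%:R^-1 un nd => z un nd; apply/andP; split; lra.
Unshelve. all: by end_near. Qed.

(** * Time integrals and shifts of trajectories *)

Section skorokhod_functionals.
Context (R : realType) (E : pseudoPMetricType R).
Local Notation D := (skorokhod E).
Local Notation time := (measurableTypeR R).
Implicit Types X Y : D.

Lemma traj_right X s : X u @[u --> s^'+] --> X s.
Proof.
have [s0|s0] := leP 0 s; first exact: traj_rcont.
apply: cvg_at_right_filter; exact: (@continuity_time_le0 _ _ X s (ltW s0)).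
Qed.

Lemma right_continuous_traj X (g : E -> R) : continuous g ->
  right_continuous (fun s => g (X s)).
Proof.
by move=> cg s; exact: (cvg_comp _ _ (@traj_right X s) (cg _)).
Qed.

Lemma bmfun_traj X (g : Cb R E) : bmfun (fun s : time => g (X s)).
Proof.
split; last by have [C _ gC] := Cb_bounded g; exists C.
by apply: right_continuous_measurable; apply: right_continuous_traj; exact: Cb_continuous.
Qed.

Lemma bmfun_coord (g : Cb R E) s : bmfun (fun X : borel D => g ((X : D) s)).
Proof.
split; last by have [C _ gC] := Cb_bounded g; exists C.
rewrite (_ : (fun X => _) = fun X : borel D => g ((X : D) (Num.max 0 s))); last first.
  by apply/funext => X; rewrite traj_max.
apply: (measurableT_comp (f := g : borel E -> R)).
  by apply: continuous_borel; exact: Cb_continuous.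
by apply: measurable_coord; rewrite le_max lexx.
Qed.

Lemma bmfun_joint (g : Cb R E) :
  bmfun (fun z : time * borel D => g ((z.2 : D) z.1)).
Proof.
split; last by have [C _ gC] := Cb_bounded g; exists C.
apply: measurable_rcont => [s|X]; first exact: (bmfun_coord g s).1.
exact: right_continuous_traj (@Cb_continuous _ _ g).
Qed.

(** The jump times of the limit trajectory are Lebesgue-null, hence [mu]-null, so convergence at the
    continuity times suffices for dominated convergence. *)
Lemma skorokhod_continuous_Rint (mu : {finite_measure set time -> \bar R})
    (G : time -> D -> R) (C : R) :
  mu `<< (@lebesgue_measure R) ->
  (forall X, measurable_fun setT (G ^~ X)) ->
  (forall s X, `|G s X| <= C) ->
  (forall X (Y_ : nat -> D), skorokhod_cvg Y_ X ->
    forall s, continuity_time X s -> G s (Y_ n) @[n --> \oo] --> G s X) ->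
  continuous (fun X => \int[mu]_s G s X).
Proof.
move=> muleb mG GC cG; apply/skorokhod_continuousP => X Y_ YX.
apply: (@bounded_cvg_Rint _ _ _ mu _ _ C [set s | ~ continuity_time X s]) => //.
- have [A [mA A0 JA]] := jumps_negligible X; exists A; split => //.
  by move/null_content_dominatesP : muleb; exact.
- by move=> s /contrapT cs; exact: cG.
Qed.

Lemma continuous_Rint_traj (mu : {finite_measure set time -> \bar R}) (g : Cb R E) :
  mu `<< (@lebesgue_measure R) -> continuous (fun X : D => \int[mu]_s g (X s)).
Proof.
move=> muleb; have [C _ gC] := Cb_bounded g.
apply: (@skorokhod_continuous_Rint mu (fun s X => g (X s)) C) => //.
- by move=> X; exact: (bmfun_traj X g).1.
- move=> X Y_ YX s cs.
  apply: (cvg_comp (fun n => Y_ n s) g _ (@Cb_continuous _ _ g (X s))).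
  exact: (skorokhod_cvg_pt YX cs (cvg_cst s)).
Qed.

(** The maxima with 0 make the shift total in [r] and its result constant on the negative half-line,
    as [traj_neg] demands. *)
Definition shift (r : R) X : D.
Proof.
pose r' := Num.max 0 r.
refine (@MkSkorokhod _ _ (fun t => X (r' + Num.max 0 t)) _ _ _).
- by move=> t t0; rewrite (max_idPl (ltW t0)) maxxx.
- move=> t t0; rewrite (max_idPr t0).
  have h : X (r' + s) @[s --> t^'+] --> X (r' + t).
    have /cvg_ballP h := @traj_right X (r' + t); apply/cvg_ballP => e e0.
    have [d /= d0 dX] := h e e0; exists d => //= s ts st.
    by apply: dX => /=; [rewrite opprD addrACA subrr add0r|rewrite ltrD2l].
  apply: cvg_trans h; apply: near_eq_cvg; near=> s.
  have st : t < s by near: s; exact: nbhs_right_gt.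
  by rewrite (max_idPr (le_trans t0 (ltW st))).
- move=> t t0.
  have rt : 0 < r' + t by rewrite ltr_wpDl// le_max lexx.
  have /cvg_ex[/= a /cvg_ballP h] := @traj_llim _ _ X (r' + t) rt.
  apply: (@cvgP _ _ a).
  have {}h : X (r' + s) @[s --> t^'-] --> a.
    apply/cvg_ballP => e e0.
    have [d /= d0 dX] := h e e0; exists d => //= s ts st.
    by apply: dX => /=; [rewrite opprD addrACA subrr add0r|rewrite ltrD2l].
  apply: cvg_trans h; apply: near_eq_cvg; near=> s.
  have s0 : 0 < s by near: s; exact: nbhs_left_gt.
  by rewrite (max_idPr (ltW s0)).
Unshelve. all: by end_near.
Defined.

Lemma shiftE r X t : 0 <= r -> 0 <= t -> shift r X t = X (r + t).
Proof. by move=> r0 t0; rewrite /= (max_idPr r0) (max_idPr t0). Qed.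

Lemma skorokhod_ext X Y : (X : R -> E) = Y -> X = Y.
Proof.
case: X => a a1 a2 a3; case: Y => b b1 b2 b3 /= ab; subst b.
by rewrite (Prop_irrelevance a1 b1) (Prop_irrelevance a2 b2) (Prop_irrelevance a3 b3).
Qed.

Lemma shift_max r X : shift (Num.max 0 r) X = shift r X.
Proof.
apply: skorokhod_ext; apply/funext => t /=; congr (X (_ + _)).
by rewrite maxA maxxx.
Qed.

(* The time change [l' t = l (r' + t) - r] need not vanish at [0]; it is
   replaced by a linear one on [[0, k / 2]], where [X (r + _)] is almost constant. *)
Lemma shift_nbhd X Y l (r r' k S a e e' : R) : time_change l ->
  0 < a -> 0 <= r -> 0 <= r' -> 0 < k -> e + e' < k / 2 ->
  (forall t, 0 <= t <= S -> `|l t - t| < e /\ ball (X (l t)) e (Y t)) ->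
  `|r' - r| < e' -> r' + k / 2 <= S ->
  (forall u, Num.min r (l r') <= u <= r + k -> ball (X r) a (X u)) ->
  skorokhod_nbhd (shift r X) (S - r') (a + a + e + e') (shift r' Y).
Proof.
move=> tl a0 r0 r'0 k0 eek lY rr' kS Xr.
have [l1 l2 l3] := (time_changeP l).1 tl.
pose eta := k / 2; have eta0 : 0 < eta by rewrite divr_gt0.
have re0 : 0 <= r' + eta by rewrite addr_ge0// ltW.
pose m := l (r' + eta) - r.
have [|le _] := lY (r' + eta); first by rewrite re0.
have e0 : 0 < e by rewrite (le_lt_trans _ le).
have e'0 : 0 < e' by rewrite (le_lt_trans _ rr').
have m_eta : `|m - eta| < e + e'.
  rewrite (_ : m - eta = (l (r' + eta) - (r' + eta)) + (r' - r)); last by rewrite /m; ring.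
  by rewrite (le_lt_trans (ler_normD _ _))// ltrD.
have [m0 mk] : 0 < m /\ m <= k.
  by move: m_eta; rewrite ltr_norml /eta => /andP[? ?]; split; lra.
pose l' t := if t <= eta then t * (m / eta) else l (r' + t) - r.
have l'eta : l' eta = m by rewrite /l' lexx mulrCA divff ?mulr1// gt_eqF.
have l'ge t : eta <= t -> l' t = l (r' + t) - r.
  rewrite le_eqVlt => /predU1P[<-|et]; first by rewrite l'eta.
  by rewrite /l' leNgt et.
have l'le t : t <= eta -> l' t = t * (m / eta) by rewrite /l' => ->.
have me0 : 0 < m / eta by rewrite divr_gt0.
have l'_lt s t : 0 <= s -> s < t -> l' s < l' t.
  move=> s0 st; have [te|et] := leP t eta.
    by rewrite !l'le ?ltr_pM2r// (le_trans (ltW st)).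
  have [se|es] := leP s eta.
    apply: (@le_lt_trans _ _ m); first by rewrite -l'eta !l'le// ler_pM2r.
    by rewrite l'ge ?ltW// ltrD2r l2// ltrD2l.
  rewrite !l'ge ?(ltW es)// ?(ltW et)// ltrD2r l2 ?ltrD2l//.
  by rewrite addr_ge0.
exists l'.
  apply/time_changeP; split => //.
  - move=> t; rewrite le_eqVlt => /predU1P[<-|t0].
      by rewrite l'le ?mul0r// ltW.
    by rewrite (le_trans _ (ltW (l'_lt 0 t _ t0)))// l'le ?mul0r// ltW.
  - move=> u u0; have [um|mu] := leP u m.
      exists (u * (eta / m)); first by rewrite mulr_ge0// divr_ge0// ltW.
      rewrite l'le; first by field; rewrite !gt_eqF.
      by rewrite mulrA ler_pdivrMr// mulrC ler_pM2l.
    have [w w0 lw] := l3 (u + r) (addr_ge0 u0 r0).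
    have rw : r' + eta < w.
      by rewrite -(time_change_lt tl)// lw -ltrBlDr.
    exists (w - r'); first by rewrite subr_ge0 (le_trans _ (ltW rw))// lerDl ltW.
    by rewrite l'ge ?subrKC ?lw ?addrK// lerBrDl ltW.
move=> t /andP[t0 tS].
have rt0 : 0 <= r' + t by rewrite addr_ge0.
have rtS : r' + t <= S by lra.
have [|lt XY] := lY (r' + t); first by rewrite rt0.
have l't0 : 0 <= l' t.
  move: t0; rewrite le_eqVlt => /predU1P[<-|t0].
    by rewrite l'le ?mul0r// ltW.
  by rewrite (le_trans _ (ltW (l'_lt 0 t _ t0)))// l'le ?mul0r// ltW.
rewrite !shiftE//.
have [te|et] := leP t eta; last first.
  rewrite l'ge ?(ltW et)// subrKC; split.
    rewrite (_ : _ - t = (l (r' + t) - (r' + t)) + (r' - r)); last by ring.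
    rewrite (le_lt_trans (ler_normD _ _))// [ltRHS]addrC.
    have := ltrD lt rr'; lra.
  by apply: le_ball XY; lra.
have l'tm : l' t <= m by rewrite -l'eta !l'le// ler_pM2r.
split.
  rewrite l'le// (_ : _ - t = (t / eta) * (m - eta)); last by field; rewrite gt_eqF.
  have t1 : `|t / eta| <= 1.
    by rewrite ger0_norm ?ler_pdivrMr ?mul1r// divr_ge0// ltW.
  rewrite normrM (@le_lt_trans _ _ `|m - eta|)//; last by lra.
  by rewrite ler_piMl.
rewrite -[a + a + e + e']addrA.
apply: (@ball_triangle _ _ (X (l (r' + t)))); last by apply: le_ball XY; lra.
apply: (@ball_triangle _ _ (X r)).
  apply: ball_sym; apply: Xr; rewrite ge_min lerDl l't0/= lerD2l.
  exact: le_trans mk.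
apply: Xr; rewrite ge_min (time_change_le tl)// lerDl t0 orbT/=.
apply: (@le_trans _ _ (l (r' + eta))).
  by rewrite (time_change_le tl)// lerD2l.
by rewrite -lerBlDl.
Qed.

Lemma skorokhod_cvg_shift (Y_ : nat -> D) X (r : R) : 0 <= r ->
  skorokhod_cvg Y_ X -> continuity_time X r ->
  skorokhod_cvg (fun n => shift r (Y_ n)) (shift r X).
Proof.
move=> r0 YX /cvg_ballP cX T e e0.
have a0 : 0 < e / 4 by rewrite divr_gt0.
have [d /= d0 dX] := cX _ a0.
(* [shift_nbhd] is applied with k = d / 2 and e = e' = b: it requires 2 b < d / 4, and its four
   tolerances, each at most e / 4, add up to [e]. *)
pose b := Num.min (e / 4) (d / 16).
have b0 : 0 < b by rewrite lt_min a0 divr_gt0.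
have ba : b <= e / 4 by rewrite ge_min lexx.
have bd : b <= d / 16 by rewrite ge_min lexx orbT.
have := YX (Num.max T 0 + r + d) b b0; apply: filterS => n [l tl lY].
have T0 : 0 <= Num.max T 0 by rewrite le_max lexx orbT.
have TT : T <= Num.max T 0 by rewrite le_max lexx.
have : skorokhod_nbhd (shift r X) (Num.max T 0 + r + d - r) (e / 4 + e / 4 + b + b) (shift r (Y_ n)).
  apply: (@shift_nbhd _ _ l r r (d / 2)) => //.
  - by rewrite divr_gt0.
  - by lra.
  - by rewrite subrr normr0.
  - by lra.
  - move=> u /andP[u1 u2]; apply: dX => /=.
    have [|+ _] := lY r; first by rewrite r0/=; lra.
    move: u1; rewrite ge_min !ltr_norml => u1 /andP[l1 l2].
    by case/orP: u1 => u1; apply/andP; split; lra.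
by apply: skorokhod_nbhdS; lra.
Qed.

(** With the identity as time change only values of [X] at or after [r] enter, so right continuity
    suffices and [r] may be a jump time. *)
Lemma shift_right X (r T e : R) : 0 <= r -> 0 < e ->
  \forall u \near r^'+, skorokhod_nbhd (shift r X) T e (shift u X).
Proof.
move=> r0 e0; have a0 : 0 < e / 4 by rewrite divr_gt0.
have /cvg_ballP/(_ _ a0)[d /= d0 dX] := @traj_right X r.
pose b := Num.min (e / 4) (d / 16).
have b0 : 0 < b by rewrite lt_min a0 divr_gt0.
have ba : b <= e / 4 by rewrite ge_min lexx.
have bd : b <= d / 16 by rewrite ge_min lexx orbT.
exists b => //= u ru ltru.
have T0 : 0 <= Num.max T 0 by rewrite le_max lexx orbT.
have TT : T <= Num.max T 0 by rewrite le_max lexx.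
have : skorokhod_nbhd (shift r X) (Num.max T 0 + u + d - u) (e / 4 + e / 4 + b + b) (shift u X).
  apply: (@shift_nbhd _ _ id r u (d / 2)) => //.
  - exact: time_change_id.
  - by rewrite (le_trans r0)// ltW.
  - by rewrite divr_gt0.
  - by lra.
  - by move=> t _; rewrite subrr normr0; split => //; exact: ballxx.
  - by rewrite distrC.
  - by lra.
  - move=> v; rewrite (min_idPl (ltW ltru)) => /andP[rv vd].
    move: rv; rewrite le_eqVlt => /predU1P[<-|rv]; first exact: ballxx.
    by apply: dX => //=; rewrite ltr_norml; apply/andP; split; lra.
by apply: skorokhod_nbhdS; lra.
Qed.

Lemma right_continuous_shift (F : D -> R) X : continuous F ->
  right_continuous (fun r => F (shift r X)).
Proof.
move=> cF r V /(cF (shift r X)); rewrite nbhsE => -[U [oU UX] UV].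
have : \forall u \near (Num.max 0 r)^'+, U (shift u X).
  move: oU; rewrite skorokhod_openE => /(_ _ UX)[T [e [e0 TU]]].
  have := @shift_right X (Num.max 0 r) T e; rewrite le_max lexx shift_max.
  by move=> /(_ isT e0); apply: filterS => u; exact: TU.
have [r0|r0] := leP 0 r => h; first by apply: filterS h => u /UV.
have : \forall u \near r^'+, u < 0 by apply: nbhs_right_lt.
apply: filterS => u u0; apply: UV.
rewrite -shift_max (max_idPl (ltW u0)).
by move: UX; rewrite -shift_max (max_idPl (ltW r0)).
Qed.

(** The map is not continuous at a trajectory that jumps at [s]. Its averages over short time
    intervals to the right of [s] are continuous, since almost every shift is by a continuity time,
    and they converge to it by right continuity in [s]. *)
Lemma measurable_shift_Cb (F : Cb R D) (s : R) : 0 <= s ->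
  measurable_fun setT (fun X : borel D => F (shift s X)).
Proof.
move=> s0; have [C C0 FC] := Cb_bounded F.
have bF X : bmfun (fun u : time => F (shift u X)).
  split; last by exists C.
  by apply: right_continuous_measurable; apply: right_continuous_shift; exact: Cb_continuous.
apply: (@measurable_fun_cvg _ _ _ _ (fun n (X : borel D) =>
    n.+1%:R * \int[lebesgue_itv s (s + n.+1%:R^-1)]_u F (shift u X))); last first.
  move=> X _; apply: cvg_right_average (bF X) _.
  by apply: right_continuous_shift; exact: Cb_continuous.
move=> n; apply: measurable_funM => //; apply: continuous_borel.
apply: (@skorokhod_continuous_Rint _ (fun u X => F (shift u X)) C) => //.
- exact: lebesgue_itv_dominates.
- by move=> X; exact: (bF X).1.
- move=> X Y_ YX u cu; rewrite -(shift_max u).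
  under eq_fun do rewrite -(shift_max u).
  have /skorokhod_continuousP := @Cb_continuous _ _ F; apply.
  apply: skorokhod_cvg_shift => //; first by rewrite le_max lexx.
  have [//|u0] := leP 0 u; exact: continuity_time_le0.
Qed.

End skorokhod_functionals.

(** * Open sets of trajectories as cozero sets *)

Section perfectly_normal.
Context (R : realType) (E : pseudoPMetricType R).
Local Notation D := (skorokhod E).
Implicit Types X Y Z : D.

(** Horizon 1/e and tolerance [e] are merged into one parameter. The cap 1/2 yields the triangle
    inequality: composing radii [a] and [b] requires 1/(a + b) + b <= 1/a, that is a (a + b) <=
    1. *)
Let radii X Y : set R := [set e | (0 < e <= 1 / 2 /\ skorokhod_nbhd X e^-1 e Y) \/ e = 1 / 2].

Let has_inf_radii X Y : has_inf (radii X Y).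
Proof.
split; first by exists (1 / 2); right.
by exists 0 => e [[/andP[/ltW]]//|->]; rewrite divr_ge0.
Qed.

(* Not symmetric, but the triangle inequality is enough to make the distance to the
   complement of an open set continuous. *)
Let rho X Y := inf (radii X Y).

Let rho_ge0 X Y : 0 <= rho X Y.
Proof.
apply: lb_le_inf; first exact: (has_inf_radii X Y).1.
by move=> e [[/andP[/ltW]]//|->]; rewrite divr_ge0.
Qed.

Let rho_le X Y e : radii X Y e -> rho X Y <= e.
Proof. by move=> re; apply: ge_inf => //; exact: (has_inf_radii X Y).2. Qed.

Let rho_triangle X Y Z : rho X Z <= rho X Y + rho Y Z.
Proof.
rewrite -lerBlDr; apply: lb_le_inf; first exact: (has_inf_radii X Y).1.
move=> a ra; rewrite lerBlDr addrC -lerBlDr; apply: lb_le_inf.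
  exact: (has_inf_radii Y Z).1.
move=> b rb; rewrite lerBlDr.
have a0 : 0 < a by case: ra => [[/andP[]]//|->].
have b0 : 0 < b by case: rb => [[/andP[]]//|->].
have [ab|ab] := leP (1 / 2) (b + a).
  by apply: le_trans ab; apply: rho_le; right.
case: ra => [[/andP[_ a2] ra]|]; last by lra.
case: rb => [[/andP[_ b2] rb]|]; last by lra.
apply: rho_le; left; split; first by rewrite addr_gt0//= ltW.
rewrite addrC; apply: (@skorokhod_nbhd_trans _ _ X Y Z a^-1) => //.
  rewrite -lerBrDl (_ : a^-1 - (a + b)^-1 = b / (a * (a + b))); last first.
    by field; rewrite !gt_eqF// addr_gt0.
  rewrite ler_pMr// invf_ge1 ?mulr_gt0// ?addr_gt0//.
  have : a * (a + b) <= 1 * 1 by apply: ler_pM => //; lra.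
  by rewrite mulr1.
apply: skorokhod_nbhdS rb => //.
by rewrite lef_pV2 ?posrE// ?addr_gt0// lerDr ltW.
Qed.

Let rho_cvg (Y_ : nat -> D) X : skorokhod_cvg Y_ X ->
  forall e, 0 < e -> \forall n \near \oo, rho X (Y_ n) <= e /\ rho (Y_ n) X <= e.
Proof.
move=> YX e e0; pose a := Num.min e (1 / 2).
have a0 : 0 < a by rewrite lt_min e0 divr_gt0.
have := YX (a^-1 + a) a a0; apply: filterS => n nY.
have ae : a <= e by rewrite ge_min lexx.
have a2 : a <= 1 / 2 by rewrite ge_min lexx orbT.
split; apply: le_trans ae; apply: rho_le; left; rewrite a0 a2; split => //.
  by apply: skorokhod_nbhdS nY => //; rewrite lerDl ltW.
by have := skorokhod_nbhd_sym a0 nY; rewrite addrK.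
Qed.

(** The value 1/2 keeps the set nonempty when [U] is the whole space. *)
Let dist (U : set D) X := inf ([set rho X Z | Z in ~` U] `|` [set 1 / 2]).

Let has_inf_dist U X : has_inf ([set rho X Z | Z in ~` U] `|` [set 1 / 2]).
Proof.
split; first by exists (1 / 2); right.
by exists 0 => e [[Z _ <-]//|->]; rewrite divr_ge0.
Qed.

Let dist_ge0 U X : 0 <= dist U X.
Proof.
apply: lb_le_inf; first exact: (has_inf_dist U X).1.
by move=> e [[Z _ <-]//|->]; rewrite divr_ge0.
Qed.

Let dist_le U X Y : dist U X <= rho X Y + dist U Y.
Proof.
rewrite addrC -lerBlDr; apply: lb_le_inf; first exact: (has_inf_dist U Y).1.
move=> e [[Z UZ <-]|->]; rewrite lerBlDr addrC.
  apply: le_trans (rho_triangle X Y Z); apply: ge_inf; first exact: (has_inf_dist U X).2.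
  by left; exists Z.
apply: (@le_trans _ _ (1 / 2)); last by rewrite lerDr.
by apply: ge_inf; [exact: (has_inf_dist U X).2|right].
Qed.

Let dist_continuous U : continuous (dist U).
Proof.
apply/skorokhod_continuousP => X Y_ YX; apply/cvgrPdist_le => e e0.
have := rho_cvg YX e0; apply: filterS => n [h1 h2].
have := dist_le U X (Y_ n); have := dist_le U (Y_ n) X.
by rewrite ler_norml => ? ?; apply/andP; split; lra.
Qed.

Let dist_out U X : ~ U X -> dist U X = 0.
Proof.
move=> UX; apply/eqP; rewrite eq_le dist_ge0 andbT; apply/ler_addgt0Pl => e e0.
rewrite addr0; apply: (@le_trans _ _ (rho X X)).
  by apply: ge_inf; [exact: (has_inf_dist U X).2|left; exists X].
have YX : skorokhod_cvg (fun=> X) X.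
  by move=> T d d0; apply: nearW => _; exact: skorokhod_nbhd_self.
have [N _ NX] := rho_cvg YX e0.
by have [] := NX N (leqnn _).
Qed.

Let dist_in U X : open U -> U X -> 0 < dist U X.
Proof.
rewrite skorokhod_openE => oU UX; have [T [e [e0 TU]]] := oU _ UX.
pose a := Num.min (1 / 2) (Num.min e (`|T| + 1)^-1).
have T1 : 0 < `|T| + 1 by rewrite ltr_wpDl.
have a0 : 0 < a by rewrite !lt_min divr_gt0//= e0 invr_gt0.
apply: (lt_le_trans a0); apply: lb_le_inf; first exact: (has_inf_dist U X).1.
move=> _ [[Z UZ <-]|->]; last by rewrite ge_min lexx.
apply: lb_le_inf; first exact: (has_inf_radii X Z).1.
move=> b [[/andP[b0 b2] rb]|->]; last by rewrite ge_min lexx.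
rewrite leNgt; apply/negP => ba; apply: UZ; apply: TU.
move: ba; rewrite !lt_min => /and3P[_ be bT].
apply: skorokhod_nbhdS rb; last exact: ltW.
have : `|T| + 1 < b^-1 by rewrite -[ltLHS]invrK ltf_pV2 ?posrE ?invr_gt0.
by have := ler_norm T; lra.
Qed.

(** An open set is exactly where the distance to its complement is positive, so min(1, n dist) tends
    to its indicator. This carries measurability from bounded continuous functionals to Borel
    sets. *)
Lemma open_indic_cvg (U : set D) : open U -> exists G : nat -> Cb R D,
  (forall n X, 0 <= G n X <= 1) /\ forall X, G n X @[n --> \oo] --> (\1_U X : R).
Proof.
move=> oU; pose g (n : nat) X := Num.min 1 (n%:R * dist U X).
have g01 n X : 0 <= g n X <= 1.
  by rewrite le_min ler01 mulr_ge0//= ge_min lexx.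
have gP n : g n \in @bounded_continuous R D.
  apply: Cb_intro; last first.
    by exists 1 => X; have /andP[? ?] := g01 n X; rewrite ger0_norm.
  move=> X; apply: (@continuous_min _ _ (cst 1) (fun X => n%:R * dist U X)).
    exact: cst_continuous.
  by apply: (@continuousM _ _ (cst n%:R)); [exact: cst_continuous|exact: dist_continuous].
exists (fun n => MkCb (gP n)); split => [n X|X] /=; first exact: g01.
rewrite indicE; have [UX|UX] := pselect (U X); last first.
  rewrite memNset//= (_ : (fun n => _) = cst 0); first exact: cvg_cst.
  by apply/funext => n; rewrite /g dist_out// mulr0 min_r.
rewrite mem_set//=; apply: cvg_near_cst.
have d0 := dist_in oU UX.
near=> n; apply/min_idPl; rewrite -ler_pdivrMr//.
near: n; exact: nbhs_infty_ger.
Unshelve. all: by end_near. Qed.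

End perfectly_normal.

Lemma measurable_shift_skorokhod (R : realType) (E : pseudoPMetricType R) (s : R) :
  0 <= s -> measurable_fun setT (fun X : borel (skorokhod E) => shift s X : borel (skorokhod E)).
Proof.
move=> s0; apply: (@measurability _ _ _ (borel (skorokhod E)) _ _ (@open _)) => //.
move=> _ [U oU <-]; rewrite setTI.
have [G [G01 GU]] := open_indic_cvg oU.
have : measurable_fun setT (fun X : borel (skorokhod E) => (\1_U (shift s X) : R)).
  apply: (@measurable_fun_cvg _ _ _ _ (fun n (X : borel (skorokhod E)) => G n (shift s X))).
    by move=> n; exact: measurable_shift_Cb.
  by move=> X _; exact: GU.
move=> /(_ measurableT [set 1] (measurable_set1 _)); rewrite setTI.
congr (measurable _); apply/seteqP; split => X /=; rewrite indicE.
  by case: (boolP (_ \in U)) => [/set_mem//|_ /esym/eqP]; rewrite oner_eq0.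
by move=> UX; rewrite mem_set.
Qed.

(** * The Markov property *)

Section mixture.
Context d1 d2 (T1 : measurableType d1) (T2 : measurableType d2) (R : realType).
Variables (nu : probability T1 R) (k : T1 -> probability T2 R).
Hypothesis mk : forall B, measurable B -> measurable_fun setT (fun x => k x B).

Lemma bmfun_kernel (f : T2 -> R) : bmfun f -> bmfun (fun x => \int[k x]_y f y).
Proof.
move=> bf; have [C C0 fC] := bmfun_ge0 bf; split; last first.
  by exists (C * 1) => x; rewrite -(mass_probability (k x)); exact: Rint_norm_le.
have bfC : bmfun (fun y => f y + C) by apply: bmfunD => //; exact: bmfun_cst.
rewrite (_ : (fun x => _) = (fun x => \int[k x]_y (f y + C) - C)); last first.
  apply/funext => x; rewrite RintD//; last exact: bmfun_cst.
  by rewrite Rint_cst mass_probability mulr1 addrK.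
apply: measurable_funB => //; apply/measurable_EFinP.
rewrite [X in measurable_fun _ X](_ : _ = (fun x => \int[k x]_y (f y + C)%:E)%E); last first.
  by apply/funext => x /=; rewrite integral_bmfun.
apply: (@measurable_fun_integral_kernel _ _ _ _ _ k) => //.
- by move=> y; rewrite lee_fin; have := fC y; rewrite ler_norml => /andP[+ _]; lra.
- by apply/measurable_EFinP; exact: bfC.1.
Qed.

Let gk : T1 -> giry T2 R := fun x => k x.

Let mgk : measurable_fun setT gk.
Proof. by apply: measurable_giry_codensity => // B mB; exact: mk. Qed.

Let mix : {measure set T2 -> \bar R} := giry_bind nu mgk.

Let mixE (f : T2 -> \bar R) : measurable_fun setT f -> (forall x, 0 <= f x)%E ->
  (\int[mix]_y f y = \int[nu]_x \int[k x]_y f y)%E.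
Proof. by move=> mf f0; rewrite -[LHS]/(giry_int (giry_bind nu mgk) f) giry_int_bind. Qed.

Let mix1 : mix setT = 1%E.
Proof.
rewrite -[LHS]mul1e -(integral_cst _ measurableT) mixE//.
rewrite (eq_integral (cst 1%E)); last first.
  by move=> x _; rewrite /= integral_cst// mul1e; exact: probability_setT.
by rewrite integral_cst// mul1e; exact: probability_setT.
Qed.

Lemma ex_mixture : exists Q : probability T2 R, forall f, bmfun f ->
  \int[Q]_y f y = \int[nu]_x \int[k x]_y f y.
Proof.
exists (probability_of_measure mix1) => f bf; set Q := probability_of_measure mix1.
have [C C0 fC] := bmfun_ge0 bf.
have bfC : bmfun (fun y => f y + C) by apply: bmfunD => //; exact: bmfun_cst.
have f0 y : 0 <= f y + C.
  by have := fC y; rewrite ler_norml => /andP[+ _]; lra.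
suff : \int[Q]_y (f y + C) = \int[nu]_x \int[k x]_y (f y + C).
  rewrite (RintD _ bf (bmfun_cst _ _)) Rint_cst mass_probability.
  rewrite (_ : \int[nu]_x \int[k x]_y (f y + C) = \int[nu]_x (\int[k x]_y f y + C)).
    rewrite (RintD _ (bmfun_kernel bf) (bmfun_cst _ _)) Rint_cst mass_probability.
    exact: addIr.
  apply: eq_Rintegral => x _.
  by rewrite (RintD _ bf (bmfun_cst _ _)) Rint_cst mass_probability mulr1.
apply: EFin_inj; rewrite -integral_bmfun// -integral_bmfun; last exact: bmfun_kernel.
rewrite -[LHS]/(\int[mix]_y (f y + C)%:E)%E mixE//.
- by apply: eq_integral => x _; rewrite integral_bmfun.
- by apply/measurable_EFinP; exact: bfC.1.
Qed.

End mixture.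

Section markov.
Context (R : realType) (E : pseudoPMetricType R) (A : set (Cb R E * Cb R E)).
Local Notation D := (borel (skorokhod E)).
Local Notation time := (measurableTypeR R).
Variable P : E -> probability D R.
Hypothesis A_well_posed : well_posed A.
Hypothesis P_solution : forall x : E,
  solves_martingale_problem A (@dirac _ (borel E) x R) (P x).
Hypothesis P_continuous : continuous (P : E -> prob_weak R (skorokhod E)).

Lemma continuous_Rint_Cb (F : Cb R (skorokhod E)) :
  continuous (fun y => \int[P y]_X F X).
Proof.
move=> y.
have h1 := @initial_continuous _ _ (@prob_integral R (skorokhod E)) (P y).
have h2 := @proj_continuous (Cb R (skorokhod E)) (fun=> R) F (prob_integral (P y)).
exact: (cvg_comp _ _ (cvg_comp _ _ (@P_continuous y) h1) h2).
Qed.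

(** Weak continuity handles bounded continuous functionals, [open_indic_cvg] open sets; these are
    stable under intersection and generate the Borel sets, so a Dynkin argument concludes. *)
Lemma measurable_P (B : set D) : measurable B ->
  measurable_fun setT (fun y : borel E => P y B).
Proof.
move=> mB; have mE (V : set D) : measurable V ->
    measurable_fun setT (fun y : borel E => P y V) <->
    measurable_fun setT (fun y : borel E => \int[P y]_X (\1_V X : R)).
  move=> mV; rewrite -measurable_EFinP.
  rewrite (_ : EFin \o _ = (fun y : borel E => P y V))//.
  by apply/funext => y /=; rewrite probability_Rint.
apply: (@dynkin_induction _ D (@open (skorokhod E))
  (fun B => measurable_fun setT (fun y : borel E => P y B))) mB => //.
- exact: openI.
- rewrite (_ : (fun y => _) = cst 1%E)//.
  by apply/funext => y; rewrite probability_setT.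
- move=> U oU; apply/mE; first exact: sub_sigma_algebra.
  have [G [G01 GU]] := open_indic_cvg oU.
  apply: (@measurable_fun_cvg _ _ _ _ (fun n (y : borel E) => \int[P y]_X G n X)).
    by move=> n; apply: continuous_borel; exact: continuous_Rint_Cb.
  move=> y _; apply: (@bounded_cvg_RintT _ _ _ (P y) (fun n X => G n X) _ 1) => //.
    by move=> n; exact: (Cb_bmfun (G n)).1.
  by move=> n X; have /andP[? ?] := G01 n X; rewrite ger0_norm.
- move=> S mS PS; rewrite (_ : (fun y => _) = (fun y => 1 - P y S)%E); last first.
    by apply/funext => y; rewrite probability_setC.
  exact: emeasurable_funB.
- move=> F mF tF PF.
  rewrite (_ : (fun y => _) = (fun y => \sum_(0 <= k <oo) P y (F k))%E); last first.
    by apply/funext => y; rewrite measure_semi_bigcup//; exact: bigcup_measurable.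
  exact: ge0_emeasurable_sum.
Qed.

Lemma bmfun_Rint_P (F : D -> R) : bmfun F -> bmfun (fun y : borel E => \int[P y]_X F X).
Proof. by move=> bF; apply: bmfun_kernel => //; exact: measurable_P. Qed.

Lemma bmfun_itv_traj (g : Cb R E) (a b : R) :
  bmfun (fun X : D => \int[lebesgue_measure]_(s in `[a, b]) g ((X : skorokhod E) s)).
Proof.
rewrite (_ : (fun X => _) = (fun X : D => \int[lebesgue_itv a b]_s g ((X : skorokhod E) s))).
  (* The Dirac mass merely fills the place of the second finite measure in the Fubini lemma. *)
  exact: (@bmfun_Rint2 _ _ _ _ _ (lebesgue_itv a b) (@dirac _ D point R) _ (bmfun_joint g)).
by apply/funext => X; rewrite Rint_lebesgue_itv//; exact: bmfun_traj.
Qed.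

Lemma bmfun_martingale_process (f g : Cb R E) t : bmfun (@martingale_process R E f g t).
Proof.
by apply: bmfunB; [apply: bmfunB; exact: bmfun_coord|exact: bmfun_itv_traj].
Qed.

Lemma coord_filtration_measurable t (B : set (skorokhod E)) : coord_filtration t B ->
  measurable (B : set D).
Proof.
move=> FB; have := @measurable_to_upto R E t measurableT B FB.
by rewrite setTI.
Qed.

Lemma coord_filtrationS s t : s <= t -> @coord_filtration R E s `<=` @coord_filtration R E t.
Proof.
move=> st; apply: sub_sigma_algebra2 => _ [u /andP[u0 us] [B mB ->]].
by exists u; [rewrite u0 (le_trans us)|exists B].
Qed.

Lemma coord_filtration_shift s t (B : set (skorokhod E)) : 0 <= s -> coord_filtration t B ->
  coord_filtration (s + t) (shift s @^-1` B).
Proof.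
move=> s0 FB.
have : measurable_fun setT ((fun X => shift s X) : skorokhod_upto E (s + t) -> skorokhod_upto E t).
  apply: (@measurability _ _ _ (skorokhod_upto E t) _ _ (@coord_gen R E t)) => //.
  move=> _ [_ [u /andP[u0 ut] [V mV ->]] <-]; rewrite setTI; apply: sub_sigma_algebra.
  exists (s + u); first by rewrite addr_ge0//= lerD2l.
  exists V => //; apply/seteqP; split => X;
    by rewrite /preimage/= (max_idPr s0) (max_idPr u0).
by move=> /(_ measurableT B FB); rewrite setTI.
Qed.

Lemma martingale_process_shift (f g : Cb R E) s t (X : skorokhod E) : 0 <= s -> 0 <= t ->
  martingale_process f g t (shift s X : D) =
  martingale_process f g (s + t) (X : D) - martingale_process f g s (X : D).
Proof.
move=> s0 t0; rewrite /martingale_process !shiftE// addr0.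
rewrite (@Rint_itv_cat _ 0 s (s + t)) ?lerDl//; last exact: bmfun_traj.
have -> : \int[lebesgue_measure]_(x in `[s, s + t]) g (X x) =
    \int[lebesgue_measure]_(x in `[0, t]) g (shift s X x).
  rewrite (_ : `[s, s + t] = `[0 + s, t + s]); last by rewrite add0r addrC.
  rewrite Rint_itv_shift; last exact: bmfun_traj.
  apply: eq_Rintegral => x; rewrite inE/= in_itv/= => /andP[x0 _].
  by rewrite (max_idPr s0) (max_idPr x0) addrC.
by ring.
Qed.

Lemma Rint_martingale (f g : Cb R E) y s t (B : set (skorokhod E)) : A (f, g) ->
  0 <= s -> s <= t -> coord_filtration s B ->
  \int[P y]_X (\1_(B : set D) X * martingale_process f g t X) =
  \int[P y]_X (\1_(B : set D) X * martingale_process f g s X).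
Proof.
move=> Afg s0 st FB; have [_ H] := P_solution y; have [_ H2] := H f g Afg.
have e (C : D -> R) : \int[P y]_(x in (B : set D)) C x = \int[P y]_X (\1_(B : set D) X * C X).
  exact: (Rint_indic (P y)).
by rewrite -!e; exact: H2.
Qed.

Lemma solves_of_Rint (nu : probability (borel E) R) (Q : probability D R) :
  (forall B : set (borel E), measurable B ->
    \int[Q]_X (\1_B ((X : skorokhod E) 0) : R) = \int[nu]_y \1_B y) ->
  (forall f g s t (B : set (skorokhod E)), A (f, g) -> 0 <= s -> s <= t ->
    coord_filtration s B ->
    \int[Q]_X (\1_(B : set D) X * martingale_process f g t X) =
    \int[Q]_X (\1_(B : set D) X * martingale_process f g s X)) ->
  solves_martingale_problem A nu Q.
Proof.
move=> Q0 Qm; split.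
- move=> B mB; rewrite [RHS]probability_Rint// -Q0// probability_Rint.
    by congr (_%:E); apply: eq_Rintegral => X _; rewrite !indicE.
  have := @measurable_coord R E 0 (lexx _) measurableT B mB.
  by rewrite setTI.
- move=> f g Afg; split.
    (* Adaptedness does not involve the measure, so it is read off the solution started at
       [point]. *)
    move=> t t0; have [_ /(_ f g Afg)[/(_ t t0)[h _] _]] := P_solution point.
    by split => //; apply: bmfun_integrable; exact: bmfun_martingale_process.
  move=> s t s0 st B FB; have := Qm f g s t B Afg s0 st FB.
  by rewrite -!Rint_indic.
Qed.

(* The law of [shift s X] under [P x] conditioned on [B], and the mixture of the [P y] over
   the conditional law of [X s], solve the same martingale problem. *)
Let markov_indic x s (B : set (skorokhod E)) (F : D -> R) : 0 <= s ->
  coord_filtration s B -> bmfun F ->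
  \int[P x]_X (\1_(B : set D) X * F (shift s X)) =
  \int[P x]_X (\1_(B : set D) X * \int[P ((X : skorokhod E) s)]_Y F Y).
Proof.
move=> s0 FB bF; have mB := coord_filtration_measurable FB.
have b1 : bmfun (\1_(B : set D) : D -> R) by exact: bmfun_indic.
pose p := \int[P x]_X \1_(B : set D) X.
have p0 : 0 <= p by apply: Rintegral_ge0 => X _; rewrite indicE.
have mcs := measurable_coord (R := R) (E := E) s0.
have msh := measurable_shift_skorokhod (R := R) (E := E) s0.
have bFs : bmfun (fun X : D => F (shift s X : D)) by exact: bmfun_comp bF msh.
have bKs : bmfun (fun X : D => \int[P ((X : skorokhod E) s)]_Y F Y).
  exact: (bmfun_comp (bmfun_Rint_P bF) mcs).
(* A null event cannot be conditioned on, but then both sides vanish. *)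
move: p0; rewrite le_eqVlt => /predU1P[p0|p0].
  have B0 : P x B = 0%E by rewrite probability_Rint// -/p -p0.
  have Z (Y : D -> R) : bmfun Y -> \int[P x]_X (\1_(B : set D) X * Y X) = 0.
    move=> bY; rewrite -Rint_indic /Rintegral null_set_integral//.
    by apply: measurable_funTS; apply/measurable_EFinP; exact: bY.1.
  by rewrite !Z.
pose w (X : D) := p^-1 * \1_(B : set D) X.
have bw : bmfun w by exact: bmfunZ.
have w0 X : 0 <= w X by rewrite /w mulr_ge0 ?invr_ge0 ?(ltW p0)// indicE.
have w1 : \int[P x]_X w X = 1 by rewrite RintZ// mulVf// gt_eqF.
have [nu nuE] := ex_density_pushforward bw w0 w1 mcs.
have [Q QE] := ex_density_pushforward bw w0 w1 msh.
have [M ME] := ex_mixture nu measurable_P.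
have wZ (Y : D -> R) : bmfun Y ->
    \int[P x]_X (w X * Y X) = p^-1 * \int[P x]_X (\1_(B : set D) X * Y X).
  move=> bY; rewrite -RintZ; last exact: bmfunM b1 bY.
  by apply: eq_Rintegral => X _; rewrite /w mulrA.
have QM : forall C, measurable C -> Q C = M C.
  have [_ uniq] := A_well_posed nu; apply: uniq.
  - apply: solves_of_Rint => [C mC|f g a b C Afg a0 ab FC].
      have mc0 := measurable_coord (R := R) (E := E) (lexx 0).
      rewrite QE; last exact: (bmfun_comp (bmfun_indic R mC) mc0).
      rewrite nuE; last exact: bmfun_indic.
      by apply: eq_Rintegral => X _; rewrite shiftE// addr0.
    have mC := coord_filtration_measurable FC.
    have bC : bmfun (\1_(C : set D) : D -> R) by exact: bmfun_indic.
    have bm t : bmfun (fun X : D => \1_(C : set D) X * martingale_process f g t X).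
      by apply: bmfunM => //; exact: bmfun_martingale_process.
    (* An event of the shifted path up to [a], intersected with [B], belongs to the filtration at
       [s + a]; the martingale property under [P x] then applies between [s + a] and [s + b]. *)
    have FBC : coord_filtration (s + a) (B `&` shift s @^-1` C).
      have h1 : coord_filtration (s + a) B.
        by apply: coord_filtrationS FB; rewrite lerDl.
      exact: (@measurableI _ (skorokhod_upto E (s + a)) _ _ h1 (coord_filtration_shift s0 FC)).
    have mBC := coord_filtration_measurable FBC.
    have red t : 0 <= t -> \int[Q]_X (\1_(C : set D) X * martingale_process f g t X) =
        p^-1 * (\int[P x]_X (\1_(B `&` shift s @^-1` C : set D) X * martingale_process f g (s + t) X) -
        \int[P x]_X (\1_(B `&` shift s @^-1` C : set D) X * martingale_process f g s X)).
      move=> t0; rewrite QE// wZ; last exact: bmfun_comp (bm t) msh.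
      congr (_ * _); rewrite -RintB.
      + apply: eq_Rintegral => X _; rewrite martingale_process_shift// -mulrBr mulrA; congr (_ * _).
        by rewrite !indicE in_setI /=; case: (X \in B); rewrite ?mul0r ?mul1r// !mem_setE.
      + by apply: bmfunM; [exact: bmfun_indic mBC|exact: bmfun_martingale_process].
      + by apply: bmfunM; [exact: bmfun_indic mBC|exact: bmfun_martingale_process].
    have sa0 := addr_ge0 s0 a0.
    have sab : s + a <= s + b by rewrite lerD2l.
    by rewrite (red b (le_trans a0 ab)) (red a a0) (Rint_martingale x Afg sa0 sab FBC).
  - apply: solves_of_Rint => [C mC|f g a b C Afg a0 ab FC].
      have mc0 := measurable_coord (R := R) (E := E) (lexx 0).
      rewrite ME; last exact: (bmfun_comp (bmfun_indic R mC) mc0).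
      apply: eq_Rintegral => y _.
      have [h _] := P_solution y.
      have mC0 : measurable ([set X : skorokhod E | C (X 0)] : set D).
        by have := mc0 measurableT C mC; rewrite setTI.
      transitivity (\int[P y]_X (\1_[set X : skorokhod E | C (X 0)] X : R)).
        by apply: eq_Rintegral => X _; rewrite !indicE.
      by apply: EFin_inj; rewrite -probability_Rint//; exact: h.
    have mC := coord_filtration_measurable FC.
    have bm t : bmfun (fun X : D => \1_(C : set D) X * martingale_process f g t X).
      by apply: bmfunM; [exact: bmfun_indic|exact: bmfun_martingale_process].
    rewrite (ME _ (bm a)) (ME _ (bm b)); apply: eq_Rintegral => y _.
    exact: (Rint_martingale y Afg a0 ab FC).
have : \int[Q]_X F X = \int[M]_X F X by exact: eq_measure_Rint.
move=> e; apply: (@mulfI _ p^-1); first by rewrite invr_eq0 gt_eqF.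
by rewrite -(wZ _ bFs) -(wZ _ bKs) -(QE _ bF) -(nuE _ (bmfun_Rint_P bF)) -(ME _ bF).
Qed.

(** Events extend to bounded weights [Z] by [Rint_sub_sigma], applied to the identity seen as a map
    into the coarser sigma-algebra. *)
Lemma markov x s (Z : skorokhod_upto E s -> R) (F : D -> R) : 0 <= s ->
  bmfun Z -> bmfun F ->
  \int[P x]_X (Z X * F (shift s X)) =
  \int[P x]_X (Z X * \int[P ((X : skorokhod E) s)]_Y F Y).
Proof.
move=> s0 bZ bF.
apply: (@Rint_sub_sigma _ _ _ _ _ (P x) (@to_upto R E s)) => //.
- exact: (bmfun_comp bF (measurable_shift_skorokhod (R := R) (E := E) s0)).
- exact: (bmfun_comp (bmfun_Rint_P bF) (measurable_coord (R := R) (E := E) s0)).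
- by move=> B mB; exact: markov_indic.
Qed.

End markov.

(** * The Feller property *)

Lemma seq_continuous (R : realType) (E : pseudoMetricType R) (f : E -> R) :
  (forall x (x_ : nat -> E), x_ n @[n --> \oo] --> x -> f (x_ n) @[n --> \oo] --> f x) ->
  continuous f.
Proof.
move=> sf x; apply/cvgrPdist_lt => e e0; apply: contrapT => nf.
have /choice[x_ Px] : forall n : nat, exists y, ball x n.+1%:R^-1 y /\ e <= `|f x - f y|.
  move=> n; apply: contrapT => h; apply: nf.
  have : \forall y \near x, ball x n.+1%:R^-1 y by apply: nbhsx_ballx; rewrite invr_gt0.
  by apply: filterS => y xy; rewrite ltNge; apply/negP => ef; apply: h; exists y.
have xx : x_ n @[n --> \oo] --> x.
  apply/cvg_ballP => d d0; near=> n.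
  have [+ _] := Px n; apply: le_ball; apply: ltW; near: n.
  exact: (near_infty_natSinv_lt (PosNum d0)).
have /cvgrPdist_lt/(_ e e0)[N _ /(_ N (leqnn N))/=] := sf x x_ xx.
by have [_] := Px N; rewrite leNgt => /negP.
Unshelve. all: by end_near. Qed.

(** * Continuous functionals controlling the oscillation of a path *)

Section oscillation.
Context (R : realType) (E : pseudoPMetricType R).
Local Notation D := (skorokhod E).
Implicit Types X Y : D.

Lemma traj_left X t : exists a : E, X s @[s --> t^'-] --> a.
Proof.
have [t0|t0] := leP t 0.
  exists (X t); apply: cvg_at_left_filter; exact: (@continuity_time_le0 _ _ X _ t0).
by have /cvg_ex[a Xa] := @traj_llim _ _ X t t0; exists a.
Qed.

(** A continuous [g] need not be uniformly continuous, but near each time the path is close either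
    to its value there or to its left limit. Continuity of [g] at these two points and compactness
    of the time interval give a uniform radius along the path. *)
Lemma uniform_near_path (g : Cb R E) X (T e : R) : 0 < e ->
  \forall d \near 0^'+, forall s, 0 <= s <= T ->
    forall y, ball (X s) d y -> `|g (X s) - g y| < e.
Proof.
move=> e0; have e20 : 0 < e / 2 by rewrite divr_gt0.
have loc a : exists2 r : R, 0 < r & forall z y, ball a r z -> ball z r y -> `|g z - g y| < e.
  have /cvgrPdist_lt/(_ _ e20)/nbhs_ballP[r /= r0 rg] := @Cb_continuous _ _ g a.
  exists (r / 2); first by rewrite divr_gt0.
  move=> z y az zy; rewrite -(subrKA (g a)) (le_lt_trans (ler_normD _ _))//.
  rewrite [e]splitr ltrD//.
    by rewrite distrC; apply: rg; apply: le_ball az; rewrite ler_pdivrMr// ler_pMr// ler1n.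
  by apply: rg; rewrite [r]splitr; exact: ball_triangle az zy.
have /compact_near_coveringP := @segment_compact R 0 T.
move=> /(_ R (0^'+) (fun d s => forall y, ball (X s) d y -> `|g (X s) - g y| < e) _) h.
have : \forall d \near 0^'+, `[0, T]%classic `<=` (fun s => forall y, ball (X s) d y -> `|g (X s) - g y| < e).
  apply: h => s _.
  have [a Xa] := traj_left X s.
  have [r1 r10 h1] := loc (X s); have [r2 r20 h2] := loc a.
  have /cvg_ballP/(_ _ r10)[d1 /= d10 hd1] := @traj_right _ _ X s.
  have /cvg_ballP/(_ _ r20)[d2 /= d20 hd2] := Xa.
  exists (ball s (Num.min d1 d2), [set d : R | 0 < d < Num.min r1 r2]) => /=.
    split; first by apply: nbhsx_ballx; rewrite lt_min d10.
    exists (Num.min r1 r2) => /=; first by rewrite lt_min r10.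
    by move=> d /=; rewrite sub0r normrN => dr d0; rewrite d0/=; move: dr; rewrite gtr0_norm.
  move=> [u d] /= [su /andP[d0 dr]] y Xuy.
  move: dr; rewrite lt_min => /andP[dr1 dr2].
  move: su; rewrite /ball/= lt_min => /andP[su1 su2].
  have [us|su|us] := ltgtP u s.
  - apply: h2; first exact: hd2.
    by apply: le_ball Xuy; exact: ltW.
  - apply: h1; first exact: hd1.
    by apply: le_ball Xuy; exact: ltW.
  - rewrite us in Xuy *; apply: h1; first exact: ballxx.
    by apply: le_ball Xuy; exact: ltW.
by apply: filterS => d hd s /andP[s0 sT]; apply: hd; rewrite /= in_itv/= s0.
Qed.

(* The graphs of [g \o Y_ n] and [g \o X] are Hausdorff-close on ]-oo, T]. *)
Lemma skorokhod_cvg_graph (g : Cb R E) (Y_ : nat -> D) X (T e : R) :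
  skorokhod_cvg Y_ X -> 0 < e ->
  \forall n \near \oo,
    (forall u, u <= T -> exists2 v, `|u - v| < e & `|g (Y_ n u) - g (X v)| < e) /\
    (forall v, v <= T -> exists2 u, `|u - v| < e & `|g (Y_ n u) - g (X v)| < e).
Proof.
move=> YX e0.
have [d /= d0 hd] := @uniform_near_path g X (`|T| + e + 1) e e0.
pose r := Num.min (d / 2) (Num.min e 1).
have r0 : 0 < r by rewrite !lt_min divr_gt0// e0/=.
have rd : r <= d / 2 by rewrite ge_min lexx.
have re : r <= e by rewrite !ge_min lexx orbT.
have r1 : r <= 1 by rewrite !ge_min lexx !orbT.
have hr : forall s, 0 <= s <= `|T| + e + 1 -> forall y, ball (X s) r y -> `|g (X s) - g y| < e.
  by apply: hd => //=; rewrite sub0r normrN gtr0_norm//; lra.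
have := YX (`|T| + e) r r0; apply: filterS => n [l tl lY].
have T0 := normr_ge0 T; have TT := ler_norm T.
have key u : 0 <= u -> u <= `|T| + e -> `|u - l u| < e /\ `|g (Y_ n u) - g (X (l u))| < e.
  move=> u0 uT; have [|lu XY] := lY u; first by rewrite u0.
  split; first by rewrite distrC (lt_le_trans lu).
  rewrite distrC; apply: hr => //; rewrite (time_change_ge0 tl)//=.
  by move: lu; rewrite ltr_norml => /andP[? ?]; lra.
split=> u uT.
- have [u0|u0] := leP 0 u.
    by have [|? ?] := key u u0 _; [lra|exists (l u)].
  exists u; first by rewrite subrr normr0.
  rewrite traj_neg// (@traj_neg _ _ X u)//.
  by have [//||_] := key 0; [lra|rewrite (time_change0 tl)].
- have [u0|u0] := leP 0 u; last first.
    exists u; first by rewrite subrr normr0.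
    rewrite traj_neg// (@traj_neg _ _ X u)//.
    by have [//||_] := key 0; [lra|rewrite (time_change0 tl)].
  have [_ _ /(_ u u0)[w w0 lw]] := (time_changeP l).1 tl.
  have wT : w <= `|T| + e.
    rewrite leNgt; apply/negP => Tw.
    have Te : 0 <= `|T| + e by lra.
    have := time_change_lt tl Te w0; rewrite Tw lw => lTu.
    have [|+ _] := lY (`|T| + e); first by rewrite Te lexx.
    by rewrite ltr_norml => /andP[? ?]; lra.
  by have [? ?] := key w w0 wT; exists w; rewrite -lw.
Qed.

Section osc_def.
Variables (g : Cb R E) (t d : R).
Hypothesis d0 : 0 < d.

Let C := sval (cid2 (Cb_bounded g)).
Let C0 : 0 <= C. Proof. by rewrite /C; case: cid2. Qed.
Let gC x : `|g x| <= C. Proof. by rewrite /C; case: cid2. Qed.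

(** The slope for which the penalty, zero up to distance [d] from [t], reaches at distance 2 d the
    value 2 C, the largest possible increment of [g]. *)
Let K := 2 * C / d.
Let K0 : 0 <= K. Proof. by rewrite divr_ge0 ?mulr_ge0// ltW. Qed.
Let pen u := K * Num.max 0 (`|u - t| - d).

Let pen_ge0 u : 0 <= pen u.
Proof. by rewrite mulr_ge0// le_max lexx. Qed.

Let pen_near u : `|u - t| <= d -> pen u = 0.
Proof. by move=> ut; rewrite /pen max_l ?subr_le0// mulr0. Qed.

Let pen_lip u v e : `|u - v| <= e -> pen v <= pen u + K * e.
Proof.
move=> uve; rewrite /pen -mulrDr ler_wpM2l// ge_max; apply/andP; split.
  by rewrite addr_ge0// ?le_max ?lexx// (le_trans _ uve).
have h : `|v - t| - d <= (`|u - t| - d) + e.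
  have : `|v - t| <= `|u - t| + `|u - v|.
    by rewrite (distrC u v) -[v - t](subrKA u) addrC; exact: ler_normD.
  lra.
by rewrite (le_trans h)// lerD2r le_max lexx orbT.
Qed.

Let pen_far u : 2 * d <= `|u - t| -> 2 * C <= pen u.
Proof.
move=> du; have -> : 2 * C = K * d by rewrite /K divfK// gt_eqF.
by rewrite ler_wpM2l// le_max; apply/orP; right; lra.
Qed.

Let terms X : set R := [set z | exists u v,
  z = `|g (X u) - g (X v)| - pen u - pen v].

(* A penalised supremum, so that the oscillation is a continuous functional:
   it lies between the oscillations over radius [d] and over radius [2 d]. *)
Definition osc X := sup (terms X).

Let dist_le u v X : `|g (X u) - g (X v)| <= 2 * C.
Proof.
rewrite (le_trans (ler_normB _ _))//; have := gC (X u); have := gC (X v); lra.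
Qed.

Let has_sup_terms X : has_sup (terms X).
Proof.
split; first by exists (`|g (X t) - g (X t)| - pen t - pen t), t, t.
exists (2 * C) => _ [u [v ->]].
have := dist_le u v X; have := pen_ge0 u; have := pen_ge0 v; lra.
Qed.

Let term_le u v X : `|g (X u) - g (X v)| - pen u - pen v <= osc X.
Proof. by apply: ub_le_sup; [exact: (has_sup_terms X).2|exists u, v]. Qed.

Lemma osc_ge0 X : 0 <= osc X.
Proof.
apply: le_trans (term_le t t X).
by rewrite pen_near ?subrr ?normr0 ?subr0// ltW.
Qed.

Lemma osc_ge u v X : `|u - t| <= d -> `|v - t| <= d -> `|g (X u) - g (X v)| <= osc X.
Proof.
move=> ut vt; apply: le_trans (term_le u v X).
by rewrite !pen_near// !subr0.
Qed.

Lemma osc_le e X : 0 <= e ->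
  (forall u v, `|u - t| < 2 * d -> `|v - t| < 2 * d -> `|g (X u) - g (X v)| <= e) ->
  osc X <= e.
Proof.
move=> e0 h; apply: ge_sup; first exact: (has_sup_terms X).1.
move=> _ [u [v ->]]; have pu := pen_ge0 u; have pv := pen_ge0 v; have gd := dist_le u v X.
have [ut|ut] := ltP `|u - t| (2 * d); last first.
  by have := pen_far ut; lra.
have [vt|vt] := ltP `|v - t| (2 * d); last first.
  by have := pen_far vt; lra.
by have := h u v ut vt; lra.
Qed.

Lemma osc_bounded X : `|osc X| <= 2 * C.
Proof. by rewrite ger0_norm ?osc_ge0// osc_le// mulr_ge0. Qed.

(** Moving each of the two points to its partner on the other graph costs [e] in the value of [g]
    and at most K e in the penalty, whence the factor 2 (1 + K). *)
Let osc_cmp X Y e : 0 < e ->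
  (forall u, u <= t + 2 * d -> exists2 v, `|u - v| < e & `|g (Y u) - g (X v)| < e) ->
  osc Y <= osc X + 2 * (1 + K) * e.
Proof.
move=> e0 h; have oX := osc_ge0 X; have Ke : 0 <= K * e by rewrite mulr_ge0// ltW.
apply: ge_sup; first exact: (has_sup_terms Y).1.
move=> _ [u [v ->]]; have pu := pen_ge0 u; have pv := pen_ge0 v; have gd := dist_le u v Y.
have [ut|ut] := ltP `|u - t| (2 * d); last first.
  by have := pen_far ut; lra.
have [vt|vt] := ltP `|v - t| (2 * d); last first.
  by have := pen_far vt; lra.
have ltd w : `|w - t| < 2 * d -> w <= t + 2 * d.
  by rewrite ltr_norml => /andP[? ?]; lra.
have [u' uu' gu] := h u (ltd _ ut); have [v' vv' gv] := h v (ltd _ vt).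
have p1 := pen_lip (ltW uu'); have p2 := pen_lip (ltW vv').
have := term_le u' v' X.
have : `|g (Y u) - g (Y v)| <= `|g (Y u) - g (X u')| + `|g (X u') - g (X v')| + `|g (Y v) - g (X v')|.
  rewrite (_ : g (Y u) - g (Y v) = (g (Y u) - g (X u')) + (g (X u') - g (X v')) - (g (Y v) - g (X v'))).
    by rewrite (le_trans (ler_normB _ _))// lerD2r ler_normD.
  by ring.
move: gu gv p1 p2; lra.
Qed.

Lemma continuous_osc : continuous osc.
Proof.
apply/skorokhod_continuousP => X Y_ YX; apply/cvgrPdist_le => e e0.
have K2 : 0 < 2 * (1 + K) by rewrite mulr_gt0// ltr_wpDr.
have e'0 : 0 < e / (2 * (1 + K)) by rewrite divr_gt0.
have := skorokhod_cvg_graph g (t + 2 * d) YX e'0; apply: filterS => n [h1 h2].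
have a1 := osc_cmp e'0 h1.
have a2 : osc X <= osc (Y_ n) + 2 * (1 + K) * (e / (2 * (1 + K))).
  apply: osc_cmp => // u /h2[v uv gv]; exists v; first by rewrite distrC.
  by rewrite distrC.
move: a1 a2; rewrite mulrCA divff ?gt_eqF// mulr1 ler_norml => a1 a2.
by apply/andP; split; lra.
Qed.

Lemma osc_Cb : osc \in @bounded_continuous R D.
Proof.
by apply: Cb_intro; [exact: continuous_osc|exists (2 * C); exact: osc_bounded].
Qed.

End osc_def.

Lemma osc_cvg0 (g : Cb R E) t X (d_ : nat -> R) (d_gt0 : forall n, 0 < d_ n) :
  d_ n @[n --> \oo] --> 0 -> g (X s) @[s --> t] --> g (X t) ->
  osc g t (d_ n) X @[n --> \oo] --> 0.
Proof.
move=> dd0 gX; apply/cvgrPdist_le => e e0.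
have e20 : 0 < e / 2 by rewrite divr_gt0.
have /cvgrPdist_le/(_ _ e20)[r /= r0 rg] := gX.
have r20 : 0 < r / 2 by rewrite divr_gt0.
near=> n; rewrite sub0r normrN ger0_norm ?osc_ge0//.
have dr : 2 * d_ n < r.
  have : `|0 - d_ n| < r / 2 by near: n; move/cvgrPdist_lt : dd0; exact.
  by rewrite sub0r normrN gtr0_norm//; lra.
apply: osc_le => //; first exact: ltW.
move=> u v ut vt.
have hu : `|g (X t) - g (X u)| <= e / 2 by apply: rg => /=; rewrite distrC (lt_trans ut).
have hv : `|g (X t) - g (X v)| <= e / 2 by apply: rg => /=; rewrite distrC (lt_trans vt).
rewrite (_ : g (X u) - g (X v) = (g (X t) - g (X v)) - (g (X t) - g (X u))); last by ring.
by rewrite (le_trans (ler_normB _ _))//; lra.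
Unshelve. all: by end_near. Qed.

End oscillation.

Lemma Cb_sqr (R : realType) (T : topologicalType) (g : Cb R T) :
  (fun x => g x ^+ 2) \in @bounded_continuous R T.
Proof.
have [C C0 gC] := Cb_bounded g; apply: Cb_intro; last first.
  by exists (C ^+ 2) => x; rewrite normrX lerXn2r ?nnegrE.
move=> x; under eq_fun do rewrite expr2.
by apply: (@continuousM _ _ g g); exact: Cb_continuous.
Qed.

Lemma bmfun_coord_upto (R : realType) (E : pseudoPMetricType R) (f : borel E -> R) (u s : R) :
  bmfun f -> 0 <= u <= s ->
  bmfun (fun X : skorokhod_upto E s => f ((X : skorokhod E) u)).
Proof.
move=> bf us; split; last by have [_ [C fC]] := bf; exists C.
move=> _ B mB; rewrite setTI; apply: sub_sigma_algebra; exists u => //.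
by exists (f @^-1` B) => //; rewrite -[X in measurable X]setTI; exact: bf.1.
Qed.

Lemma bmfun_at (R : realType) (E : pseudoPMetricType R) (f : borel E -> R) (s : R) :
  0 <= s -> bmfun f -> bmfun (fun X : borel (skorokhod E) => f ((X : skorokhod E) s)).
Proof. by move=> s0 bf; exact: (bmfun_comp bf (measurable_coord s0)). Qed.

(** * Joint continuity of the transition semigroup *)

Section feller.
Context (R : realType) (E : pseudoPMetricType R).
Local Notation D := (borel (skorokhod E)).

(** The interface between the martingale problem and the rest of the proof: initial law, weak
    continuity, measurability in the starting point, Markov property. *)
Definition markov_family (P : E -> probability D R) : Prop :=
  [/\ forall x (f : borel E -> R), bmfun f ->
        \int[P x]_X f ((X : skorokhod E) 0) = f x,
      forall F : Cb R (skorokhod E), continuous (fun y => \int[P y]_X F X),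
      forall F : D -> R, bmfun F -> bmfun (fun y : borel E => \int[P y]_X F X) &
      forall x s (Z : skorokhod_upto E s -> R) (F : D -> R), 0 <= s ->
        bmfun Z -> bmfun F ->
        \int[P x]_X (Z X * F (shift s X)) =
        \int[P x]_X (Z X * \int[P ((X : skorokhod E) s)]_Y F Y)].

Variable P : E -> probability D R.
Hypothesis PM : markov_family P.

Let P_init : forall x (f : borel E -> R), bmfun f ->
  \int[P x]_X f ((X : skorokhod E) 0) = f x.
Proof. by have [] := PM. Qed.

Let P_cont : forall F : Cb R (skorokhod E), continuous (fun y => \int[P y]_X F X).
Proof. by have [] := PM. Qed.

Let P_bmfun : forall F : D -> R, bmfun F ->
  bmfun (fun y : borel E => \int[P y]_X F X).
Proof. by have [] := PM. Qed.

Let P_markov : forall x s (Z : skorokhod_upto E s -> R) (F : D -> R), 0 <= s ->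
  bmfun Z -> bmfun F ->
  \int[P x]_X (Z X * F (shift s X)) =
  \int[P x]_X (Z X * \int[P ((X : skorokhod E) s)]_Y F Y).
Proof. by have [] := PM. Qed.

Definition transition (t : R) (g : E -> R) (x : E) : R :=
  \int[P x]_X g ((X : skorokhod E) t).

Lemma transition_norm_le t (g : Cb R E) (C : R) x : (forall y, `|g y| <= C) ->
  `|transition t g x| <= C.
Proof.
move=> gC; rewrite -[C]mulr1 -(mass_probability (P x)).
by apply: Rint_norm_le => //; exact: bmfun_coord.
Qed.

Lemma transition0 (g : Cb R E) x : transition 0 g x = g x.
Proof. by rewrite /transition (P_init x (Cb_bmfun g)). Qed.

Lemma bmfun_transition t (g : Cb R E) : bmfun (transition t g : borel E -> R).
Proof. by apply: P_bmfun; exact: bmfun_coord. Qed.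

(** A continuous functional that replaces evaluation at [t]; by [average_le] the oscillation bounds
    the error, simultaneously for all times within [d] of [t]. *)
Let average (g : Cb R E) (t d : R) (X : skorokhod E) : R :=
  d^-1 * \int[lebesgue_itv t (t + d)]_u g (X u).

Let average_Cb (g : Cb R E) (t d : R) : 0 < d -> average g t d \in @bounded_continuous R (skorokhod E).
Proof.
move=> d0; have [C C0 gC] := Cb_bounded g; apply: Cb_intro.
  move=> X; apply: (@continuousM _ _ (cst d^-1) (fun X : skorokhod E => \int[lebesgue_itv t (t + d)]_u g (X u))).
    exact: cst_continuous.
  by apply: continuous_Rint_traj; exact: lebesgue_itv_dominates.
exists (d^-1 * (C * d)) => X; rewrite normrM ger0_norm ?invr_ge0 ?(ltW d0)//.
rewrite ler_wpM2l ?invr_ge0 ?(ltW d0)//.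
rewrite [X in _ <= C * X](_ : _ = mass (lebesgue_itv t (t + d))); last first.
  by rewrite mass_lebesgue_itv ?lerDl ?(ltW d0)// addrC addKr.
by apply: Rint_norm_le => //; exact: bmfun_traj.
Qed.

Let average_le (g : Cb R E) (t d s : R) (X : skorokhod E) : 0 < d -> `|s - t| <= d -> `|g (X s) - average g t d X| <= osc g t d X.
Proof.
move=> d0 st; have bg := bmfun_traj X g.
have td : t <= t + d by rewrite lerDl ltW.
have -> : g (X s) = d^-1 * \int[lebesgue_itv t (t + d)]_u g (X s).
  by rewrite Rint_cst mass_lebesgue_itv// [t + d]addrC addrK mulrCA mulVf ?mulr1// gt_eqF.
rewrite /average -mulrBr -RintB//; last exact: bmfun_cst.
rewrite normrM gtr0_norm ?invr_gt0// ler_pdivrMl// mulrC.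
have bb : bmfun (fun u : measurableTypeR R => g (X s) - g (X u)).
  by apply: bmfunB => //; exact: bmfun_cst.
rewrite Rint_lebesgue_itv// (_ : _ * d = osc g t d X * (t + d - t)); last first.
  by rewrite addrC addKr mulrC.
apply: Rint_itv_norm_le => // u /andP[tu ud]; apply: osc_ge => //.
by rewrite ger0_norm ?subr_ge0// lerBlDl.
Qed.

(** Evaluation near [t] is replaced by the average, with error at most the oscillation. Both are
    continuous functionals, so their means converge along the starting points, and the mean
    oscillation under [P x] is small for small [d] by the almost sure continuity at [t]. *)
Let transition_cvg_ae (g : Cb R E) (t : R) (x : E) (t_ : nat -> R) (x_ : nat -> E) :
  {ae P x, forall X : D, g ((X : skorokhod E) s) @[s --> t] --> g ((X : skorokhod E) t)} ->
  t_ n @[n --> \oo] --> t -> x_ n @[n --> \oo] --> x ->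
  transition (t_ n) g (x_ n) @[n --> \oo] --> transition t g x.
Proof.
move=> aeg tt xx; apply/cvgrPdist_le => e e0.
have e40 : 0 < e / 4 by rewrite divr_gt0.
pose d_ (k : nat) : R := k.+1%:R^-1.
have d_0 k : 0 < d_ k by rewrite invr_gt0.
have d_cvg : d_ k @[k --> \oo] --> 0 by exact: cvg_harmonic.
have [C C0 gC] := Cb_bounded g.
have bosc k : bmfun (osc g t (d_ k) : D -> R) by exact: (Cb_bmfun (MkCb (osc_Cb g t (d_0 k)))).
have osc2 k X : `|osc g t (d_ k) X| <= 2 * C.
  rewrite ger0_norm ?osc_ge0//; apply: osc_le; rewrite ?mulr_ge0// => u v _ _.
  by rewrite (le_trans (ler_normB _ _))//; have := gC (X u); have := gC (X v); lra.
have : \int[P x]_X osc g t (d_ k) X @[k --> \oo] --> \int[P x]_X 0.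
  case: aeg => N [mN N0 subN].
  apply: (@bounded_cvg_Rint _ _ _ (P x) (fun k => osc g t (d_ k) : D -> R) (cst 0) (2 * C) N) => //.
  - by move=> k; exact: (bosc k).1.
  - by exists N; split.
  - move=> X NX; apply: osc_cvg0 => //; apply: contrapT => h; apply: NX.
    exact: subN.
rewrite Rint_cst mul0r => /cvgrPdist_le/(_ _ e40)[k _ /(_ k (leqnn k))/=].
set d := d_ k; have d0 : 0 < d by exact: d_0.
rewrite sub0r normrN => oscx.
pose Th := MkCb (osc_Cb g t d0); pose Av := MkCb (average_Cb g t d0).
have bTh : bmfun (Th : D -> R) by exact: Cb_bmfun.
have bAv : bmfun (Av : D -> R) by exact: Cb_bmfun.
have key y s : `|s - t| <= d -> `|transition s g y - \int[P y]_X Av X| <= \int[P y]_X Th X.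
  move=> st; have bg := bmfun_coord g s; rewrite /transition -RintB//.
  apply: le_trans (le_normr_Rintegral _ _) _ => //.
    by apply: bmfun_integrable; exact: bmfunB.
  apply: le_Rint => //; first by apply: bmfun_norm; exact: bmfunB.
  by move=> X; exact: average_le.
have tht : \int[P x]_X Th X <= e / 4 by apply: le_trans oscx; exact: ler_norm.
have keyx : `|transition t g x - \int[P x]_X Av X| <= e / 4.
  by apply: le_trans tht; apply: key; rewrite subrr normr0 ltW.
near=> n.
have h1 : `|\int[P x]_X Th X - \int[P (x_ n)]_X Th X| <= e / 4.
  by near: n; have := cvg_comp _ _ xx (@P_cont Th x); move/cvgrPdist_le; exact.
have h2 : `|\int[P x]_X Av X - \int[P (x_ n)]_X Av X| <= e / 4.
  by near: n; have := cvg_comp _ _ xx (@P_cont Av x); move/cvgrPdist_le; exact.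
have h3 : `|t_ n - t| <= d.
  by rewrite distrC; near: n; move/cvgrPdist_le : tt; apply; exact: d_0.
have h4 := key (x_ n) (t_ n) h3.
move: keyx h1 h2 h4 tht; clear; rewrite !ler_norml.
move: (transition _ _ _) (transition _ _ _) (\int[P x]_X Av X) (\int[P x]_X Th X).
move: (\int[P (x_ n)]_X Av X) (\int[P (x_ n)]_X Th X) => z1 z2 z3 z4 z5 z6.
move=> /andP[? ?] /andP[? ?] /andP[? ?] /andP[? ?] ?; apply/andP; split; lra.
Unshelve. all: by end_near. Qed.

Let transition_cvg0 (g : Cb R E) (x : E) (t_ : nat -> R) (x_ : nat -> E) :
  t_ n @[n --> \oo] --> 0 -> x_ n @[n --> \oo] --> x ->
  transition (t_ n) g (x_ n) @[n --> \oo] --> g x.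
Proof.
move=> tt xx; rewrite -(transition0 g x); apply: transition_cvg_ae => //.
apply: aeW => X; apply: (cvg_comp _ _ (@continuity_time_le0 _ _ X _ (lexx _))).
exact: Cb_continuous.
Qed.

Lemma transition_two x s d (f g : Cb R E) : 0 <= s -> 0 <= d ->
  \int[P x]_X (f ((X : skorokhod E) s) * g ((X : skorokhod E) (s + d))) =
  \int[P x]_X (f ((X : skorokhod E) s) * transition d g ((X : skorokhod E) s)).
Proof.
move=> s0 d0.
have bZ : bmfun (fun X : skorokhod_upto E s => f ((X : skorokhod E) s)).
  by apply: bmfun_coord_upto; [exact: Cb_bmfun|rewrite s0 lexx].
rewrite -(P_markov x s0 bZ (bmfun_coord g d)).
by apply: eq_Rintegral => X _; rewrite shiftE.
Qed.

Lemma Cb_cst (a : R) : (cst a : E -> R) \in @bounded_continuous R E.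
Proof. by apply: Cb_intro; [exact: cst_continuous|exists `|a|]. Qed.

(** Let s_n increase to [t]. Given X(s_n), the mean square of the increment of [g] up to [t] is
    [psi n] at X(s_n). These points converge to the left limit and the elapsed times to 0, so
    [transition_cvg0] sends [psi n] to 0. Hence g(X t) agrees almost surely with its left limit
    [b]. *)
Let ae_continuous (g : Cb R E) (t : R) (x : E) : 0 <= t ->
  {ae P x, forall X : D, g ((X : skorokhod E) s) @[s --> t] --> g ((X : skorokhod E) t)}.
Proof.
rewrite le_eqVlt => /predU1P[<-|t0].
  apply: aeW => X; apply: (cvg_comp _ _ (@continuity_time_le0 _ _ X _ (lexx _))).
  exact: Cb_continuous.
have [C C0 gC] := Cb_bounded g.
pose d_ (n : nat) := t * n.+1%:R^-1; pose s_ n := t - d_ n.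
have d_gt0 n : 0 < d_ n by rewrite mulr_gt0// invr_gt0.
have s_ge0 n : 0 <= s_ n by rewrite subr_ge0 ger_pMr// invf_le1// ler1n.
have s_lt n : s_ n < t by rewrite ltrBlDr ltrDl.
have d_cvg : d_ n @[n --> \oo] --> 0.
  by rewrite -[0](mulr0 t); apply: cvgM; [exact: cvg_cst|exact: cvg_harmonic].
have s_cvg (X : skorokhod E) (a : E) : X s @[s --> t^'-] --> a -> X (s_ n) @[n --> \oo] --> a.
  move=> /cvg_ballP Xa; apply/cvg_ballP => e e0.
  have [r /= r0 rX] := Xa e e0; near=> n; apply: rX => //=.
  rewrite opprB addrCA subrr addr0 gtr0_norm//.
  have : `|0 - d_ n| < r by near: n; move/cvgrPdist_lt : d_cvg; exact.
  by rewrite sub0r normrN gtr0_norm.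
pose b (X : D) := lim (g ((X : skorokhod E) (s_ n)) @[n --> \oo]).
have gs_cvg (X : skorokhod E) (a : E) : X s @[s --> t^'-] --> a -> g (X (s_ n)) @[n --> \oo] --> g a.
  by move=> Xa; exact: (cvg_comp _ _ (s_cvg _ _ Xa) (@Cb_continuous _ _ g a)).
have bE (X : skorokhod E) (a : E) : X s @[s --> t^'-] --> a -> b X = g a.
  by move=> Xa; apply/cvg_lim => //; exact: gs_cvg.
have b_cvg (X : D) : g ((X : skorokhod E) (s_ n)) @[n --> \oo] --> b X.
  by have [a Xa] := traj_left X t; rewrite (bE X a Xa); exact: gs_cvg.
have bb : bmfun b.
  apply: (bmfun_lim (f_ := fun n (X : D) => g ((X : skorokhod E) (s_ n))) (C := C)) => //.
  by move=> n; exact: (bmfun_coord g (s_ n)).1.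
pose g2 := MkCb (Cb_sqr g); pose one := MkCb (Cb_cst 1).
pose h n (X : D) := (g ((X : skorokhod E) t) - g ((X : skorokhod E) (s_ n))) ^+ 2.
(* The mean of (g(X(d_n)) - g y)^2 under [P y], expanded so that only transitions of bounded
   continuous functions occur. *)
pose psi n (y : E) := transition (d_ n) g2 y - 2 * (g y * transition (d_ n) g y) + g2 y.
have bh n : bmfun (h n).
  have b0 : bmfun (fun X : D => g ((X : skorokhod E) t) - g ((X : skorokhod E) (s_ n))).
    by apply: bmfunB; exact: bmfun_coord.
  exact: (bmfunM b0 b0).
have hpsi n : \int[P x]_X h n X = \int[P x]_X psi n ((X : skorokhod E) (s_ n)).
  have sd : s_ n + d_ n = t by rewrite subrK.
  have bt (k : Cb R E) : bmfun (fun X : D => transition (d_ n) k ((X : skorokhod E) (s_ n))).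
    exact: (bmfun_at (s_ge0 n) (bmfun_transition (d_ n) k)).
  have e2 := transition_two x one g2 (s_ge0 n) (ltW (d_gt0 n)).
  have e1 := transition_two x g g (s_ge0 n) (ltW (d_gt0 n)).
  rewrite sd in e1 e2.
  transitivity (\int[P x]_X (one ((X : skorokhod E) (s_ n)) * g2 ((X : skorokhod E) t)) -
      2 * \int[P x]_X (g ((X : skorokhod E) (s_ n)) * g ((X : skorokhod E) t)) +
      \int[P x]_X g2 ((X : skorokhod E) (s_ n))).
    rewrite -RintZ; last by apply: bmfunM; exact: bmfun_coord.
    rewrite -RintB; last 2 first.
    - by apply: bmfunM; exact: bmfun_coord.
    - by apply: bmfunZ; apply: bmfunM; exact: bmfun_coord.
    rewrite -RintD; last 2 first.
    - by apply: bmfunB; [|apply: bmfunZ]; apply: bmfunM; exact: bmfun_coord.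
    - exact: bmfun_coord.
    by apply: eq_Rintegral => X _; rewrite /h /=; ring.
  rewrite e1 e2 -RintZ; last by apply: bmfunM => //; exact: bmfun_coord.
  rewrite -RintB; last 2 first.
  - by apply: bmfunM => //; exact: bmfun_coord.
  - by apply: bmfunZ; apply: bmfunM => //; exact: bmfun_coord.
  rewrite -RintD; last 2 first.
  - by apply: bmfunB; [|apply: bmfunZ]; apply: bmfunM => //; exact: bmfun_coord.
  - exact: bmfun_coord.
  by apply: eq_Rintegral => X _; rewrite /psi /= mul1r.
have h_cvg : \int[P x]_X h n X @[n --> \oo] --> \int[P x]_X (g ((X : skorokhod E) t) - b X) ^+ 2.
  apply: (@bounded_cvg_RintT _ _ _ (P x) h _ ((2 * C) ^+ 2)).
  - by move=> n; exact: (bh n).1.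
  - move=> n X; rewrite normrX lerXn2r ?nnegrE ?mulr_ge0//.
    rewrite (le_trans (ler_normB _ _))//.
    by have := gC ((X : skorokhod E) t); have := gC ((X : skorokhod E) (s_ n)); lra.
  - move=> X; rewrite /h; apply: (@cvgM R); (apply: cvgB; [exact: cvg_cst|exact: b_cvg]).
have psi_cvg : \int[P x]_X psi n ((X : skorokhod E) (s_ n)) @[n --> \oo] --> \int[P x]_X 0.
  have trC n y : `|transition (d_ n) g y| <= C by exact: transition_norm_le.
  have g2C y : `|g2 y| <= C ^+ 2 by rewrite /= normrX lerXn2r ?nnegrE.
  have tr2C n y : `|transition (d_ n) g2 y| <= C ^+ 2 by exact: transition_norm_le.
  apply: (@bounded_cvg_RintT _ _ _ (P x) (fun n (X : D) => psi n ((X : skorokhod E) (s_ n))) _ (4 * C ^+ 2)).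
  - move=> n; have mt (k : Cb R E) : measurable_fun setT (fun X : D => transition (d_ n) k ((X : skorokhod E) (s_ n))).
      exact: (bmfun_at (s_ge0 n) (bmfun_transition (d_ n) k)).1.
    have mg (k : Cb R E) := (bmfun_coord k (s_ n)).1.
    apply: measurable_funD; last exact: mg.
    apply: measurable_funB; first exact: mt.
    by apply: measurable_funM => //; apply: measurable_funM => //; exact: mt.
  - move=> n X; set y := (X : skorokhod E) (s_ n).
    have : `|g y * transition (d_ n) g y| <= C ^+ 2.
      by rewrite normrM expr2; apply: ler_pM.
    have := g2C y; have := tr2C n y; rewrite /psi !ler_norml.
    by move=> /andP[? ?] /andP[? ?] /andP[? ?]; apply/andP; split; lra.
  - move=> X; have [a Xa] := traj_left X t.
    have c1 := @transition_cvg0 g2 _ _ _ d_cvg (s_cvg _ _ Xa).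
    have c2 := @transition_cvg0 g _ _ _ d_cvg (s_cvg _ _ Xa).
    have c3 := gs_cvg _ _ Xa.
    have c4 := cvg_comp _ _ (s_cvg _ _ Xa) (@Cb_continuous _ _ g2 a).
    rewrite (_ : 0 = g2 a - 2 * (g a * g a) + g2 a); last by rewrite /=; ring.
    apply: cvgD => //; apply: cvgB => //.
    by apply: cvgM; [exact: cvg_cst|exact: cvgM].
have bgb : bmfun (fun X : D => g ((X : skorokhod E) t) - b X).
  by apply: bmfunB => //; exact: bmfun_coord.
have bgb2 : bmfun (fun X : D => (g ((X : skorokhod E) t) - b X) ^+ 2) by exact: (bmfunM bgb bgb).
have : \int[P x]_X (g ((X : skorokhod E) t) - b X) ^+ 2 = 0.
  rewrite -[RHS](_ : \int[P x]_X 0 = 0); last by rewrite Rint_cst mul0r.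
  move: h_cvg; rewrite (funext hpsi) => h_cvg.
  exact: (cvg_unique (@Rhausdorff R) h_cvg psi_cvg).
move=> Ri0; have i0 := integral_bmfun (P x) bgb2; rewrite Ri0 in i0.
have : ae_eq (P x) setT (fun X : D => ((g ((X : skorokhod E) t) - b X) ^+ 2)%:E) (cst 0%E).
  apply/ae_eq_integral_abs => //; first by apply/measurable_EFinP; exact: bgb2.1.
  rewrite -[RHS]i0; apply: eq_integral => X _.
  by rewrite gee0_abs// lee_fin sqr_ge0.
apply: filterS => X /(_ Logic.I)[] /eqP.
rewrite sqrf_eq0 subr_eq0 => /eqP gb; have [a Xa] := traj_left X t.
apply/left_right_continuousP; split; last first.
  exact: (@right_continuous_traj _ _ X g (@Cb_continuous _ _ g) t).
by rewrite gb (bE X a Xa); exact: (cvg_comp _ _ Xa (@Cb_continuous _ _ g a)).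
Unshelve. all: by end_near. Qed.

Lemma transition_cvg (g : Cb R E) (t : R) (x : E) (t_ : nat -> R) (x_ : nat -> E) : 0 <= t ->
  t_ n @[n --> \oo] --> t -> x_ n @[n --> \oo] --> x ->
  transition (t_ n) g (x_ n) @[n --> \oo] --> transition t g x.
Proof. by move=> t0; apply: transition_cvg_ae; exact: ae_continuous. Qed.

Lemma transition_Cb (g : Cb R E) (t : R) : 0 <= t -> transition t g \in @bounded_continuous R E.
Proof.
move=> t0; have [C C0 gC] := Cb_bounded g; apply: Cb_intro; last first.
  by exists C => x; exact: transition_norm_le.
by apply: seq_continuous => x x_ xx; apply: transition_cvg => //; exact: cvg_cst.
Qed.

End feller.

(** * The linear resolvent *)

Section probability_bounds.
Context d (T : measurableType d) (R : realType) (P : probability T R).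
Implicit Types f : T -> R.

Lemma prob_norm_le f (C : R) : bmfun f -> (forall x, `|f x| <= C) -> `|\int[P]_x f x| <= C.
Proof. by rewrite -[X in _ -> _ -> _ <= X]mulr1 -[X in _ * X](mass_probability P); exact: Rint_norm_le. Qed.

Lemma prob_le f (C : R) : bmfun f -> (forall x, f x <= C) -> \int[P]_x f x <= C.
Proof. by rewrite -[X in _ -> _ -> _ <= X]mulr1 -[X in _ * X](mass_probability P); exact: Rint_le. Qed.

Lemma prob_ge f (C : R) : bmfun f -> (forall x, C <= f x) -> C <= \int[P]_x f x.
Proof. by rewrite -[X in _ -> _ -> X <= _]mulr1 -[X in _ * X](mass_probability P); exact: Rint_ge. Qed.

End probability_bounds.

Section time_integral.
Context (R : realType) (E : pseudoPMetricType R).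
Local Notation D := (borel (skorokhod E)).
Local Notation time := (measurableTypeR R).

Definition time_integral (q : E -> R) (t : R) (X : skorokhod E) : R :=
  \int[lebesgue_measure]_(s in `[0, t]) q (X s).

Lemma bmfun_time_integral (q : Cb R E) t : bmfun (time_integral q t : D -> R).
Proof. exact: bmfun_itv_traj. Qed.

Lemma time_integral_norm_le (q : Cb R E) (C t : R) X : 0 <= t ->
  (forall y, `|q y| <= C) -> `|time_integral q t X| <= C * t.
Proof.
move=> t0 qC; rewrite -[X in _ <= C * X]subr0.
by apply: Rint_itv_norm_le => //; exact: bmfun_traj.
Qed.

Lemma time_integral_cat (q : Cb R E) (s t : R) X : 0 <= s -> 0 <= t ->
  time_integral q (s + t) X = time_integral q s X + time_integral q t (shift s X).
Proof.
move=> s0 t0; have bq := bmfun_traj X q; rewrite /time_integral.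
rewrite (@Rint_itv_cat _ 0 s (s + t))// ?lerDl//; congr (_ + _).
rewrite -{1}[s]add0r [s + t]addrC Rint_itv_shift//; apply: eq_Rintegral => u uI.
have /andP[u0 _] : 0 <= u <= t by move: uI; rewrite inE /= in_itv.
by rewrite (shiftE X s0 u0) addrC.
Qed.

Lemma bmfun_time_integral_upto (q : Cb R E) (s t : R) : 0 <= s <= t ->
  bmfun (time_integral q s : skorokhod_upto E t -> R).
Proof.
move=> /andP[s0 st].
(* Stopping the path at [s] makes the integrand measurable for the sigma-algebra up to [t] at every
   time [u], not only for u <= s. *)
have bj : bmfun (fun z : time * skorokhod_upto E t => q ((z.2 : skorokhod E) (Num.min z.1 s))).
  split; last by have [C _ qC] := Cb_bounded q; exists C.
  apply: measurable_rcont => [u|X] /=.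
    under eq_fun do rewrite traj_max.
    apply: (bmfun_coord_upto (Cb_bmfun q) _).1.
    by rewrite le_max lexx/= ge_max (le_trans s0 st)/= ge_min st orbT.
  move=> u /=; have [us|su] := ltP u s.
    apply: cvg_trans (@right_continuous_traj _ _ X q (@Cb_continuous _ _ q) u).
    apply: near_eq_cvg; near=> v; have vs : v < s by near: v; exact: nbhs_right_lt.
    by rewrite min_l// ltW.
  apply: cvg_near_cst; near=> v.
  have uv : u < v by near: v; exact: nbhs_right_gt.
  by rewrite min_r// (le_trans su)// ltW.
rewrite (_ : time_integral q s = fun X : skorokhod_upto E t =>
    \int[lebesgue_itv 0 s]_u q ((X : skorokhod E) (Num.min u s))).
  exact: (@bmfun_Rint2 _ _ _ _ _ (lebesgue_itv 0 s) (@dirac _ (skorokhod_upto E t) point R) _ bj).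
apply/funext => X; rewrite Rint_lebesgue_itv; last exact: (bmfun_section2 bj X).
apply: eq_Rintegral => u; rewrite inE /= in_itv/= => /andP[_ us].
by rewrite min_l.
Unshelve. all: by end_near. Qed.

Definition feynman_kac (f q : E -> R) (t : R) (X : skorokhod E) : R :=
  expR (f (X t) - time_integral q t X).

Lemma bmfun_feynman_kac (f q : Cb R E) t : bmfun (feynman_kac f q t : D -> R).
Proof.
by apply: bmfun_exp; apply: bmfunB; [exact: bmfun_coord|exact: bmfun_time_integral].
Qed.

Lemma feynman_kac_shift (f q : Cb R E) (s t : R) X : 0 <= s -> 0 <= t ->
  feynman_kac f q (s + t) X = expR (- time_integral q s X) * feynman_kac f q t (shift s X).
Proof.
move=> s0 t0; rewrite /feynman_kac time_integral_cat// shiftE// -expRD.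
by congr expR; ring.
Qed.

End time_integral.

Lemma eq_Rint_exp_law (R : realType) (c : {posnum R}) (f g : measurableTypeR R -> R) :
  bmfun f -> bmfun g -> (forall s, 0 <= s -> f s = g s) ->
  \int[exp_law c]_s f s = \int[exp_law c]_s g s.
Proof.
move=> bf bg fg; rewrite !Rint_exp_law//; apply: eq_Rintegral => s _.
have [/fg -> //|s0] := leP 0 s.
have -> : exponential_pdf c%:num s = 0; last by rewrite !mulr0.
by rewrite /exponential_pdf patchE memNset//= in_itv/= andbT; apply/negP; rewrite -ltNge.
Qed.

Lemma expR_taylor1 (R : realType) (z : R) : z <= 1 / 2 -> 0 <= expR z - 1 - z <= 2 * z ^+ 2.
Proof.
move=> z2; have h := expR_ge1Dx z; apply/andP; split; first by lra.
have h1 := expR_ge1Dx (- z); rewrite expRN in h1.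
have e0 := expR_gt0 z.
have : expR z * (1 - z) <= 1.
  by rewrite -(ler_pM2l e0) divff ?gt_eqF// in h1.
have : 1 <= (1 + z + 2 * z ^+ 2) * (1 - z).
  rewrite (_ : _ * _ = 1 + z ^+ 2 * (1 - 2 * z)); last by ring.
  by rewrite lerDl mulr_ge0 ?sqr_ge0//; lra.
move=> h2 h3; have := le_trans h3 h2; rewrite ler_pM2r; last by lra.
by lra.
Qed.

Lemma norm_expRB1_le (R : realType) (z : R) : `|z| <= 1 / 2 -> `|expR z - 1| <= 2 * `|z|.
Proof.
move=> z2; have /expR_taylor1/andP[g1 g2] : z <= 1 / 2 by apply: le_trans z2; exact: ler_norm.
have g3 : z ^+ 2 <= `|z| * (1 / 2) by rewrite -real_normK ?num_real// expr2 ler_wpM2l.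
have := ler_norm z; have := ler_norm (- z); rewrite normrN ler_norml.
by move=> ? ?; apply/andP; split; lra.
Qed.

Lemma exp_itv (R : realType) (c : {posnum R}) (d : R) : 0 <= d ->
  \int[lebesgue_measure]_(s in `[0, d]) (c%:num * expR (- c%:num * s)) =
  1 - expR (- c%:num * d).
Proof.
move=> d0; have h := exp_law_shift c d0 (bmfun_cst (measurableTypeR R) (1 : R)).
rewrite !Rint_cst mass_exp_law !mulr1 in h; rewrite [X in _ = X - _]h addrK.
by apply: eq_Rintegral => s _; rewrite mulr1.
Qed.

(** The exponential is unbounded on negative times; truncating the time to [0, d] gives a bounded
    function with the same integrals over that interval. *)
Lemma bmfun_exp_time (R : realType) (c a d : R) : exists2 w : measurableTypeR R -> R, bmfun w &
  forall s, 0 <= s <= d -> w s = a * expR (- c * s).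
Proof.
exists (fun s => a * expR (- c * Num.max 0 (Num.min s d))).
  apply: bmfunZ; apply: bmfun_exp; apply: bmfunZ.
  have mmin : measurable_fun setT (fun s : measurableTypeR R => Num.max 0 (Num.min s d)).
    by apply: measurable_maxr => //; apply: measurable_minr => //; exact: measurable_id.
  split => //; exists `|d| => s; rewrite ger0_norm ?le_max ?lexx// ge_max normr_ge0/=.
  by rewrite ge_min; apply/orP; right; exact: ler_norm.
by move=> s /andP[s0 sd]; rewrite (min_l sd) (max_r s0).
Qed.

(** Cutting [0, T] into n + 1 equal steps bounds the total increment by C T^2 / (n + 1). *)
Lemma quadratic_increments (R : realType) (w : R -> R) (C r T : R) : 0 < r -> 0 <= T ->
  (forall s d, 0 <= s <= T -> 0 <= d <= r -> `|w (s + d) - w s| <= C * d ^+ 2) ->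
  w T = w 0.
Proof.
move=> r0 T0 step.
have C0 : 0 <= C.
  have := step 0 r; rewrite lexx T0 ltW// lexx => /(_ isT isT) /(le_trans (normr_ge0 _)).
  by rewrite pmulr_lge0// exprn_gt0.
apply/eqP; rewrite -subr_eq0 -normr_le0; apply/ler_addgt0Pl => e e0; rewrite addr0.
near \oo => n.
have n0 : 0 < n.+1%:R :> R by rewrite ltr0n.
have nn : n%:R <= n.+1%:R :> R by rewrite ler_nat.
have tn : T / n.+1%:R <= r.
  rewrite ler_pdivrMr// -ler_pdivrMl//.
  by apply: le_trans nn; near: n; exact: nbhs_infty_ger.
have Cn : C * T * (T / n.+1%:R) <= e.
  rewrite mulrA ler_pdivrMr// -ler_pdivrMl//.
  by apply: le_trans nn; near: n; exact: nbhs_infty_ger.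
have dn : n.+1%:R * (T / n.+1%:R) = T by rewrite mulrCA divff ?mulr1 ?gt_eqF.
have d0 : 0 <= T / n.+1%:R by rewrite divr_ge0.
move: (T / n.+1%:R) tn Cn dn d0 => d dr Cd dn d0.
have ind m : (m <= n.+1)%N -> `|w (m%:R * d) - w 0| <= m%:R * (C * d ^+ 2).
  elim: m => [|m IH] mn; first by rewrite !mul0r subrr normr0.
  have md : 0 <= m%:R * d <= T.
    by rewrite mulr_ge0//= -dn ler_wpM2r// ler_nat ltnW.
  have h1 := step _ _ md (introT andP (conj d0 dr)); have h2 := IH (ltnW mn).
  rewrite -natr1 !mulrDl !mul1r.
  apply: le_trans (ler_distD (w (m%:R * d)) _ _) _.
  by rewrite addrC; exact: lerD.
have := ind _ (leqnn n.+1); rewrite dn => h; apply: (le_trans h).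
by apply: le_trans Cd; rewrite -dn le_eqVlt; apply/orP; left; apply/eqP; ring.
Unshelve. all: by end_near. Qed.

Section linear_resolvent.
Context (R : realType) (E : pseudoPMetricType R).
Local Notation D := (borel (skorokhod E)).
Local Notation time := (measurableTypeR R).
Variable P : E -> probability D R.
Hypothesis PM : markov_family P.

Lemma transition_add (g : Cb R E) (s t : R) x : 0 <= s -> 0 <= t ->
  transition P (s + t) g x = transition P s (transition P t g) x.
Proof.
move=> s0 t0; have := transition_two PM x (MkCb (Cb_cst E 1)) g s0 t0.
rewrite /transition /=; under eq_Rintegral do rewrite mul1r.
by move=> ->; under eq_Rintegral do rewrite mul1r.
Qed.

Lemma bmfun_transition_time (g : Cb R E) x : bmfun (fun s : time => transition P s g x).
Proof.
(* [lebesgue_itv 0 0] only fills the place of the first finite measure; measurability in time is the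
   same for any choice. *)
exact: (@bmfun_Rint _ _ _ _ _ (lebesgue_itv 0 0) (P x) _ (bmfun_joint g)).
Qed.

Definition linear_resolvent (c : {posnum R}) (g : E -> R) (x : E) : R :=
  \int[exp_law c]_s transition P s g x.

Lemma linear_resolventE c (g : Cb R E) x :
  linear_resolvent c g x = \int[P x]_X \int[exp_law c]_s g ((X : skorokhod E) s).
Proof. exact: (@Rint_Fubini _ _ _ _ _ (exp_law c) (P x) _ (bmfun_joint g)). Qed.

Lemma linear_resolvent_path_Cb c (g : Cb R E) :
  (fun X : skorokhod E => \int[exp_law c]_s g (X s)) \in @bounded_continuous R (skorokhod E).
Proof.
have [C C0 gC] := Cb_bounded g; apply: Cb_intro.
  by apply: continuous_Rint_traj; exact: exp_law_dominates.
exists C => X; rewrite -[C]mulr1 -(mass_exp_law c).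
by apply: Rint_norm_le => //; exact: bmfun_traj.
Qed.

Lemma linear_resolvent_Cb c (g : Cb R E) : linear_resolvent c g \in @bounded_continuous R E.
Proof.
have [C C0 gC] := Cb_bounded g; apply: Cb_intro.
  rewrite (funext (linear_resolventE c g)).
  by have [_ + _ _] := PM => /(_ (MkCb (linear_resolvent_path_Cb c g))).
exists C => x; rewrite -[C]mulr1 -(mass_exp_law c); apply: Rint_norm_le.
  exact: bmfun_transition_time.
by move=> s; exact: transition_norm_le.
Qed.

Lemma linear_resolvent_ge c (g : Cb R E) (a : R) x : (forall y, a <= g y) ->
  a <= linear_resolvent c g x.
Proof.
move=> ag; rewrite -[a]mulr1 -(mass_exp_law c).
apply: Rint_ge; first exact: bmfun_transition_time.
by move=> s; apply: prob_ge => //; exact: bmfun_coord.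
Qed.

Lemma linear_resolvent_le c (g : Cb R E) (b : R) x : (forall y, g y <= b) ->
  linear_resolvent c g x <= b.
Proof.
move=> ag; rewrite -[b]mulr1 -(mass_exp_law c).
apply: Rint_le; first exact: bmfun_transition_time.
by move=> s; apply: prob_le => //; exact: bmfun_coord.
Qed.

(** The Markov property at [d], applied to the exponential time average of the whole path rather
    than to one coordinate. *)
Lemma transition_linear_resolvent c (g : Cb R E) (d : R) x : 0 <= d ->
  transition P d (linear_resolvent c g) x = \int[exp_law c]_s transition P (s + d) g x.
Proof.
move=> d0; have [_ _ _ mk] := PM.
have bd : bmfun (fun z : time * D => g ((z.2 : skorokhod E) (z.1 + d))).
  apply: (@bmfun_comp _ _ (time * D)%type (time * D)%type _
    (fun z : time * D => g ((z.2 : skorokhod E) z.1))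
    (fun z : time * D => (z.1 + d : time, z.2)) (bmfun_joint g)).
  apply/measurable_fun_pairP; split => /=; last exact: measurable_snd.
  exact: (measurableT_comp (measurable_shift d) measurable_fst).
transitivity (\int[P x]_X \int[exp_law c]_s g ((X : skorokhod E) (s + d))); last first.
  exact: (esym (@Rint_Fubini _ _ _ _ _ (exp_law c) (P x) _ bd)).
pose F := MkCb (linear_resolvent_path_Cb c g).
have := mk x d (fun=> 1) (F : D -> R) d0 (bmfun_cst _ _) (Cb_bmfun F).
under eq_Rintegral do rewrite mul1r; move=> h.
transitivity (\int[P x]_X F (shift d X)); last first.
  apply: eq_Rintegral => X _; apply: eq_Rint_exp_law.
  - exact: bmfun_traj.
  - exact: (bmfun_section2 bd X).
  - by move=> s s0; rewrite (shiftE X d0 s0) addrC.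
rewrite {}h; apply: eq_Rintegral => X _; rewrite mul1r.
by rewrite linear_resolventE.
Qed.

Lemma linear_resolvent_shift c (g : Cb R E) (d : R) x : 0 <= d ->
  linear_resolvent c g x =
  \int[lebesgue_measure]_(s in `[0, d]) (c%:num * expR (- c%:num * s) * transition P s g x) +
  expR (- c%:num * d) * transition P d (linear_resolvent c g) x.
Proof.
move=> d0; rewrite transition_linear_resolvent//.
exact: (exp_law_shift c d0 (bmfun_transition_time g x)).
Qed.

(** By [linear_resolvent_shift] the difference consists of (1 - exp(- c d)) times a quantity bounded
    by [B] and of an integral over [0, d] of a function bounded by c B; each is at most c B d. *)
Lemma linear_resolvent_lip c (k : Cb R E) (B d : R) x : 0 <= d -> (forall y, `|k y| <= B) ->
  `|transition P d (linear_resolvent c k) x - linear_resolvent c k x| <= 2 * B * c%:num * d.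
Proof.
move=> d0 kB; rewrite (linear_resolvent_shift c k x d0).
pose u := MkCb (linear_resolvent_Cb c k).
have uB y : `|u y| <= B.
  rewrite ler_norml linear_resolvent_le ?linear_resolvent_ge// => z.
    by have := kB z; rewrite ler_norml => /andP[].
  by have := kB z; rewrite ler_norml => /andP[].
have SB : `|transition P d u x| <= B by exact: transition_norm_le.
have B0 : 0 <= B by apply: le_trans SB.
have [w bw wE] := bmfun_exp_time c%:num c%:num d.
have bS := bmfun_transition_time k x.
have h1 : `|\int[lebesgue_measure]_(s in `[0, d]) (c%:num * expR (- c%:num * s) * transition P s k x)|
    <= c%:num * B * (d - 0).
  rewrite (@eq_Rintegral _ _ _ _ _ (fun s => w s * transition P s k x)); last first.
    by move=> s; rewrite inE /= in_itv/= => sd; rewrite wE.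
  apply: Rint_itv_norm_le => //; first exact: bmfunM.
  move=> s sd; rewrite wE//; have /andP[s0 _] := sd.
  rewrite !normrM (ger0_norm (expR_ge0 _)) gtr0_norm//.
  rewrite ler_pM//; last exact: transition_norm_le.
  by rewrite ger_pMr// -expR0 ler_expR mulNr oppr_le0 mulr_ge0.
have h2 : 0 <= 1 - expR (- c%:num * d) <= c%:num * d.
  have := expR_ge1Dx (- c%:num * d); have : expR (- c%:num * d) <= 1.
    by rewrite -expR0 ler_expR mulNr oppr_le0 mulr_ge0.
  rewrite mulNr => h3 h4; apply/andP; split; lra.
set I := \int[_]_(_ in _) _ in h1 *; set e := expR _ in h2 *.
have h3 : `|(1 - e) * transition P d u x| <= c%:num * d * B.
  have /andP[h20 h21] := h2.
  by rewrite normrM (ger0_norm h20) ler_pM.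
rewrite (_ : _ - _ = (1 - e) * transition P d u x - I); last by rewrite /=; ring.
apply: le_trans (ler_normB _ _) _; rewrite subr0 in h1.
by move: h1 h3; move: (`|I|) (`|_ * _|) => a b; lra.
Qed.

Lemma transition_lip (g : Cb R E) (L s t : R) x :
  (forall y d, 0 <= d -> `|transition P d g y - g y| <= L * d) -> 0 <= s <= t ->
  `|transition P t g x - transition P s g x| <= L * (t - s).
Proof.
move=> gL /andP[s0 st]; have ts0 : 0 <= t - s by rewrite subr_ge0.
have e : t = s + (t - s) by rewrite addrC subrK.
rewrite [X in transition P X g x - _]e transition_add//.
pose gt := MkCb (transition_Cb PM g ts0).
rewrite {1 2}/transition -RintB; last 2 first.
- exact: (bmfun_coord gt s).
- exact: bmfun_coord.
apply: prob_norm_le.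
  by apply: bmfunB; [exact: (bmfun_coord gt s)|exact: bmfun_coord].
by move=> X; exact: gL.
Qed.

End linear_resolvent.

(** * Exponential functionals with constant mean *)

Section multiplicative_functional.
Context (R : realType) (E : pseudoPMetricType R).
Local Notation D := (borel (skorokhod E)).
Local Notation time := (measurableTypeR R).
Variable P : E -> probability D R.
Hypothesis PM : markov_family P.
Variables (c : {posnum R}) (f q k : Cb R E).
Hypothesis fE : forall y, expR (f y) = linear_resolvent P c k y.
Hypothesis qE : forall y, q y * expR (f y) = c%:num * (expR (f y) - k y).

Let u := MkCb (linear_resolvent_Cb PM c k).

(** The integrated form of A u = c (u - k) for u = L_c k = exp f. Hypothesis [qE] thus says that q =
    exp(- f) A exp(f), the potential compensating exp(f(X t)). *)
Let generator (d : R) y : 0 <= d ->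
  transition P d u y - u y = \int[lebesgue_measure]_(s in `[0, d])
    (c%:num * expR (- c%:num * s) * (transition P d u y - transition P s k y)).
Proof.
move=> d0; have [w bw wE] := bmfun_exp_time c%:num c%:num d.
have bS := bmfun_transition_time P k y.
transitivity (\int[lebesgue_measure]_(s in `[0, d]) (w s * transition P d u y - w s * transition P s k y)).
  have bS1 : bmfun (fun s => w s * transition P d u y) by apply: bmfunM => //; exact: bmfun_cst.
  have bS2 : bmfun (fun s => w s * transition P s k y) by exact: bmfunM.
  rewrite RintegralB//; [|exact: bmfun_integrable_itv|exact: bmfun_integrable_itv].
  rewrite RintegralZr//; last exact: bmfun_integrable_itv.
  have w1 : \int[lebesgue_measure]_(s in `[0, d]) w s = 1 - expR (- c%:num * d).
    rewrite -exp_itv//; apply: eq_Rintegral => s; rewrite inE /= in_itv/= => sd.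
    by rewrite wE.
  rewrite w1 [X in _ - X = _](linear_resolvent_shift PM c k y d0).
  rewrite [X in _ = _ - X](_ : _ = \int[lebesgue_measure]_(s in `[0, d]) (c%:num * expR (- c%:num * s) * transition P s k y)).
    by rewrite /=; ring.
  by apply: eq_Rintegral => s; rewrite inE /= in_itv/= => sd; rewrite wE.
by apply: eq_Rintegral => s; rewrite inE /= in_itv/= => sd; rewrite wE// mulrBr.
Qed.

(** [first]: the mean of q u at time [s] is c (S_s u - S_s k), which is the integrand of [generator]
    up to O(d); hence S_d u - u agrees to second order with the mean of u(X d) times the integral of
    [q]. [second]: the exponential of minus that integral is expanded to first order. *)
Let local_error : exists2 K, 0 <= K & exists2 r, 0 < r & forall d y, 0 <= d <= r ->
  `|\int[P y]_X feynman_kac f q d X - expR (f y)| <= K * d ^+ 2.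
Proof.
have [B B0 kB] := Cb_bounded k; have [Q Q0 qQ] := Cb_bounded q.
have uB y : `|u y| <= B.
  rewrite ler_norml linear_resolvent_le ?linear_resolvent_ge// => z.
    by have := kB z; rewrite ler_norml => /andP[].
  by have := kB z; rewrite ler_norml => /andP[].
have uL y d : 0 <= d -> `|transition P d u y - u y| <= 2 * B * c%:num * d.
  by move=> d0; exact: linear_resolvent_lip.
(* The term in c^2 collects two errors 2 B c^2 d, from replacing the kernel c exp(- c s) by c and
   S_d u by S_s u; the term in [Q] comes from replacing u(X d) by u(X s) next to q(X s). *)
pose K2 := 4 * B * c%:num ^+ 2 + 2 * B * c%:num * Q.
exists (2 * B * Q ^+ 2 + K2).
  by rewrite !addr_ge0// !mulr_ge0// ?sqr_ge0.
(* For [d] below this threshold the integral of [q] is at most 1/2 in absolute value, as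
   [expR_taylor1] requires. *)
exists (2 * (Q + 1))^-1; first by rewrite invr_gt0 mulr_gt0// ltr_wpDl.
move=> d y /andP[d0 dr].
have Qd : Q * d <= 1 / 2.
  have : (2 * (Q + 1)) * d <= 1.
    by rewrite -ler_pdivlMl ?mulr1// mulr_gt0// ltr_wpDl.
  by rewrite mulrDr mulrDl; lra.
pose I := time_integral q d.
have IQ (X : skorokhod E) : `|I X| <= Q * d by exact: time_integral_norm_le.
have bI : bmfun (I : D -> R) by exact: bmfun_time_integral.
have bud := bmfun_coord u d.
have first : `|transition P d u y - u y - \int[P y]_X (u ((X : skorokhod E) d) * I X)| <= K2 * d * d.
  have bj : bmfun (fun z : time * D => u ((z.2 : skorokhod E) d) * q ((z.2 : skorokhod E) z.1)).
    apply: bmfunM; last exact: bmfun_joint.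
    exact: (bmfun_comp bud measurable_snd).
  have -> : \int[P y]_X (u ((X : skorokhod E) d) * I X) =
      \int[lebesgue_measure]_(s in `[0, d])
        \int[P y]_X (u ((X : skorokhod E) d) * q ((X : skorokhod E) s)).
    rewrite -(@Rint_lebesgue_itv _ 0 d _ (@bmfun_Rint _ _ _ _ _ (lebesgue_itv 0 0) (P y) _ bj)).
    rewrite (@Rint_Fubini _ _ _ _ _ (lebesgue_itv 0 d) (P y) _ bj); apply: eq_Rintegral => X _.
    rewrite /I /time_integral -(@Rint_lebesgue_itv _ 0 d _ (bmfun_traj X q)).
    exact: (esym (@RintZ _ _ _ (lebesgue_itv 0 d) (u ((X : skorokhod E) d)) _ (bmfun_traj X q))).
  rewrite generator//; have [w bw wE] := bmfun_exp_time c%:num c%:num d.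
  have bS := bmfun_transition_time P k y.
  have bS1 : bmfun (fun s => w s * (transition P d u y - transition P s k y)).
    by apply: bmfunM => //; apply: bmfunB => //; exact: bmfun_cst.
  have bS2 := @bmfun_Rint _ _ _ _ _ (lebesgue_itv 0 0) (P y) _ bj.
  rewrite (@eq_Rintegral _ _ _ _ _ (fun s => w s * (transition P d u y - transition P s k y))); last first.
    by move=> s; rewrite inE /= in_itv/= => sd; rewrite wE.
  rewrite -RintegralB//; [|exact: bmfun_integrable_itv|exact: bmfun_integrable_itv].
  rewrite -[X in _ <= _ * X]subr0; apply: Rint_itv_norm_le => //; first exact: bmfunB.
  move=> s /andP[s0 sd]; rewrite wE ?s0//=.
  have ds0 : 0 <= d - s by rewrite subr_ge0.
  pose v := MkCb (transition_Cb PM u ds0).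
  have buq := bmfun_coord u s; have bqs := bmfun_coord q s.
  have bvs := bmfun_coord v s; have bks := bmfun_coord k s.
  have e1 : \int[P y]_X (u ((X : skorokhod E) d) * q ((X : skorokhod E) s)) =
      \int[P y]_X (q ((X : skorokhod E) s) * v ((X : skorokhod E) s)).
    rewrite -(transition_two PM y q u s0 ds0) addrC subrK.
    by apply: eq_Rintegral => X _; rewrite mulrC.
  have e2 : \int[P y]_X (q ((X : skorokhod E) s) * u ((X : skorokhod E) s)) =
      c%:num * (transition P s u y - transition P s k y).
    rewrite {1 2}/transition -RintB// -RintZ; last exact: bmfunB.
    by apply: eq_Rintegral => X _; rewrite /= -fE qE.
  have h1 : `|transition P d u y - transition P s u y| <= 2 * B * c%:num * d.
    have sd' : 0 <= s <= d by rewrite s0.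
    apply: le_trans (transition_lip PM y uL sd') _.
    by apply: ler_wpM2l; rewrite ?mulr_ge0// gerBl.
  have h2 : `|\int[P y]_X (q ((X : skorokhod E) s) * v ((X : skorokhod E) s)) -
      \int[P y]_X (q ((X : skorokhod E) s) * u ((X : skorokhod E) s))| <= Q * (2 * B * c%:num * d).
    rewrite -RintB; [|exact: bmfunM|exact: bmfunM].
    apply: prob_norm_le.
      by apply: bmfunB; exact: bmfunM.
    move=> X; rewrite -mulrBr normrM; apply: ler_pM => //.
    apply: le_trans (uL _ _ ds0) _.
    by apply: ler_wpM2l; rewrite ?mulr_ge0// gerBl.
  rewrite e1; rewrite e2 in h2.
  have h3 : `|(1 - expR (- c%:num * s)) * (c%:num * (transition P d u y - transition P s k y))|
      <= (c%:num * d) * (c%:num * (2 * B)).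
    have := expR_ge1Dx (- c%:num * s); have : expR (- c%:num * s) <= 1.
      by rewrite -expR0 ler_expR mulNr oppr_le0 mulr_ge0.
    have cs : c%:num * s <= c%:num * d by rewrite ler_wpM2l.
    move=> g1 g2; rewrite normrM; apply: ler_pM => //.
      by rewrite ger0_norm ?subr_ge0// ; move: g2 cs; rewrite mulNr; lra.
    rewrite normrM gtr0_norm// ler_wpM2l//.
    apply: le_trans (ler_normB _ _) _.
    by rewrite mulr_natl mulr2n; apply: lerD; exact: transition_norm_le.
  have h4 : `|c%:num * (transition P d u y - transition P s u y)| <= c%:num * (2 * B * c%:num * d).
    by rewrite normrM gtr0_norm// ler_wpM2l.
  move: h2 h3 h4; rewrite /K2 -[linear_resolvent P c k]/(u : E -> R); clear.
  move: (expR (- c%:num * s)) (transition P s u y) (transition P s k y) (transition P d u y).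
  move: (\int[P y]_X (q ((X : skorokhod E) s) * v ((X : skorokhod E) s))) (c%:num).
  move=> e z1 z2 z3 z4 c1; rewrite !ler_norml => /andP[? ?] /andP[? ?] /andP[? ?].
  by apply/andP; split; lra.
have bfk := bmfun_feynman_kac f q d.
have bui : bmfun (fun X : D => u ((X : skorokhod E) d) * I X) by exact: bmfunM.
have second : `|\int[P y]_X feynman_kac f q d X -
    (transition P d u y - \int[P y]_X (u ((X : skorokhod E) d) * I X))| <= B * (2 * (Q * d) ^+ 2).
  rewrite /transition -RintB// -RintB//; last exact: bmfunB.
  apply: prob_norm_le.
    by apply: bmfunB => //; exact: bmfunB.
  move=> X; rewrite /feynman_kac expRD fE -/(I X).
  rewrite (_ : _ - _ = u ((X : skorokhod E) d) * (expR (- I X) - 1 - - I X)); last by rewrite /=; ring.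
  rewrite normrM; apply: ler_pM => //.
  have := IQ X; rewrite ler_norml => /andP[g1 g2].
  have /expR_taylor1/andP[g3 g4] : - I X <= 1 / 2 by lra.
  rewrite ger0_norm//; apply: (le_trans g4).
  by rewrite ler_wpM2l// sqrrN -real_normK ?num_real// lerXn2r ?nnegrE ?mulr_ge0.
rewrite fE; move: first second; rewrite -[linear_resolvent P c k y]/(u y); clear.
move: (\int[P y]_X feynman_kac f q d X) (\int[P y]_X (u ((X : skorokhod E) d) * I X)).
move: (transition P d u y) (u y) => z1 z2 z3 z4.
rewrite !ler_norml expr2 => /andP[? ?] /andP[? ?]; apply/andP; split; lra.
Qed.

(* The mean is constant in time because its increments are quadratic in the time step. *)
Theorem feynman_kac_resolvent x t : 0 <= t ->
  \int[P x]_X feynman_kac f q t X = expR (f x).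
Proof.
move=> t0; have [K K0 [r r0 loc]] := local_error; have [_ _ pb mk] := PM.
have [Q Q0 qQ] := Cb_bounded q.
pose w s := \int[P x]_X feynman_kac f q s X.
have w0 : w 0 = expR (f x).
  transitivity (transition P 0 u x); last by rewrite (transition0 PM) fE.
  apply: eq_Rintegral => X _; rewrite /feynman_kac /time_integral.
  by rewrite set_itv1 Rintegral_set1 subr0 fE.
have step s d : 0 <= s <= t -> 0 <= d <= r -> `|w (s + d) - w s| <= expR (Q * t) * K * d ^+ 2.
  move=> /andP[s0 st] dr; have /andP[d0 _] := dr.
  pose Z (X : skorokhod E) := expR (- time_integral q s X).
  have bZ : bmfun (Z : skorokhod_upto E s -> R).
    by apply: bmfun_exp; apply: bmfunN; apply: bmfun_time_integral_upto; rewrite s0 lexx.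
  have bZ' : bmfun (Z : D -> R) by apply: bmfun_exp; apply: bmfunN; exact: bmfun_time_integral.
  have bF := bmfun_feynman_kac f q d.
  have bG := bmfun_at s0 (pb _ bF); have bu := bmfun_coord u s.
  have -> : w (s + d) = \int[P x]_X (Z X * \int[P ((X : skorokhod E) s)]_Y feynman_kac f q d Y).
    by rewrite -mk//; apply: eq_Rintegral => X _; rewrite feynman_kac_shift.
  have -> : w s = \int[P x]_X (Z X * u ((X : skorokhod E) s)).
    by apply: eq_Rintegral => X _; rewrite /feynman_kac expRD fE mulrC.
  rewrite -RintB; [|exact: bmfunM|exact: bmfunM].
  rewrite -mulrA; apply: prob_norm_le.
    by apply: bmfunB; exact: bmfunM.
  move=> X; rewrite -mulrBr normrM; apply: ler_pM => //.
    rewrite ger0_norm ?expR_ge0// ler_expR.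
    have : `|time_integral q s X| <= Q * s by exact: time_integral_norm_le.
    have : Q * s <= Q * t by rewrite ler_wpM2l.
    by rewrite ler_norml => ? /andP[? ?]; lra.
  by rewrite /= -fE; exact: loc.
by rewrite -w0; exact: (@quadratic_increments _ w _ r t r0 t0 step).
Qed.

End multiplicative_functional.

(** * Relative entropy and the variational resolvent *)

Section entropy.
Context d (T : measurableType d) (R : realType).
Local Open Scope ereal_scope.

(* No measurability is needed: the integral of [f] is the difference of two
   suprema over the simple functions below its positive and negative parts. *)
Lemma le_integral_pointwise (mu : {measure set T -> \bar R}) (D : set T) (f g : T -> \bar R) :
  (forall x, D x -> f x <= g x) -> \int[mu]_(x in D) f x <= \int[mu]_(x in D) g x.
Proof.
move=> fg.
have h (x : T) : (f \_ D) x <= (g \_ D) x.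
  by rewrite !patchE; case: ifPn => // /set_mem; exact: fg.
rewrite /integral; apply: leeB; apply: le_ereal_sup => _ [k kf <-]; exists k => // x;
  apply: (le_trans (kf x)).
- by rewrite unlock ge_max !le_max h lexx orbT.
- by rewrite unlock ge_max !le_max leeN2 h lexx orbT.
Qed.

(** The infinite value [e] on a null set turns an almost everywhere comparison with the logarithm of
    a Radon-Nikodym derivative into a pointwise one, to which [le_integral_pointwise] applies. *)
Lemma integral_off_null (mu : {finite_measure set T -> \bar R}) (N : set T) (l : T -> R) (e : \bar R) :
  measurable N -> mu N = 0 -> measurable_fun setT l ->
  \int[mu]_x (if x \in N then e else (l x)%:E) = \int[mu]_x (l x)%:E.
Proof.
move=> mN N0 ml; apply: ae_eq_integral => //.
- apply: measurable_fun_ifT => //; last exact/measurable_EFinP.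
  by apply: (measurable_fun_bool true); rewrite setTI preimage_mem_true.
- exact/measurable_EFinP.
exists N; split => // x /= h; apply: contrapT => Nx; apply: h => _.
by rewrite memNset.
Qed.

(** The inequality 1 + y <= exp y at y = phi - log D, with [D] the density, gives log D >= phi + 1 -
    exp(phi) / D. The last term has [nu]-integral at most that of exp(phi) under [mu], hence at most
    1. *)
Lemma relative_entropy_ge (nu mu : probability T R) (phi : T -> R) : bmfun phi ->
  (\int[mu]_x expR (phi x) <= 1)%R ->
  (\int[nu]_x phi x)%:E <= relative_entropy nu mu.
Proof.
move=> bphi phi1; rewrite /relative_entropy; case: asboolP => [numu|_]; last exact: leey.
pose f := Radon_Nikodym_SigmaFinite.f nu mu.
pose D x := fine (f x).
have fE x : f x = (D x)%:E.
  by rewrite fineK//; exact: Radon_Nikodym_SigmaFinite.f_fin_num.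
have D0 x : (0 <= D x)%R by apply: fine_ge0; exact: Radon_Nikodym_SigmaFinite.f_ge0.
have mf : measurable_fun setT f.
  exact: measurable_int (Radon_Nikodym_SigmaFinite.f_integrable numu).
have mD : measurable_fun setT D by apply/measurable_EFinP; rewrite [X in measurable_fun _ X](_ : _ = f)//; apply/funext => x; rewrite fE.
have [N0 [mN0 muN0 subN0]] : ae_eq mu setT f (Radon_Nikodym (charge_of_finite_measure nu) mu).
  exact: ae_eq_Radon_Nikodym_SigmaFinite.
(* Where the density vanishes [ln] takes a default value; such points form a [nu]-null set. *)
pose Z := D @^-1` [set 0%R].
have mZ : measurable Z by rewrite -[Z]setTI; exact: mD.
have nuZ : nu Z = 0.
  rewrite (Radon_Nikodym_SigmaFinite.f_integral numu mZ); apply: integral0_eq => x Zx.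
  by rewrite -/(f x) fE Zx.
have nuN0 : nu N0 = 0.
  by move/null_content_dominatesP : numu; apply.
have nuN : nu (N0 `|` Z) = 0 by apply: null_set_setU.
have mN : measurable (N0 `|` Z) by exact: measurableU.
pose w x := expR (phi x - ln (D x)).
have mw : measurable_fun setT w.
  apply: measurableT_comp; first exact: measurable_expR.
  apply: measurable_funB; first exact: bphi.1.
  by apply: measurableT_comp => //; exact: measurable_ln.
have mw' : measurable_fun setT (EFin \o w) by exact/measurable_EFinP.
have w1 : \int[nu]_x (w x)%:E <= 1.
  rewrite -(@Radon_Nikodym_SigmaFinite.change_of_variables _ _ _ nu mu numu (EFin \o w) setT)//; last first.
    by move=> x; rewrite lee_fin expR_ge0.
  apply: (@le_trans _ _ (\int[mu]_x (expR (phi x))%:E)).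
    apply: ge0_le_integral => //.
    - by move=> x _; rewrite mule_ge0// ?lee_fin ?expR_ge0// -/(f x) fE lee_fin.
    - exact: emeasurable_funM.
    - by apply/measurable_EFinP; have [] := bmfun_exp bphi.
    - move=> x _; rewrite -/(f x) fE /= lee_fin /w.
      have := D0 x; rewrite le_eqVlt => /predU1P[<-|Dx].
        by rewrite mulr0 expR_ge0.
      by rewrite expRD expRN lnK// mulfVK// gt_eqF.
  by rewrite integral_bmfun ?lee_fin//; exact: bmfun_exp.
have iw : nu.-integrable setT (EFin \o w).
  apply/integrableP; split => //.
  apply: (@le_lt_trans _ _ 1); last exact: ltry.
  apply: le_trans w1; rewrite le_eqVlt; apply/orP; left; apply/eqP.
  by apply: eq_integral => x _ /=; rewrite ger0_norm ?expR_ge0.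
pose l x := (phi x + 1 - w x)%R.
have bphi1 : bmfun (fun x => phi x + 1)%R by apply: bmfunD => //; exact: bmfun_cst.
have ml : measurable_fun setT l by apply: measurable_funB => //; exact: bphi1.1.
apply: (@le_trans _ _ (\int[nu]_x (l x)%:E)).
  rewrite (_ : \int[nu]_x (l x)%:E = \int[nu]_x (phi x + 1)%:E - \int[nu]_x (w x)%:E).
    rewrite integral_bmfun// RintD//; last exact: bmfun_cst.
    rewrite Rint_cst mul1r mass_probability EFinD.
    have wr : \int[nu]_x (w x)%:E = (fine (\int[nu]_x (w x)%:E))%:E.
      by rewrite fineK//; exact: integrable_fin_num.
    move: w1; rewrite wr => w1; rewrite -EFinB lee_fin; move: w1; rewrite lee_fin.
    by move: (fine _) => r; lra.
  by rewrite -integralB//; exact: bmfun_integrable.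
rewrite -(integral_off_null -oo mN nuN ml).
apply: le_integral_pointwise => x _; case: ifPn => [_|/negP]; first exact: leNye.
rewrite inE => /not_orP[N0x Zx].
have -> : Radon_Nikodym (charge_of_finite_measure nu) mu x = (D x)%:E.
  rewrite -fE; apply: contrapT => h; apply: N0x; apply: subN0 => /= h'; apply: h.
  by rewrite h'.
have Dx : (0 < D x)%R by rewrite lt_neqAle D0 andbT eq_sym; apply/eqP.
rewrite lne_EFin// lee_fin /l /w.
by have := expR_ge1Dx (phi x - ln (D x)); lra.
Qed.

(** The converse bound for the measure that saturates [relative_entropy_ge]: off a null set its
    log-density is [phi]. *)
Lemma relative_entropy_density (nu mu : probability T R) (phi : T -> R) : bmfun phi ->
  (forall A, measurable A -> nu A = \int[mu]_(x in A) (expR (phi x))%:E) ->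
  relative_entropy nu mu <= (\int[nu]_x phi x)%:E.
Proof.
move=> bphi nuE; have be := bmfun_exp bphi.
have me : measurable_fun setT (fun x => (expR (phi x))%:E) by apply/measurable_EFinP; have [] := be.
have numu : nu `<< mu.
  apply/null_content_dominatesP => A mA A0; rewrite nuE//.
  by apply: null_set_integral => //; exact: measurable_funTS.
rewrite /relative_entropy; case: asboolP => // _.
have [N [mN muN subN]] : ae_eq mu setT (Radon_Nikodym (charge_of_finite_measure nu) mu)
    (fun x => (expR (phi x))%:E).
  apply: integral_ae_eq => //.
    exact: (@Radon_Nikodym_integrable _ _ _ (charge_of_finite_measure nu) mu numu).
  move=> B _ mB; rewrite -nuE//.
  by rewrite -(@Radon_Nikodym_integral _ _ _ (charge_of_finite_measure nu) mu).
have nuN : nu N = 0 by move/null_content_dominatesP : numu; apply.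
rewrite -integral_bmfun// -(integral_off_null +oo mN nuN bphi.1).
apply: le_integral_pointwise => x _; case: ifPn => [_|/negP]; first exact: leey.
rewrite inE => Nx.
have -> : Radon_Nikodym (charge_of_finite_measure nu) mu x = (expR (phi x))%:E.
  by apply: contrapT => h; apply: Nx; apply: subN => /= h'; apply: h; rewrite h'.
by rewrite lne_EFin ?expR_gt0// expRK.
Qed.

End entropy.

(** * Averages over an exponential time *)

Section exponential_time.
Context (R : realType).
Local Notation time := (measurableTypeR R).

Lemma exp_law_tail (c : {posnum R}) (s : R) (a : R) : 0 <= s ->
  \int[exp_law c]_t (if s <= t then a else 0) = a * expR (- c%:num * s).
Proof.
move=> s0.
have bi u : bmfun (fun t : time => if u <= t then a else 0).
  split; last by exists `|a| => t; case: ifP => // _; rewrite normr0.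
  apply: measurable_fun_ifT => //.
  exact: (@measurable_fun_ler _ _ R setT (cst u : time -> R) id).
have [w bw wE] := bmfun_exp_time c%:num c%:num s.
rewrite (exp_law_shift c s0 (bi s)).
have -> : \int[lebesgue_measure]_(t in `[0, s])
    (c%:num * expR (- c%:num * t) * (if s <= t then a else 0)) = 0.
  transitivity (\int[lebesgue_measure]_(t in `[0, s]) (w t * (if s <= t then a else 0))).
    by apply: eq_Rintegral => t; rewrite inE /= in_itv/= => ts; rewrite wE.
  rewrite -Rintegral_itv_bndo_bndc; last first.
    have i1 := bmfun_integrable_itv 0 s (bmfunM bw (bi s)).
    by apply: (integrableS _ _ _ i1) => //; apply: subset_itvl; rewrite bnd_simp.
  rewrite -[RHS](mul0r (fine (lebesgue_measure (`[0, s[ : set time)))) -Rintegral_cst//.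
  apply: eq_Rintegral => t.
  by rewrite inE /= in_itv/= => /andP[_ ts]; rewrite leNgt ts mulr0.
rewrite add0r mulrC; congr (_ * _).
rewrite -[RHS]mulr1 -(mass_exp_law c) -Rint_cst; apply: eq_Rint_exp_law => //.
- exact: (bmfun_comp (bi s) (measurable_shift s)).
- exact: bmfun_cst.
- by move=> t t0; rewrite lerDr t0.
Qed.

(** By Fubini, c times the integral of [gam] up to the exponential time stopped at [T] has mean
    equal to that of [gam] at the exponential time on the event that it precedes [T]. There it
    cancels eta - zeta = - gam. What remains lives after [T], an event of probability exp(- c T). *)
Lemma exp_law_stopped (c : {posnum R}) (eta zeta gam : time -> R) (a K T : R) :
  bmfun eta -> bmfun zeta -> bmfun gam -> 0 <= T ->
  (forall t, zeta t = eta t + gam t) -> (forall s t, `|eta s - zeta t| <= K) ->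
  bmfun (fun t : time => eta t - (zeta (Num.min t T) - a -
    c%:num * \int[lebesgue_measure]_(s in `[0, Num.min t T]) gam s)) /\
  `|\int[exp_law c]_t (eta t - (zeta (Num.min t T) - a -
    c%:num * \int[lebesgue_measure]_(s in `[0, Num.min t T]) gam s)) - a| <=
  K * expR (- c%:num * T).
Proof.
move=> beta bzeta bgam T0 zE zK.
have mmin : measurable_fun setT (fun t : time => Num.min t T : time).
  by apply: (@measurable_minr _ _ _ setT id (cst T)).
have bzm : bmfun (fun t : time => zeta (Num.min t T)) by exact: (bmfun_comp bzeta mmin).
pose F (z : time * time) : R := if z.2 <= z.1 then gam z.2 else 0.
have bF : bmfun F.
  have [mg [C gC]] := bgam; split; last first.
    exists C => z; rewrite /F; case: ifP => // _.
    by rewrite normr0; exact: le_trans (gC 0).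
  apply: measurable_fun_ifT => //.
    by apply: (@measurable_fun_ler _ _ R setT).
  exact: measurableT_comp mg _.
have GE t : \int[lebesgue_measure]_(s in `[0, Num.min t T]) gam s =
    \int[lebesgue_itv 0 T]_s F (t, s).
  rewrite Rint_lebesgue_itv; last exact: (bmfun_section bF t).
  rewrite Rintegral_mkcond [RHS]Rintegral_mkcond; apply: eq_Rintegral => s _.
  rewrite !patchE !mem_setE !in_itv/= le_min /F /=.
  by case: (0 <= s); case: (s <= t); case: (s <= T).
have bG := @bmfun_Rint _ _ _ _ _ (exp_law c) (lebesgue_itv 0 T) _ bF.
have bG' : bmfun (fun t : time => c%:num * \int[lebesgue_measure]_(s in `[0, Num.min t T]) gam s).
  by apply: bmfunZ; rewrite (funext GE).
have bez : bmfun (fun t : time => eta t - zeta (Num.min t T)) by exact: bmfunB.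
have [w bw wE] := bmfun_exp_time c%:num c%:num T.
have intG : \int[exp_law c]_t (c%:num * \int[lebesgue_measure]_(s in `[0, Num.min t T]) gam s) =
    \int[lebesgue_measure]_(s in `[0, T]) (w s * gam s).
  under eq_Rintegral do rewrite GE.
  rewrite RintZ// (@Rint_Fubini _ _ _ _ _ (exp_law c) (lebesgue_itv 0 T) _ bF).
  rewrite -RintZ; last exact: (@bmfun_Rint2 _ _ _ _ _ (exp_law c) (lebesgue_itv 0 T) _ bF).
  rewrite Rint_lebesgue_itv; last first.
    by apply: bmfunZ; exact: (@bmfun_Rint2 _ _ _ _ _ (exp_law c) (lebesgue_itv 0 T) _ bF).
  apply: eq_Rintegral => s; rewrite inE /= in_itv/= => /andP[s0 sT].
  by rewrite /F /= exp_law_tail// wE ?s0//; ring.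
have intez : \int[exp_law c]_t (eta t - zeta (Num.min t T)) =
    - (\int[lebesgue_measure]_(s in `[0, T]) (w s * gam s)) +
    expR (- c%:num * T) * \int[exp_law c]_t (eta (t + T) - zeta (Num.min (t + T) T)).
  rewrite {1}(exp_law_shift c T0 bez); congr (_ + _).
  rewrite -[RHS]mulN1r -RintegralZl//; last by apply: bmfun_integrable_itv; exact: bmfunM.
  apply: eq_Rintegral => s; rewrite inE /= in_itv/= => /andP[s0 sT].
  by rewrite wE ?s0// (min_l sT) zE; ring.
have -> : (fun t : time => eta t - (zeta (Num.min t T) - a -
    c%:num * \int[lebesgue_measure]_(s in `[0, Num.min t T]) gam s)) =
  (fun t : time => (eta t - zeta (Num.min t T)) +
    c%:num * \int[lebesgue_measure]_(s in `[0, Num.min t T]) gam s + a).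
  by apply/funext => t; ring.
have bsum := bmfunD bez bG'; split; first by apply: bmfunD => //; exact: bmfun_cst.
rewrite RintD//; last exact: bmfun_cst.
rewrite RintD// Rint_cst mass_exp_law mulr1 addrK intez intG addrAC addNr add0r.
rewrite normrM ger0_norm ?expR_ge0// mulrC ler_wpM2r ?expR_ge0//.
rewrite -[K]mulr1 -(mass_exp_law c); apply: Rint_norm_le => //.
exact: (bmfun_comp bez (measurable_shift T)).
Qed.

End exponential_time.

Section Cb_operations.
Context (R : realType) (T : topologicalType).

Lemma Cb_lincomb (a b : R) (f g : Cb R T) :
  (fun x => a * f x + b * g x) \in @bounded_continuous R T.
Proof.
have [C C0 fC] := Cb_bounded f; have [B B0 gB] := Cb_bounded g; apply: Cb_intro.
  move=> x; apply: cvgD; apply: cvgM; try exact: cvg_cst; exact: Cb_continuous.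
exists (`|a| * C + `|b| * B) => x.
by rewrite (le_trans (ler_normD _ _))// !normrM lerD// ler_wpM2l.
Qed.

Lemma Cb_comp (phi : R -> R) (C : R) (f : Cb R T) :
  (forall x, {for f x, continuous phi}) -> (forall x, `|phi (f x)| <= C) ->
  (fun x => phi (f x)) \in @bounded_continuous R T.
Proof.
move=> cphi phiC; apply: Cb_intro; last by exists C.
by move=> x; apply: continuous_comp; [exact: Cb_continuous|exact: cphi].
Qed.

Definition rate (c : R) (f h : T -> R) (x : T) : R := c * (f x - h x).

Lemma rate_Cb (c : R) (f h : Cb R T) : rate c f h \in @bounded_continuous R T.
Proof.
rewrite (_ : rate c f h = fun x => c * f x + (- c) * h x); first exact: Cb_lincomb.
by apply/funext => x; rewrite /rate; ring.
Qed.

End Cb_operations.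

Lemma exp_small (R : realType) (c K e : R) : 0 < c -> 0 <= K -> 0 < e ->
  exists2 T, 0 <= T & K * expR (- c * T) <= e.
Proof.
move=> c0 K0 e0; exists (K / (c * e)); first by rewrite divr_ge0// mulr_ge0// ltW.
rewrite mulNr expRN ler_pdivrMr ?expR_gt0//.
apply: le_trans (ler_wpM2l (ltW e0) (expR_ge1Dx _)).
rewrite (_ : e * _ = e + K); first by rewrite lerDr ltW.
by field; rewrite !gt_eqF.
Qed.

(** * The two bounds on the variational resolvent *)

Section resolvent_bounds.
Context (R : realType) (E : pseudoPMetricType R).
Local Notation D := (borel (skorokhod E)).
Local Notation time := (measurableTypeR R).
Variable P : E -> probability D R.
Hypothesis PM : markov_family P.
Variable c : {posnum R}.

(* With [c = 1 / lambda], a weak form of [f - lambda * exp (- f) * A (exp f) = h]. *)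
Definition resolvent_pair (f h : E -> R) : Prop := forall x t, 0 <= t ->
  \int[P x]_X feynman_kac f (rate c%:num f h) t X = expR (f x).

(** The inequality is all that the upper bound on the resolvent uses and, unlike the equation, it
    survives lowering [h] and averaging. *)
Definition resolvent_super (f h : E -> R) : Prop := forall x t, 0 <= t ->
  \int[P x]_X feynman_kac f (rate c%:num f h) t X <= expR (f x).

Lemma resolvent_pair_super f h : resolvent_pair f h -> resolvent_super f h.
Proof. by move=> fh x t t0; rewrite fh. Qed.

Variables f h : Cb R E.
Let q : Cb R E := MkCb (rate_Cb c%:num f h).
Let g : Cb R E := MkCb (rate_Cb 1 f h).

Let log_mart (x : E) (s : R) (X : skorokhod E) : R :=
  f (X s) - f x - time_integral q s X.

Let bmfun_log_mart x s : bmfun (log_mart x s : D -> R).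
Proof.
apply: bmfunB; last exact: bmfun_time_integral.
by apply: bmfunB; [exact: bmfun_coord|exact: bmfun_cst].
Qed.

Let bmfun_log_mart_upto x (s t : R) : 0 <= s <= t ->
  bmfun (log_mart x s : skorokhod_upto E t -> R).
Proof.
move=> st; apply: bmfunB; last exact: bmfun_time_integral_upto.
by apply: bmfunB; [exact: bmfun_coord_upto (Cb_bmfun f) st|exact: bmfun_cst].
Qed.

Let exp_log_mart x s X : expR (log_mart x s X) = (expR (f x))^-1 * feynman_kac f q s X.
Proof. by rewrite -expRN -expRD; congr expR; rewrite /log_mart; ring. Qed.

Let restr_Rint (Q : probability D R) t (F : skorokhod_upto E t -> R) : bmfun F ->
  \int[restr_upto t Q]_X F X = \int[Q]_X F (to_upto t X).
Proof. by move=> bF; exact: (Rint_pushforward Q (@measurable_to_upto R E t) bF). Qed.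

(** The integrand of the resolvent with the entropy replaced by the [Q]-mean of the log-density,
    stopped at [T] so that it stays bounded in [t]. *)
Let payoff (Q : probability D R) x (T t : R) : R :=
  \int[Q]_X h ((X : skorokhod E) t) - \int[Q]_X log_mart x (Num.min t T) X.

Let payoff_bound : exists2 K, 0 <= K & forall (Q : probability D R) x T, 0 <= T ->
  bmfun (payoff Q x T : time -> R) /\
  `|\int[exp_law c]_t payoff Q x T t - f x| <= K * expR (- c%:num * T).
Proof.
have [C C0 fC] := Cb_bounded f; have [B B0 hB] := Cb_bounded h.
exists (B + C) => [|Q x T T0]; first exact: addr_ge0.
have bt (k : Cb R E) : bmfun (fun t : time => \int[Q]_X k ((X : skorokhod E) t)).
  exact: (@bmfun_Rint _ _ _ _ _ (lebesgue_itv 0 0) Q _ (bmfun_joint k)).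
have zE t : \int[Q]_X f ((X : skorokhod E) t) =
    \int[Q]_X h ((X : skorokhod E) t) + \int[Q]_X g ((X : skorokhod E) t).
  rewrite -RintD; [|exact: bmfun_coord|exact: bmfun_coord].
  by apply: eq_Rintegral => X _; rewrite /g /= /rate; ring.
have zK s t : `|\int[Q]_X h ((X : skorokhod E) s) - \int[Q]_X f ((X : skorokhod E) t)| <= B + C.
  apply: le_trans (ler_normB _ _) _; apply: lerD; apply: prob_norm_le => //; exact: bmfun_coord.
have := @exp_law_stopped R c _ _ _ (f x) (B + C) T (bt h) (bt f) (bt g) T0 zE zK.
rewrite (_ : payoff Q x T = fun t : time => \int[Q]_X h ((X : skorokhod E) t) -
  (\int[Q]_X f ((X : skorokhod E) (Num.min t T)) - f x -
    c%:num * \int[lebesgue_measure]_(s in `[0, Num.min t T]) \int[Q]_X g ((X : skorokhod E) s)))//.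
apply/funext => t; rewrite /payoff; congr (_ - _); set s := Num.min t T.
rewrite /log_mart RintB; last 2 first.
- by apply: bmfunB; [exact: bmfun_coord|exact: bmfun_cst].
- exact: bmfun_time_integral.
rewrite RintB; [|exact: bmfun_coord|exact: bmfun_cst].
rewrite Rint_cst mass_probability mulr1; congr (_ - _).
rewrite -(@Rint_lebesgue_itv _ 0 s _ (bt g)).
rewrite (@Rint_Fubini _ _ _ _ _ (lebesgue_itv 0 s) Q _ (bmfun_joint g)) -RintZ; last first.
  exact: (@bmfun_Rint2 _ _ _ _ _ (lebesgue_itv 0 s) Q _ (bmfun_joint g)).
apply: eq_Rintegral => X _.
rewrite /time_integral -(@Rint_lebesgue_itv _ 0 s _ (bmfun_traj X q)).
rewrite -(@RintZ _ _ _ (lebesgue_itv 0 s) c%:num _ (bmfun_traj X g)).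
by apply: eq_Rintegral => u _; rewrite /q /g /= /rate mul1r.
Qed.

Let payoff_integral (Q : probability D R) x T : bmfun (payoff Q x T : time -> R) ->
  (\int[lebesgue_measure]_(t in `[0%R, +oo[) ((payoff Q x T t)%:E * (exponential_pdf c%:num t)%:E) =
  (\int[exp_law c]_t payoff Q x T t)%:E)%E.
Proof.
move=> bp.
have ipdf : lebesgue_measure.-integrable setT (EFin \o exponential_pdf c%:num).
  exact: integrable_exponential_pdf.
have ip := integrableM_pdf c bp ipdf.
rewrite Rint_exp_law// /Rintegral fineK; last exact: integrable_fin_num.
rewrite [LHS]integral_mkcond; apply: eq_integral => t _; rewrite patchE mem_setE in_itv/= andbT.
by case: ifPn => // t0; rewrite lt0_exponential_pdf ?mulr0// ltNge.
Qed.

Let expectation_coord (Q : probability D R) (t : R) :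
  ('E_Q[fun X => h ((X : skorokhod E) t)] = (\int[Q]_X h ((X : skorokhod E) t))%:E)%E.
Proof. by rewrite unlock integral_bmfun//; exact: bmfun_coord. Qed.

Lemma resolvent_ereal_le lam x : lam^-1 = c%:num -> resolvent_super f h ->
  (resolvent_ereal P lam h x <= (f x)%:E)%E.
Proof.
move=> lamE super; apply: ge_ereal_sup => _ [Q _ <-]; rewrite lamE.
have [K K0 bK] := payoff_bound.
have le_payoff T : 0 <= T ->
    (\int[lebesgue_measure]_(t in `[0%R, +oo[)
      (('E_Q[fun X => h ((X : skorokhod E) t)] - relative_entropy_upto t Q (P x)) *
        (exponential_pdf c%:num t)%:E) <= (f x + K * expR (- c%:num * T))%:E)%E.
  move=> T0; have [bp pK] := bK Q x T T0.
  apply: (@le_trans _ _ (\int[exp_law c]_t payoff Q x T t)%:E); last first.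
    by rewrite lee_fin; move: pK; rewrite ler_norml => /andP[_]; lra.
  rewrite -payoff_integral//; apply: le_integral_pointwise => t /=.
  rewrite in_itv/= andbT => t0; apply: lee_wpmul2r; first by rewrite lee_fin exponential_pdf_ge0.
  (* Being stopped no later than [t], the log-density is measurable for the sigma-algebra up to [t],
     on which the entropy is computed. *)
  have tT : 0 <= Num.min t T <= t by rewrite le_min t0 T0 ge_min lexx.
  have blm := bmfun_log_mart_upto x tT.
  rewrite expectation_coord /payoff EFinB; apply: leeB => //.
  rewrite -[X in (X%:E <= _)%E](@restr_Rint Q t _ blm); apply: relative_entropy_ge => //.
  rewrite restr_Rint; last exact: bmfun_exp.
  under eq_Rintegral do rewrite exp_log_mart.
  rewrite RintZ; last exact: bmfun_feynman_kac.
  rewrite ler_pdivrMl ?expR_gt0// mulr1; apply: super.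
  by have /andP[] := tT.
apply/lee_addgt0Pr => e e0; have [T T0 Te] := exp_small (gt0 c) K0 e0.
by apply: le_trans (le_payoff T T0) _; rewrite -EFinD lee_fin lerD2l.
Qed.

Lemma resolvent_ereal_ge lam x : lam^-1 = c%:num -> resolvent_pair f h ->
  ((f x)%:E <= resolvent_ereal P lam h x)%E.
Proof.
move=> lamE pair; have [K K0 bK] := payoff_bound; have [_ _ pb mk] := PM.
have ge_payoff T : 0 <= T -> ((f x - K * expR (- c%:num * T))%:E <= resolvent_ereal P lam h x)%E.
  move=> T0.
  have bw : bmfun (fun X : D => expR (log_mart x T X)) by apply: bmfun_exp; exact: bmfun_log_mart.
  have fk1 s : 0 <= s -> \int[P x]_X expR (log_mart x s X) = 1.
    move=> s0; under eq_Rintegral do rewrite exp_log_mart.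
    rewrite RintZ; last exact: bmfun_feynman_kac.
    by rewrite pair// mulVf// gt_eqF// expR_gt0.
  have [Q QE] := @ex_density_pushforward _ _ D D R (P x) _ id bw (fun X => expR_ge0 _)
    (fk1 T T0) (@measurable_id _ D setT).
  have [bp pK] := bK Q x T T0.
  apply: (@le_trans _ _ (\int[exp_law c]_t payoff Q x T t)%:E).
    by rewrite lee_fin; move: pK; rewrite ler_norml => /andP[+ _]; lra.
  rewrite -payoff_integral//.
  apply: (@le_trans _ _ (\int[lebesgue_measure]_(t in `[0%R, +oo[)
      (('E_Q[fun X => h ((X : skorokhod E) t)] - relative_entropy_upto t Q (P x)) *
        (exponential_pdf c%:num t)%:E))%E); last first.
    rewrite -lamE; apply: ereal_sup_ubound.
    by exists Q.
  apply: le_integral_pointwise => t /=.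
  rewrite in_itv/= andbT => t0; apply: lee_wpmul2r; first by rewrite lee_fin exponential_pdf_ge0.
  have tT : 0 <= Num.min t T <= t by rewrite le_min t0 T0 ge_min lexx.
  have blm := bmfun_log_mart_upto x tT.
  rewrite expectation_coord /payoff EFinB; apply: leeB => //.
  rewrite -[X in (_ <= X%:E)%E](@restr_Rint Q t _ blm); apply: relative_entropy_density => //.
  move=> A mA; have bA := bmfun_indic R mA.
  have bA' : bmfun (fun X : D => \1_A (to_upto t X) : R).
    exact: (bmfun_comp bA (@measurable_to_upto R E t)).
  have beu := bmfun_exp blm.
  have e1 : restr_upto t Q A = (\int[P x]_X (expR (log_mart x T X) * \1_A (to_upto t X)))%:E.
    by rewrite (probability_Rint (restr_upto t Q) mA) (restr_Rint Q bA) (QE _ bA').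
  have e2 := integral_setE (restr_upto t (P x)) mA beu.
  rewrite [LHS]e1 [RHS]e2; congr EFin.
  rewrite (restr_Rint (P x) (bmfunM bA beu)).
  (* If T <= t the density is already measurable up to [t]. Otherwise the Markov property at [t] and
     [pair] integrate out the factor after [t], leaving the density at [t]. *)
  have [Tt|tT'] := leP T t; first by apply: eq_Rintegral => X _; rewrite mulrC.
  have Tt0 : 0 <= T - t by rewrite subr_ge0 ltW.
  pose Z (X : skorokhod_upto E t) : R := \1_A X * expR (- time_integral q t X).
  have bZ : bmfun Z.
    apply: bmfunM => //; apply: bmfun_exp; apply: bmfunN.
    by apply: bmfun_time_integral_upto; rewrite t0 lexx.
  have bZ' : bmfun (Z : D -> R).
    by apply: bmfunM => //; apply: bmfun_exp; apply: bmfunN; exact: bmfun_time_integral.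
  have := mk x t Z _ t0 bZ (bmfun_feynman_kac f q (T - t)).
  move=> /(congr1 (fun z => (expR (f x))^-1 * z)).
  rewrite -!RintZ; last 2 first.
  - exact: (bmfunM bZ' (bmfun_at t0 (pb _ (bmfun_feynman_kac f q (T - t))))).
  - exact: (bmfunM bZ' (bmfun_comp (bmfun_feynman_kac f q (T - t)) (measurable_shift_skorokhod t0))).
  move=> e; transitivity (\int[P x]_X ((expR (f x))^-1 * (Z X * feynman_kac f q (T - t) (shift t X)))).
    apply: eq_Rintegral => X _; rewrite exp_log_mart -{1}[T](subrK t) [T - t + t]addrC.
    by rewrite feynman_kac_shift// /Z; ring.
  rewrite e; apply: eq_Rintegral => X _; rewrite pair// exp_log_mart /Z /feynman_kac.
  by rewrite expRD; ring.
apply/lee_addgt0Pr => e e0; have [T T0 Te] := exp_small (gt0 c) K0 e0.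
have := ge_payoff T T0; rewrite -leeBlDr// => /(le_trans _); apply.
by rewrite -EFinB lee_fin lerB.
Qed.

End resolvent_bounds.

(** * Solving the resolvent equation *)

(** With K = B / (1 - theta) the intervals of centre f_n x and radius K theta^n are nested, which
    gives the limit and the rate at once. *)
Lemma uniform_geometric_limit (R : realType) (T : topologicalType) (f_ : nat -> Cb R T)
    (B theta : R) : 0 <= B -> 0 <= theta < 1 ->
  (forall n x, `|f_ n.+1 x - f_ n x| <= B * theta ^+ n) ->
  exists f : Cb R T, forall n x, `|f_ n x - f x| <= B / (1 - theta) * theta ^+ n.
Proof.
move=> B0 /andP[th0 th1] step.
have th1' : 0 < 1 - theta by rewrite subr_gt0.
set K := B / (1 - theta).
have K0 : 0 <= K by rewrite divr_ge0// ltW.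
have KE : K * (1 - theta) = B by rewrite mulfVK// gt_eqF.
have pw n : 0 <= theta ^+ n by exact: exprn_ge0.
pose L x n := f_ n x - K * theta ^+ n; pose U x n := f_ n x + K * theta ^+ n.
have LS x n : L x n <= L x n.+1.
  have := step n x; rewrite /L exprS -KE ler_norml => /andP[+ _].
  by move: (theta ^+ n) => z; lra.
have US x n : U x n.+1 <= U x n.
  have := step n x; rewrite /U exprS -KE ler_norml => /andP[_].
  by move: (theta ^+ n) => z; lra.
have LU x n m : L x n <= U x m.
  have h1 : L x n <= L x (maxn n m).
    by apply: (@homo_leq _ (L x) <=%R) => //; [exact: le_trans|exact: leq_maxl].
  have h2 : U x (maxn n m) <= U x m.
    by apply: (@homo_leq _ (U x) (fun a b => b <= a)%R) => //;
      [move=> a b d ba ad; exact: le_trans ad ba|exact: leq_maxr].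
  apply: le_trans h1 (le_trans _ h2); rewrite /L /U.
  by have := mulr_ge0 K0 (pw (maxn n m)); lra.
pose f x := sup (range (L x)).
have hs x : has_sup (range (L x)).
  by split; [exists (L x 0%N), 0%N|exists (U x 0%N) => _ [n _ <-]].
have fK n x : `|f_ n x - f x| <= K * theta ^+ n.
  have h1 : L x n <= f x by apply: ub_le_sup; [exact: (hs x).2|exists n].
  have h2 : f x <= U x n by apply: ge_sup; [exact: (hs x).1|move=> _ [m _ <-]].
  by move: h1 h2; rewrite /L /U ler_norml => ? ?; apply/andP; split; lra.
have fCb : f \in @bounded_continuous R T.
  apply: Cb_intro.
    move=> x; apply/cvgrPdist_le => e e0.
    have e30 : 0 < e / 3 by rewrite divr_gt0.
    have : K * theta ^+ n @[n --> \oo] --> (0 : R).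
      by rewrite -[X in _ --> X](mulr0 K); apply: cvgM; [exact: cvg_cst|
        apply: cvg_expr; rewrite ger0_norm].
    move=> /cvgrPdist_le/(_ _ e30)[n _ /(_ n (leqnn n))/=].
    rewrite sub0r normrN ger0_norm; last exact: mulr_ge0.
    move=> Kn.
    have := @Cb_continuous _ _ (f_ n) x; move/cvgrPdist_le/(_ _ e30).
    apply: filterS => y; have := fK n x; have := fK n y; rewrite !ler_norml.
    by move=> /andP[? ?] /andP[? ?] /andP[? ?]; apply/andP; split; lra.
  have [C C0 fC] := Cb_bounded (f_ 0%N); exists (C + K) => x.
  have := fK 0%N x; have := fC x; rewrite expr0 mulr1 !ler_norml.
  by move=> /andP[? ?] /andP[? ?]; apply/andP; split; lra.
by exists (MkCb fCb).
Qed.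

Lemma feynman_kac_stable (R : realType) (E : pseudoPMetricType R) (f f' q q' : Cb R E)
    (e t : R) (X : skorokhod E) : 0 <= t ->
  (forall y, `|f y - f' y| <= e) -> (forall y, `|q y - q' y| <= e) ->
  feynman_kac f q t X <= expR (e * (1 + t)) * feynman_kac f' q' t X.
Proof.
move=> t0 ff qq; rewrite /feynman_kac -expRD ler_expR.
have bq := bmfun_traj X q; have bq' := bmfun_traj X q'.
have : `|time_integral q t X - time_integral q' t X| <= e * (t - 0).
  rewrite /time_integral -RintegralB//; [|exact: bmfun_integrable_itv|exact: bmfun_integrable_itv].
  by apply: Rint_itv_norm_le => //; exact: bmfunB.
have := ff (X t); rewrite !ler_norml => /andP[? ?] /andP[? ?]; lra.
Qed.

Lemma expR_approx_le (R : realType) (a b K : R) : 0 <= b ->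
  (forall e, 0 < e -> a <= expR (K * e) * b) -> a <= b.
Proof.
move=> b0 h; have : expR (K * n.+1%:R^-1) * b @[n --> \oo] --> expR (K * 0) * b.
  apply: cvgM; last exact: cvg_cst.
  have h0 : K * n.+1%:R^-1 @[n --> \oo] --> K * 0.
    by apply: cvgM; [exact: cvg_cst|exact: cvg_harmonic].
  exact: (cvg_comp _ _ h0 (@continuous_expR R _)).
rewrite mulr0 expR0 mul1r; apply: (closed_cvg (fun z => a <= z)).
  exact: closed_ge.
by near=> n; apply: h; rewrite invr_gt0.
Unshelve. all: by end_near. Qed.

(** The solution [k] of c (s - h) = a (1 - k exp(- s)) with kap = c / a: the function whose linear
    resolvent at rate [a] should be exp f when s = f. *)
Definition euler_step (R : realType) (kap h s : R) : R := expR s * (1 - kap * (s - h)).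

(** On the logarithmic scale the step preserves [-H, H], so that the iteration keeps a fixed bound
    and the step stays positive. *)
Lemma euler_step_bounds (R : realType) (H kap h s : R) : 0 < kap -> kap * (1 + 2 * H) <= 1 ->
  `|h| <= H -> `|s| <= H -> expR (- H) <= euler_step kap h s <= expR H.
Proof.
move=> kap0 kapH; rewrite !ler_norml => /andP[h1 h2] /andP[s1 s2]; rewrite /euler_step.
have H0 : 0 <= H by lra.
have kH := mulr_ge0 (ltW kap0) H0.
have kap1 : kap <= 1 by move: kH kapH; lra.
have y0 : 0 <= s + H by lra.
have z0 : 0 <= H - s by lra.
have k1 : kap * (s - h) <= kap * (s + H) by apply: ler_wpM2l; [exact: ltW|lra].
have k2 : kap * (s + H) <= kap * (2 * H) by apply: ler_wpM2l; [exact: ltW|lra].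
have k3 : kap * (h - s) <= kap * (H - s) by apply: ler_wpM2l; [exact: ltW|lra].
have k4 : kap * (H - s) <= H - s by apply: ler_piMl.
apply/andP; split.
  have b0 : 0 <= 1 - kap * (s - h) by move: k1 k2 kapH kH kap0; lra.
  rewrite (_ : - H = s + (- (s + H))); last by ring.
  rewrite expRD ler_wpM2l ?expR_ge0// expRN -div1r ler_pdivrMr ?expR_gt0//.
  apply: le_trans (ler_wpM2l b0 (expR_ge1Dx _)).
  have g1 : 0 <= (s + H) * (1 - kap - kap * (s + H)).
    by apply: mulr_ge0 => //; move: k2 kapH; lra.
  have g2 : 0 <= (s + H) * (kap * (s + H) - kap * (s - h)).
    by apply: mulr_ge0 => //; move: k1; lra.
  by move: g1 g2 k1; lra.
rewrite (_ : H = s + (H - s)); last by ring.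
rewrite expRD ler_wpM2l ?expR_ge0//.
by apply: le_trans (expR_ge1Dx _); move: k3 k4; lra.
Qed.

(** The logarithmic derivative in [s] is 1 - kap / (1 - kap (s - h)). The smallness of [kap] keeps
    the last denominator between [kap] and 2, so the derivative lies between 0 and 1 - kap / 2. The
    proof is its derivative-free version. *)
Lemma euler_step_contract (R : realType) (H kap h s r : R) :
  0 < kap -> kap * (1 + 2 * H) <= 1 -> `|h| <= H -> `|s| <= H -> `|r| <= H ->
  euler_step kap h s <= expR ((1 - kap / 2) * `|s - r|) * euler_step kap h r.
Proof.
move=> kap0 kapH.
rewrite !ler_norml => /andP[h1 h2] /andP[s1 s2] /andP[r1 r2]; rewrite /euler_step.
have H0 : 0 <= H by lra.
have kH := mulr_ge0 (ltW kap0) H0.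
have kap1 : kap <= 1 by move: kH kapH; lra.
have kM (y : R) : y <= 2 * H -> kap * y <= kap * (2 * H) by apply: ler_wpM2l; exact: ltW.
have kr1 : kap * (r - h) <= kap * (2 * H) by apply: kM; lra.
have kr2 : kap * (h - r) <= kap * (2 * H) by apply: kM; lra.
have ks1 : kap * (s - h) <= kap * (2 * H) by apply: kM; lra.
have br : kap <= 1 - kap * (r - h) by move: kr1 kapH; lra.
have br2 : 1 - kap * (r - h) <= 2 by move: kr2 kapH kap0; lra.
have bs : 0 <= 1 - kap * (s - h) by move: ks1 kapH kap0; lra.
have [rs|sr] := leP r s.
  have y0 : 0 <= s - r by rewrite subr_ge0.
  rewrite ger0_norm//.
  pose z := kap / 2 * (s - r).
  have z0 : 0 <= z by rewrite /z !mulr_ge0// ltW.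
  have ks : kap * (s - r) <= kap * (2 * H) by apply: kM; lra.
  have z1 : z < 1 by rewrite /z; move: ks kapH kap0; lra.
  rewrite [in leLHS](_ : s = ((1 - kap / 2) * (s - r) + r) + z); last by rewrite /z; field.
  rewrite expRD -mulrA [expR ((1 - kap / 2) * (s - r) + r)]expRD -!mulrA.
  rewrite !ler_wpM2l ?expR_ge0//.
  rewrite (_ : (1 - kap / 2) * (s - r) + r + z = s); last by rewrite /z; field.
  have e1 : expR z * (1 - z) <= 1.
    have := expR_ge1Dx (- z); rewrite expRN => e2.
    by rewrite mulrC -ler_pdivlMr ?expR_gt0// mul1r.
  have g1 : 0 <= (s - r) * (kap * (1 - (1 - kap * (r - h)) / 2)).
    by rewrite !mulr_ge0 ?(ltW kap0)//; move: br2; lra.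
  have le1 : 1 - kap * (s - h) <= (1 - z) * (1 - kap * (r - h)).
    by move: g1; rewrite /z; lra.
  apply: le_trans (ler_wpM2l (expR_ge0 z) le1) _.
  rewrite mulrA ler_piMl//; by move: br kap0; lra.
have y0 : 0 <= r - s by rewrite subr_ge0 ltW.
have t0 : 0 <= (1 - kap / 2) * `|s - r| by rewrite mulr_ge0//; lra.
apply: (@le_trans _ _ (expR r * (1 - kap * (r - h)))); last first.
  have e1 : 1 <= expR ((1 - kap / 2) * `|s - r|) by rewrite -[X in X <= _](@expR0 R) ler_expR.
  have b1 : 0 <= 1 - kap * (r - h) by move: br kap0; lra.
  by rewrite ler_peMl// mulr_ge0// expR_ge0.
rewrite (_ : expR r = expR s * expR (r - s)); last by rewrite -expRD; congr expR; ring.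
rewrite -mulrA ler_wpM2l ?expR_ge0//.
have b0 : 0 <= 1 - kap * (r - h) by move: br kap0; lra.
apply: le_trans (ler_wpM2r b0 (expR_ge1Dx _)).
have : 0 <= (r - s) * (1 - kap * (r - h) - kap) by rewrite mulr_ge0// subr_ge0.
by lra.
Qed.

Section resolvent_solution.
Context (R : realType) (E : pseudoPMetricType R).
Local Notation D := (borel (skorokhod E)).
Variable P : E -> probability D R.
Hypothesis PM : markov_family P.

Lemma ln_Cb (a : R) (g : Cb R E) : 0 < a -> (forall y, a <= g y) ->
  (fun y => ln (g y)) \in @bounded_continuous R E.
Proof.
move=> a0 ag; have [C C0 gC] := Cb_bounded g.
apply: (@Cb_comp _ _ (@ln R) (`|ln a| + `|ln C|)) => y.
  by apply: continuous_ln; exact: lt_le_trans (ag y).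
have gy0 : 0 < g y by exact: lt_le_trans (ag y).
have gCy : g y <= C by apply: le_trans (gC y); exact: ler_norm.
have h1 : ln a <= ln (g y) by rewrite ler_ln.
have h2 : ln (g y) <= ln C by rewrite ler_ln// posrE (lt_le_trans gy0).
have := ler_norm (ln C); have := ler_norm (- ln a); rewrite normrN.
have := normr_ge0 (ln a); have := normr_ge0 (ln C); rewrite ler_norml => *.
by apply/andP; split; lra.
Qed.

Lemma exp_Cb (g : Cb R E) : (fun y => expR (g y)) \in @bounded_continuous R E.
Proof.
have [C C0 gC] := Cb_bounded g; apply: (@Cb_comp _ _ (@expR R) (expR C)) => y.
  exact: continuous_expR.
rewrite ger0_norm ?expR_ge0// ler_expR.
by apply: le_trans (gC y); exact: ler_norm.
Qed.

Lemma Cb_mul (f g : Cb R E) : (fun y => f y * g y) \in @bounded_continuous R E.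
Proof.
have [C C0 fC] := Cb_bounded f; have [B B0 gB] := Cb_bounded g; apply: Cb_intro.
  by move=> x; apply: (@continuousM _ _ f g); exact: Cb_continuous.
by exists (C * B) => x; rewrite normrM ler_pM.
Qed.

Variable c : {posnum R}.

Let log_resolvent_Cb (k : Cb R E) :
  (fun y => ln (linear_resolvent P c (fun y => expR (k y)) y)) \in @bounded_continuous R E.
Proof.
have [C C0 kC] := Cb_bounded k.
apply: (@ln_Cb (expR (- C)) (MkCb (linear_resolvent_Cb PM c (MkCb (exp_Cb k))))).
  exact: expR_gt0.
move=> y; apply: (@linear_resolvent_ge _ _ P c (MkCb (exp_Cb k))) => z.
by rewrite ler_expR; have := kC z; rewrite ler_norml => /andP[].
Qed.

Definition log_resolvent (k : Cb R E) : Cb R E := MkCb (log_resolvent_Cb k).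

Lemma log_resolventE (k : Cb R E) y :
  expR (log_resolvent k y) = linear_resolvent P c (fun y => expR (k y)) y.
Proof.
have [C C0 kC] := Cb_bounded k.
rewrite lnK// posrE; apply: (@lt_le_trans _ _ (expR (- C))); first exact: expR_gt0.
apply: (@linear_resolvent_ge _ _ P c (MkCb (exp_Cb k))) => z.
by rewrite ler_expR; have := kC z; rewrite ler_norml => /andP[].
Qed.

Lemma log_resolvent_bound (k : Cb R E) (H : R) y : (forall z, `|k z| <= H) ->
  `|log_resolvent k y| <= H.
Proof.
move=> kH; have e := log_resolventE k y.
rewrite ler_norml -(ler_expR (- H)) -(ler_expR _ H) e; apply/andP; split.
- apply: (@linear_resolvent_ge _ _ P c (MkCb (exp_Cb k))) => z.
  by rewrite ler_expR; have := kH z; rewrite ler_norml => /andP[].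
- apply: (@linear_resolvent_le _ _ P c (MkCb (exp_Cb k))) => z.
  by rewrite ler_expR; have := kH z; rewrite ler_norml => /andP[].
Qed.

Lemma log_resolvent_le (k l : Cb R E) (d : R) y : (forall z, k z <= l z + d) ->
  log_resolvent k y <= log_resolvent l y + d.
Proof.
move=> kl; have ek := log_resolventE k y; have el := log_resolventE l y.
rewrite -(ler_expR (log_resolvent k y)) ek expRD el mulrC.
pose ck := MkCb (exp_Cb k); pose cl := MkCb (exp_Cb l).
have bl := bmfun_transition_time P cl y.
rewrite -(RintZ (exp_law c) (expR d) bl).
apply: le_Rint; [exact: (bmfun_transition_time P ck y)|exact: bmfunZ|].
move=> s; rewrite -(RintZ (P y) (expR d) (bmfun_coord cl s)).
apply: le_Rint; [exact: (bmfun_coord ck s)|by apply: bmfunZ; exact: (bmfun_coord cl s)|].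
by move=> X; rewrite -expRD ler_expR addrC; exact: kl.
Qed.

End resolvent_solution.

Section resolvent_existence.
Context (R : realType) (E : pseudoPMetricType R).
Local Notation D := (borel (skorokhod E)).
Variable P : E -> probability D R.
Hypothesis PM : markov_family P.

Let ln_euler_Cb (kap H : R) (h f : Cb R E) : 0 < kap -> kap * (1 + 2 * H) <= 1 ->
  (forall y, `|h y| <= H) -> (forall y, `|f y| <= H) ->
  exists2 k : Cb R E, forall y, expR (k y) = euler_step kap (h y) (f y) & forall y, `|k y| <= H.
Proof.
move=> kap0 kapH hH fH.
pose lin := MkCb (Cb_lincomb 1 kap (MkCb (Cb_cst E 1)) (MkCb (Cb_lincomb 1 (-1) h f))).
pose G := MkCb (Cb_mul (MkCb (exp_Cb f)) lin).
have GE y : G y = euler_step kap (h y) (f y) by rewrite /G /lin /euler_step /=; congr (_ * _); ring.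
have Gb y : expR (- H) <= G y <= expR H by rewrite GE; exact: euler_step_bounds.
have G0 y : 0 < G y by have /andP[+ _] := Gb y; apply: lt_le_trans; exact: expR_gt0.
pose K := MkCb (ln_Cb (expR_gt0 (- H)) (fun y => proj1 (andP (Gb y)))).
have KE y : expR (K y) = G y by rewrite -[K y]/(ln (G y)) lnK// posrE.
exists K => y; first by rewrite KE GE.
by rewrite ler_norml -(ler_expR (- H)) -(ler_expR _ H) KE.
Qed.

(** Uniform errors [e] in the function and in the potential change the exponent by at most e (1 +
    t), so the equation passes to uniform limits. *)
Lemma feynman_kac_approx (f q : Cb R E) :
  (forall e, 0 < e -> exists f' q' : Cb R E,
    [/\ forall y, `|f y - f' y| <= e, forall y, `|q y - q' y| <= e &
     forall x t, 0 <= t -> \int[P x]_X feynman_kac f' q' t X = expR (f' x)]) ->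
  forall x t, 0 <= t -> \int[P x]_X feynman_kac f q t X = expR (f x).
Proof.
move=> approx x t t0; have bfk := bmfun_feynman_kac f q t.
apply/eqP; rewrite eq_le; apply/andP; split.
  apply: (@expR_approx_le _ _ _ (2 + t)) => [|e e0]; first exact: expR_ge0.
  have [f' [q' [ff qq fk]]] := approx e e0; have bfk' := bmfun_feynman_kac f' q' t.
  apply: (@le_trans _ _ (\int[P x]_X (expR (e * (1 + t)) * feynman_kac f' q' t X))).
    apply: (@le_Rint _ _ _ (P x) _ _ bfk (bmfunZ (expR (e * (1 + t))) bfk')) => X.
    exact: feynman_kac_stable.
  rewrite (RintZ (P x) _ bfk') fk// -!expRD ler_expR.
  by have := ff x; rewrite ler_norml => /andP[? ?]; lra.
apply: (@expR_approx_le _ _ _ (2 + t)) => [|e e0].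
  by apply: (@prob_ge _ _ _ (P x)) => // X; exact: expR_ge0.
have [f' [q' [ff qq fk]]] := approx e e0; have bfk' := bmfun_feynman_kac f' q' t.
have ff' y : `|f' y - f y| <= e by rewrite distrC.
have qq' y : `|q' y - q y| <= e by rewrite distrC.
apply: (@le_trans _ _ (expR e * expR (f' x))).
  by rewrite -expRD ler_expR; have := ff x; rewrite ler_norml => /andP[? ?]; lra.
rewrite -(fk x t t0) (_ : (2 + t) * e = e + e * (1 + t)); last by ring.
rewrite expRD -mulrA ler_wpM2l ?expR_ge0//.
rewrite -(RintZ (P x) (expR (e * (1 + t))) bfk).
by apply: (@le_Rint _ _ _ (P x) _ _ bfk' (bmfunZ (expR (e * (1 + t))) bfk)) => X; exact: feynman_kac_stable.
Qed.

(* [f] is the fixed point of [f |-> log_resolvent a (ln (euler_step kap h f))], where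
   [a * kap = c]; the iterates solve the equation for data that converge to [h]. *)
Theorem resolvent_pair_exists (c : {posnum R}) (h : Cb R E) :
  exists f : Cb R E, resolvent_pair P c f h.
Proof.
have [H H0 hH] := Cb_bounded h.
pose kap : R := (1 + 2 * H)^-1.
have H1 : 0 < 1 + 2 * H by rewrite ltr_pwDl// mulr_ge0.
have kap0 : 0 < kap by rewrite invr_gt0.
have kapH : kap * (1 + 2 * H) <= 1 by rewrite mulVf// gt_eqF.
have a0 : 0 < c%:num / kap by rewrite divr_gt0.
have [a akap] : exists a : {posnum R}, a%:num * kap = c%:num.
  by exists (PosNum a0); rewrite /= mulfVK// gt_eqF.
pose bounded (f : Cb R E) := forall y, `|f y| <= H.
have /choice[F PF] : forall f : Cb R E, exists g : Cb R E, bounded f ->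
    bounded g /\ exists2 k : Cb R E,
      forall y, expR (k y) = euler_step kap (h y) (f y) & g = log_resolvent PM a k.
  (* Outside the ball the map is arbitrary, here the identity; the iterates start at [h] and never
     leave the ball. *)
  move=> f; have [bf|nf] := pselect (bounded f); last by exists f.
  have [k kE kH] := ln_euler_Cb kap0 kapH hH bf; exists (log_resolvent PM a k) => _.
  split; last by exists k.
  by move=> y; exact: log_resolvent_bound.
pose f_ n := iter n F h.
have bf n : bounded (f_ n) by elim: n => [|n IH] //=; exact: (PF _ IH).1.
pose theta := 1 - kap / 2.
have kap1 : kap <= 1 by rewrite invf_le1// lerDl mulr_ge0.
have th : 0 <= theta < 1 by rewrite /theta; apply/andP; split; lra.
have contr (f g : Cb R E) (d : R) : bounded f -> bounded g -> (forall y, `|f y - g y| <= d) ->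
    forall y, F f y <= F g y + theta * d.
  move=> Bf Bg fgd y; have [_ [k kE ->]] := PF f Bf; have [_ [l lE ->]] := PF g Bg.
  apply: log_resolvent_le => z; rewrite -(ler_expR (k z)) expRD kE lE mulrC.
  apply: le_trans (euler_step_contract kap0 kapH (hH z) (Bf z) (Bg z)) _.
  rewrite ler_wpM2r//; last by rewrite ler_expR ler_wpM2l//; have /andP[] := th.
  by have /andP[+ _] := euler_step_bounds kap0 kapH (hH z) (Bg z); apply: le_trans; exact: expR_ge0.
have step n y : `|f_ n.+1 y - f_ n y| <= 2 * H * theta ^+ n.
  elim: n y => [|n IH] y.
    rewrite expr0 mulr1; have := bf 1%N y; have := bf 0%N y; rewrite !ler_norml.
    by move=> /andP[? ?] /andP[? ?]; apply/andP; split; lra.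
  have h1 := contr _ _ _ (bf n.+1) (bf n) IH y.
  have IH' z : `|f_ n z - f_ n.+1 z| <= 2 * H * theta ^+ n by rewrite distrC.
  have h2 := contr _ _ _ (bf n) (bf n.+1) IH' y.
  rewrite exprS mulrCA ler_norml; move: h1 h2; rewrite -!/(f_ _.+1) /=.
  by move=> h1 h2; apply/andP; split; lra.
have H20 : 0 <= 2 * H by rewrite mulr_ge0.
have [f fE] := uniform_geometric_limit H20 th step.
exists f; pose q := MkCb (rate_Cb c%:num f h).
apply: (@feynman_kac_approx f q) => e e0.
pose K := 2 * H / (1 - theta).
have K0 : 0 <= K by rewrite /K divr_ge0// subr_ge0 ltW//; have /andP[] := th.
(* M theta^n dominates both errors. The last term is the distance of f_(n+1) to the limit; the
   others bound the error in the potential, from exp(z) - 1 with z = f_n - f_(n+1) and from f_n -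
   f. *)
pose M := (a%:num + c%:num * (2 * H)) * (2 * (2 * H)) + c%:num * K + K.
have [n nM] : exists n, M * theta ^+ n <= e /\ 2 * H * theta ^+ n <= 1 / 2.
  have thn (B : R) : B * theta ^+ n @[n --> \oo] --> (0 : R).
    rewrite -[X in _ --> X](mulr0 B); apply: cvgM; first exact: cvg_cst.
    by apply: cvg_expr; have /andP[? ?] := th; rewrite ger0_norm.
  have h20 : 0 < 1 / 2 :> R by [].
  have := thn (2 * H); move/cvgrPdist_le/(_ _ h20) => near1.
  have := thn M; move/cvgrPdist_le/(_ _ e0) => near2.
  have [n _ /(_ n (leqnn n))/= []] := filterI near1 near2.
  rewrite !sub0r !normrN => h1 h2; exists n.
  by split; [apply: le_trans h2|apply: le_trans h1]; exact: ler_norm.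
move: nM; set d := theta ^+ n => -[Md Hd].
have d0 : 0 <= d by apply: exprn_ge0; have /andP[] := th.
have [_ [k kE FE]] := PF _ (bf n).
have f1E y : expR (f_ n.+1 y) = linear_resolvent P a (fun z => expR (k z)) y.
  by rewrite /f_ /= FE log_resolventE.
pose g := MkCb (Cb_lincomb 1 (-1) k (f_ n.+1)).
(* The potential of the equation that f_(n+1) = log L_a exp(k) solves exactly. Since exp(k) is the
   step at f_n, it equals c (f_n - h) up to the factor exp(f_n - f_(n+1)). *)
pose qn := MkCb (Cb_lincomb a%:num (- a%:num) (MkCb (Cb_cst E 1)) (MkCb (exp_Cb g))).
have qnE y : qn y = a%:num * (1 - expR (k y - f_ n.+1 y)).
  rewrite /qn /g /= (_ : 1 * k y + -1 * f_ n.+1 y = k y - f_ n.+1 y); last by ring.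
  by ring.
have fn y := fE n y; have fS y := fE n.+1 y.
have Kd : K * theta ^+ n.+1 <= K * d.
  by rewrite ler_wpM2l// exprS ler_piMl//; have /andP[_ /ltW] := th.
have M1 : 0 <= (a%:num + c%:num * (2 * H)) * (2 * (2 * H)) by apply: mulr_ge0; [apply: addr_ge0 => //; exact: mulr_ge0|exact: mulr_ge0].
have M2 : 0 <= c%:num * K by rewrite mulr_ge0.
exists (f_ n.+1), qn; split.
- move=> y; rewrite distrC; apply: le_trans (fS y) _; apply: le_trans Kd _; apply: le_trans Md.
  by apply: ler_wpM2r => //; rewrite /M lerDr addr_ge0.
- move=> y; rewrite qnE expRB kE /euler_step.
  have zle : `|f_ n y - f_ n.+1 y| <= 2 * H * d by rewrite distrC; exact: step.
  set z := f_ n y - f_ n.+1 y in zle.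
  have ez : expR (f_ n y) * (1 - kap * (f_ n y - h y)) / expR (f_ n.+1 y) =
      expR z * (1 - kap * (f_ n y - h y)) by rewrite /z expRB; ring.
  rewrite ez.
  rewrite -[q y]/(c%:num * (f y - h y)).
  have z2 : `|z| <= 1 / 2 by apply: le_trans zle Hd.
  have e1 : `|expR z - 1| <= 2 * (2 * H * d).
    by apply: (le_trans (norm_expRB1_le z2)); rewrite ler_wpM2l.
  have fh : `|f_ n y - h y| <= 2 * H.
    by apply: le_trans (ler_normB _ _) _; have := bf n y; have := hH y; lra.
  rewrite (_ : _ - _ = (expR z - 1) * (a%:num - c%:num * (f_ n y - h y)) - c%:num * (f_ n y - f y));
    last by rewrite -akap; ring.
  apply: le_trans (ler_normB _ _) _; rewrite !normrM.
  have t1 : `|expR z - 1| * `|a%:num - c%:num * (f_ n y - h y)| <=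
      2 * (2 * H * d) * (a%:num + c%:num * (2 * H)).
    apply: ler_pM => //; apply: le_trans (ler_normB _ _) _.
    by rewrite normrM (gtr0_norm (gt0 a)) (gtr0_norm (gt0 c)) lerD2l ler_wpM2l.
  have t2 : `|c%:num| * `|f_ n y - f y| <= c%:num * (K * d).
    by rewrite (gtr0_norm (gt0 c)) ler_wpM2l.
  have Kd0 : 0 <= K * d by rewrite mulr_ge0.
  move: Md t1 t2 Kd0; rewrite /M; move: (`|expR z - 1| * _) (`|c%:num| * _) => b1 b2.
  by clear; lra.
- move=> x t t0; apply: (@feynman_kac_resolvent _ _ _ PM a (f_ n.+1) qn (MkCb (exp_Cb k))) => //.
  move=> y; rewrite qnE expRB /= mulrAC -mulrA; congr (_ * _).
  by rewrite mulrBr mulr1 mulrCA divff ?mulr1// gt_eqF// expR_gt0.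
Qed.

End resolvent_existence.

(** * Comparison of resolvents *)

Section comparison.
Context (R : realType) (E : pseudoPMetricType R).
Local Notation D := (borel (skorokhod E)).
Variable P : E -> probability D R.
Hypothesis PM : markov_family P.
Variable c : {posnum R}.
Implicit Types f h k : Cb R E.

Let bmfun_fk f h t : bmfun (feynman_kac f (rate c%:num f h) t : D -> R).
Proof. exact: (bmfun_feynman_kac f (MkCb (rate_Cb c%:num f h)) t). Qed.

Lemma time_integral_le (q q' : Cb R E) t (X : skorokhod E) : (forall y, q y <= q' y) ->
  time_integral q t X <= time_integral q' t X.
Proof.
move=> qq'; have bq := bmfun_traj X q; have bq' := bmfun_traj X q'.
rewrite /time_integral -(@Rint_lebesgue_itv _ 0 t _ bq) -(@Rint_lebesgue_itv _ 0 t _ bq').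
exact: le_Rint.
Qed.

Lemma resolvent_super_le f h h' : (forall y, h y <= h' y) ->
  resolvent_super P c f h' -> resolvent_super P c f h.
Proof.
move=> hh' super x t t0; apply: le_trans (super x t t0).
apply: le_Rint => // X; rewrite ler_expR lerD2l lerN2.
apply: (@time_integral_le (MkCb (rate_Cb c%:num f h')) (MkCb (rate_Cb c%:num f h))) => y.
by rewrite /= /rate ler_wpM2l// lerD2l lerN2.
Qed.

(** The value R(lambda) h lies between the two: it is at least [f] by the near-optimal measure and
    at most [f'] by the entropy inequality. *)
Lemma resolvent_comparison f h f' h' x : resolvent_pair P c f h ->
  resolvent_super P c f' h' -> (forall y, h y <= h' y) -> f x <= f' x.
Proof.
move=> pair super hh'; have super' := resolvent_super_le hh' super.
have cE : (c%:num^-1)^-1 = c%:num by rewrite invrK.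
rewrite -lee_fin; apply: le_trans (resolvent_ereal_le x cE super').
exact: (resolvent_ereal_ge PM x cE pair).
Qed.

(** Adding the same constant to [f'] and [h'] leaves the rate c (f' - h') unchanged and multiplies
    both sides of the equation by exp(r). *)
Lemma resolvent_comparison_shift f h f' h' (r : R) x : resolvent_pair P c f h ->
  resolvent_pair P c f' h' -> (forall y, h y <= h' y + r) -> f x <= f' x + r.
Proof.
move=> pair pair' hh'.
pose one := MkCb (Cb_cst E (1 : R)).
pose fr := MkCb (Cb_lincomb 1 r f' one); pose hr := MkCb (Cb_lincomb 1 r h' one).
have frE y : fr y = f' y + r by rewrite /= mul1r mulr1.
have hrE y : hr y = h' y + r by rewrite /= mul1r mulr1.
rewrite -frE; apply: (resolvent_comparison x pair (h' := hr)); last by move=> y; rewrite hrE.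
move=> y t t0; rewrite frE addrC expRD -(pair' y t t0) -RintZ//.
rewrite le_eqVlt; apply/orP; left; apply/eqP; apply: eq_Rintegral => X _.
rewrite /feynman_kac -expRD; congr expR.
rewrite (_ : rate c%:num fr hr = rate c%:num f' h'); first by rewrite frE; ring.
by apply/funext => z; rewrite /rate frE hrE; ring.
Qed.

(** The half-sum of two solutions is a supersolution for the half-sum of the data: its weight is the
    geometric mean of the two weights, hence at most a weighted arithmetic mean. *)
Lemma resolvent_comparison_convex f h f1 h1 f2 h2 x : resolvent_pair P c f h ->
  resolvent_pair P c f1 h1 -> resolvent_pair P c f2 h2 ->
  (forall y, 2 * h y <= h1 y + h2 y) -> 2 * f x <= f1 x + f2 x.
Proof.
move=> pair pair1 pair2 hh.
pose fm := MkCb (Cb_lincomb (1 / 2) (1 / 2) f1 f2).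
pose hm := MkCb (Cb_lincomb (1 / 2) (1 / 2) h1 h2).
have fmE y : fm y = 1 / 2 * f1 y + 1 / 2 * f2 y by [].
have hmE y : hm y = 1 / 2 * h1 y + 1 / 2 * h2 y by [].
suff : f x <= fm x by rewrite fmE; lra.
apply: (resolvent_comparison x pair (h' := hm)); last by move=> y; rewrite hmE; have := hh y; lra.
move=> y t t0.
(* Chosen so that the weights exp(d) and exp(- d) give both terms the same mean, the exponential of
   the half-sum at [y]. *)
pose d := (f2 y - f1 y) / 2.
have b1 := bmfun_fk f1 h1 t; have b2 := bmfun_fk f2 h2 t.
apply: (@le_trans _ _ (\int[P y]_X (expR d / 2 * feynman_kac f1 (rate c%:num f1 h1) t X +
    expR (- d) / 2 * feynman_kac f2 (rate c%:num f2 h2) t X))).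
  apply: le_Rint; [exact: bmfun_fk|exact: (bmfunD (bmfunZ _ b1) (bmfunZ _ b2))|].
  move=> X.
  have ti : time_integral (rate c%:num fm hm) t X = 1 / 2 * time_integral (rate c%:num f1 h1) t X +
      1 / 2 * time_integral (rate c%:num f2 h2) t X.
    have bq1 := bmfun_traj X (MkCb (rate_Cb c%:num f1 h1)).
    have bq2 := bmfun_traj X (MkCb (rate_Cb c%:num f2 h2)).
    have bq := bmfun_traj X (MkCb (rate_Cb c%:num fm hm)).
    rewrite /time_integral -(@Rint_lebesgue_itv _ 0 t _ bq1) -(@Rint_lebesgue_itv _ 0 t _ bq2).
    rewrite -(@Rint_lebesgue_itv _ 0 t _ bq) -RintZ// -RintZ// -RintD; [|exact: bmfunZ|exact: bmfunZ].
    by apply: eq_Rintegral => s _; rewrite /rate /=; ring.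
  rewrite /feynman_kac ti fmE.
  pose u := expR ((d + (f1 (X t) - time_integral (rate c%:num f1 h1) t X)) / 2).
  pose v := expR ((- d + (f2 (X t) - time_integral (rate c%:num f2 h2) t X)) / 2).
  have uE : expR d * expR (f1 (X t) - time_integral (rate c%:num f1 h1) t X) = u ^+ 2.
    by rewrite /u -expRM_natl -expRD; congr expR; field.
  have vE : expR (- d) * expR (f2 (X t) - time_integral (rate c%:num f2 h2) t X) = v ^+ 2.
    by rewrite /v -expRM_natl -expRD; congr expR; field.
  rewrite [expR d / 2 * _]mulrAC uE [expR (- d) / 2 * _]mulrAC vE.
  rewrite [leLHS](_ : _ = u * v); last by rewrite /u /v -expRD; congr expR; field.
  by have := sqr_ge0 (u - v); rewrite sqrrB -mulr_natl; lra.
rewrite (RintD (P y) (bmfunZ _ b1) (bmfunZ _ b2)) (RintZ _ _ b1) (RintZ _ _ b2) pair1// pair2// [expR d / 2 * _]mulrAC -expRD [expR (- d) / 2 * _]mulrAC -expRD fmE.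
rewrite le_eqVlt; apply/orP; left; apply/eqP.
rewrite (_ : d + f1 y = 1 / 2 * f1 y + 1 / 2 * f2 y); last by rewrite /d; field.
rewrite (_ : - d + f2 y = 1 / 2 * f1 y + 1 / 2 * f2 y); last by rewrite /d; field.
by field.
Qed.

Let log_pair k : exists2 h' : Cb R E, resolvent_pair P c (log_resolvent PM c k) h' &
  forall y, h' y = log_resolvent PM c k y - 1 + expR (k y - log_resolvent PM c k y).
Proof.
have LE := log_resolventE PM c k; move: (log_resolvent PM c k) LE => L LE.
pose one := MkCb (Cb_cst E (1 : R)).
pose ex := MkCb (exp_Cb (MkCb (Cb_lincomb 1 (-1) k L))).
have exE y : ex y = expR (k y - L y) by rewrite /ex /=; congr expR; ring.
pose h' := MkCb (Cb_lincomb 1 1 (MkCb (Cb_lincomb 1 (-1) L one)) ex).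
have h'E y : h' y = L y - 1 + expR (k y - L y) by rewrite -exE /h' /=; ring.
exists h' => // x t t0.
apply: (@feynman_kac_resolvent _ _ _ PM c L (MkCb (rate_Cb c%:num L h')) (MkCb (exp_Cb k))) => //.
move=> y; rewrite -[X in X * _]/(c%:num * (L y - h' y)) -[MkCb _ y]/(expR (k y)) h'E expRB.
rewrite -mulrA; congr (_ * _).
rewrite (_ : L y - _ = 1 - expR (k y) / expR (L y)); last by ring.
by rewrite mulrBl mul1r mulfVK// gt_eqF// expR_gt0.
Qed.

(** Write L for log L_c exp(h). It solves the equation for the datum L - 1 + exp(h - L), which is at
    least [h] because exp z >= 1 + z. *)
Lemma resolvent_pair_le_log f h x : resolvent_pair P c f h -> f x <= log_resolvent PM c h x.
Proof.
move=> pair; have [h' pair' h'E] := log_pair h.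
apply: (resolvent_comparison x pair (resolvent_pair_super pair')) => y.
by rewrite h'E; have := expR_ge1Dx (h y - log_resolvent PM c h y); lra.
Qed.

(** The datum solved by log L_c exp(h) exceeds [h] by the second-order remainder of the exponential,
    at most 2 e^2. *)
Lemma resolvent_pair_ge_log f h (e : R) x : resolvent_pair P c f h -> e <= 1 / 2 ->
  (forall y, `|h y - log_resolvent PM c h y| <= e) ->
  log_resolvent PM c h x - 2 * e ^+ 2 <= f x.
Proof.
move=> pair e2 he; have [h' pair' h'E] := log_pair h.
rewrite lerBlDr; apply: (resolvent_comparison_shift x pair' pair) => y.
have hey := he y; rewrite h'E; move: hey; set z := h y - _ => hey.
have /expR_taylor1/andP[_] : z <= 1 / 2 by apply: le_trans (ler_norm _) (le_trans hey e2).
have : z ^+ 2 <= e ^+ 2.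
  by rewrite -real_normK ?num_real// lerXn2r ?nnegrE// (le_trans _ hey).
by rewrite /z; lra.
Qed.

Variable F : Cb R E -> Cb R E.
Hypothesis FP : forall h, resolvent_pair P c (F h) h.

Lemma iter_le_log j h x : iter j F h x <= iter j (log_resolvent PM c) h x.
Proof.
elim: j x => [|j IH] x //=.
apply: le_trans (resolvent_pair_le_log x (FP (iter j F h))) _.
rewrite -[X in _ <= X]addr0; apply: log_resolvent_le => y.
by rewrite addr0.
Qed.

(** Each step loses 2 e^2 and passes earlier losses on without enlarging them, since the resolvent
    is monotone and commutes with constants. *)
Lemma iter_ge_log j h (e : R) x : e <= 1 / 2 ->
  (forall i y, `|iter i (log_resolvent PM c) h y - iter i.+1 (log_resolvent PM c) h y| <= e) ->
  iter j (log_resolvent PM c) h x - 2 * e ^+ 2 *+ j <= iter j F h x.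
Proof.
move=> e2 he; elim: j x => [|j IH] x; first by rewrite mulr0n subr0.
rewrite mulrS !iterS.
set hj := iter j (log_resolvent PM c) h.
have h1 : log_resolvent PM c hj x - 2 * e ^+ 2 <= F hj x.
  by apply: (resolvent_pair_ge_log x (FP hj)) => // y; exact: he.
have h2 : F hj x <= F (iter j F h) x + 2 * e ^+ 2 *+ j.
  by apply: (resolvent_comparison_shift x (FP _) (FP _)) => y; have := IH y; lra.
by rewrite -/hj; move: h1 h2; lra.
Qed.

Lemma iter_convex j h h1 h2 x : (forall y, 2 * h y <= h1 y + h2 y) ->
  2 * iter j F h x <= iter j F h1 x + iter j F h2 x.
Proof.
move=> hh; elim: j x => [|j IH] x //=.
exact: (resolvent_comparison_convex x (FP _) (FP _) (FP _)).
Qed.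

Lemma iter_log_resolventE j k y :
  expR (iter j (log_resolvent PM c) k y) =
  iter j (linear_resolvent P c) (fun z => expR (k z)) y.
Proof.
elim: j y => [//|j IH] y; rewrite !iterS log_resolventE.
by rewrite -(funext IH).
Qed.

End comparison.

(** * Laplace transforms and a Chebyshev bound for iterated resolvents *)

Section exponential_chebyshev.
Context (R : realType).
Local Notation time := (measurableTypeR R).
Variable c : {posnum R}.

Let measurable_pos : measurable_fun [set: time] (fun s : time => Num.max 0 s : time).
Proof. by apply: (@measurable_maxr _ _ _ setT (cst 0) id). Qed.

Let exp_law_pos (f : time -> R) : bmfun f ->
  \int[exp_law c]_s f s = \int[exp_law c]_s f (Num.max 0 s).
Proof.
move=> bf; apply: eq_Rint_exp_law => //; first exact: (bmfun_comp bf measurable_pos).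
by move=> s s0; rewrite max_r.
Qed.

Lemma Rint_exp_law_norm_le (f g : time -> R) : bmfun f -> bmfun g ->
  (forall s, 0 <= s -> `|f s| <= g s) -> `|\int[exp_law c]_s f s| <= \int[exp_law c]_s g s.
Proof.
move=> bf bg fg; rewrite (exp_law_pos bf) (exp_law_pos bg).
have bf' := bmfun_comp bf measurable_pos; have bg' := bmfun_comp bg measurable_pos.
have fg' s : `|f (Num.max 0 s)| <= g (Num.max 0 s) by apply: fg; rewrite le_max lexx.
rewrite ler_norml -mulN1r -RintZ//; apply/andP; split.
- apply: le_Rint => //; first exact: bmfunZ.
  by move=> s; have := fg' s; rewrite ler_norml mulN1r => /andP[].
- by apply: le_Rint => // s; have := fg' s; rewrite ler_norml => /andP[].
Qed.

(* [expR (- rho * s)] for nonnegative [s], made bounded *)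
Definition exp_decay (rho : R) (s : time) : R := expR (- (rho * Num.max 0 s)).

Lemma bmfun_exp_decay rho : 0 <= rho -> bmfun (exp_decay rho).
Proof.
move=> rho0; split.
  apply: measurableT_comp; first exact: measurable_expR.
  by apply: measurableT_comp => //; apply: measurable_funM => //; exact: measurable_pos.
exists 1 => s; rewrite ger0_norm ?expR_ge0// -expR0 ler_expR oppr_le0 mulr_ge0//.
by rewrite le_max lexx.
Qed.

Lemma Rint_exp_decay rho : 0 <= rho ->
  \int[exp_law c]_s exp_decay rho s = c%:num / (c%:num + rho).
Proof.
move=> rho0; have cr0 : 0 < c%:num + rho by rewrite ltr_wpDr.
pose cr := PosNum cr0; have bd := bmfun_exp_decay rho0.
rewrite Rint_exp_law// -[RHS]mulr1 -(mass_exp_law cr) -Rint_cst.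
rewrite Rint_exp_law; last exact: bmfun_cst.
apply: eq_Rintegral => s _; have [s0|s0] := leP 0 s; last first.
  by rewrite !lt0_exponential_pdf// !mulr0.
rewrite !exponential_pdfE// /exp_decay max_r//=.
rewrite [RHS]mulrA mulfVK ?gt_eqF// mulrCA; congr (_ * _).
by rewrite -expRD; congr expR; ring.
Qed.

End exponential_chebyshev.

Section chebyshev.
Context (R : realType) (E : pseudoPMetricType R).
Local Notation D := (borel (skorokhod E)).
Local Notation time := (measurableTypeR R).
Variable P : E -> probability D R.
Hypothesis PM : markov_family P.

Lemma iter_linear_resolvent_Cb (c : {posnum R}) (g : Cb R E) j :
  iter j (linear_resolvent P c) g \in @bounded_continuous R E.
Proof.
elim: j => [|j IH]; first exact: Cb_funP.
exact: (linear_resolvent_Cb PM c (MkCb IH)).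
Qed.

(** The mean of (exp(- (s + T)) - exp(- t))^2, where T is the sum of [j] independent exponential
    times of rate [c]. *)
Definition cheb (c t : R) (j : nat) (s : R) : R :=
  (c / (c + 2)) ^+ j * expR (- (2 * s)) -
  2 * expR (- t) * ((c / (c + 1)) ^+ j * expR (- s)) + expR (- (2 * t)).

Let expR2N (s : R) : expR (- (2 * s)) = expR (- s) ^+ 2.
Proof. by rewrite -expRM_natl; congr expR; ring. Qed.

Lemma cheb0 c t s : cheb c t 0 s = (expR (- s) - expR (- t)) ^+ 2.
Proof.
by rewrite /cheb !expR2N; ring.
Qed.

(* A Chebyshev inequality for the sum of [j] independent exponential times, whose
   Laplace transforms at 1 and 2 appear in [cheb]. *)
Lemma iter_linear_resolvent_near (c : {posnum R}) (g : Cb R E) (t a e C : R) y j s :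
  (forall s, 0 <= s -> `|transition P s g y - a| <= e + C * (expR (- s) - expR (- t)) ^+ 2) ->
  0 <= s -> `|transition P s (iter j (linear_resolvent P c) g) y - a| <= e + C * cheb c%:num t j s.
Proof.
move=> near; elim: j s => [|j IH] s s0; first by rewrite cheb0; exact: near.
pose k := MkCb (iter_linear_resolvent_Cb c g j).
rewrite iterS (transition_linear_resolvent PM c k y s0).
have bS : bmfun (fun r : time => transition P (r + s) k y).
  exact: (bmfun_comp (bmfun_transition_time P k y) (measurable_shift s)).
rewrite (_ : _ - a = \int[exp_law c]_r (transition P (r + s) k y - a)); last first.
  by rewrite RintB//; [rewrite Rint_cst mass_exp_law mulr1|exact: bmfun_cst].
pose b2 := bmfun_exp_decay (ler0n R 2); pose b1 := bmfun_exp_decay (ler0n R 1).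
pose u := C * ((c%:num / (c%:num + 2)) ^+ j * expR (- (2 * s))).
pose v := C * (2 * expR (- t) * ((c%:num / (c%:num + 1)) ^+ j * expR (- s))).
pose w := e + C * expR (- (2 * t)).
have bd2 : bmfun (fun r : time => u * exp_decay 2 r) by exact: bmfunZ.
have bd1 : bmfun (fun r : time => v * exp_decay 1 r) by exact: bmfunZ.
apply: (@le_trans _ _ (\int[exp_law c]_r (u * exp_decay 2 r - v * exp_decay 1 r + w))).
  apply: Rint_exp_law_norm_le.
  - by apply: bmfunB => //; exact: bmfun_cst.
  - by apply: bmfunD; [exact: bmfunB|exact: bmfun_cst].
  move=> r r0; apply: le_trans (IH _ (addr_ge0 r0 s0)) _.
  rewrite /exp_decay max_r// /cheb /u /v /w mul1r !expR2N opprD expRD.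
  by rewrite le_eqVlt; apply/orP; left; apply/eqP; ring.
rewrite RintD; [|exact: bmfunB|exact: bmfun_cst].
rewrite RintB// RintZ// RintZ// !Rint_exp_decay// Rint_cst mass_exp_law mulr1.
by rewrite /u /v /w /cheb !exprS le_eqVlt; apply/orP; left; apply/eqP; ring.
Qed.

(** Joint continuity covers the times near [t]. At the other times, however large, exp(- s) stays
    away from exp(- t), and a large [C] absorbs the trivial bound 2 B. *)
Lemma transition_near (g : Cb R E) (t : R) (x : E) (e : R) : 0 <= t -> 0 < e ->
  exists2 C, 0 <= C & \forall y \near x, forall s, 0 <= s ->
    `|transition P s g y - transition P t g x| <= e + C * (expR (- s) - expR (- t)) ^+ 2.
Proof.
move=> t0 e0; have [B B0 gB] := Cb_bounded g.
have [k kP] : exists k : nat, forall y, ball x k.+1%:R^-1 y -> forall s, 0 <= s ->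
    `|s - t| <= k.+1%:R^-1 -> `|transition P s g y - transition P t g x| <= e.
  apply: contrapT => /forallNP h.
  have /choice[z zP] : forall k : nat, exists z : E * R, [/\ ball x k.+1%:R^-1 z.1, 0 <= z.2,
      `|z.2 - t| <= k.+1%:R^-1 & e < `|transition P z.2 g z.1 - transition P t g x|].
    move=> k; have /existsNP[y /not_implyP[xy /existsNP[s]]] := h k.
    move=> /not_implyP[s0 /not_implyP[st /negP]]; rewrite -ltNge => es.
    by exists (y, s).
  have z1 : (z k).1 @[k --> \oo] --> x.
    apply/cvg_ballP => d d0; near=> k; have [xz _ _ _] := zP k; apply: le_ball xz.
    by apply: ltW; near: k; exact: (near_infty_natSinv_lt (PosNum d0)).
  have z2 : (z k).2 @[k --> \oo] --> t.
    apply/cvgrPdist_le => d d0; near=> k; have [_ _ zt _] := zP k.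
    rewrite distrC; apply: le_trans zt _; apply: ltW.
    by near: k; exact: (near_infty_natSinv_lt (PosNum d0)).
  have := transition_cvg PM (g := g) t0 z2 z1; move/cvgrPdist_le/(_ _ e0) => [k _ /(_ k (leqnn k))/=].
  by have [_ _ _] := zP k; rewrite distrC ltNge => /negP.
pose d : R := k.+1%:R^-1; have d0 : 0 < d by rewrite invr_gt0.
(* A lower bound for the distance of exp(- s) to exp(- t) over all [s] at distance at least [d] from
   [t]; it is attained at s = t + d. *)
pose eta := expR (- t) * (1 - expR (- d)).
have eta0 : 0 < eta.
  by rewrite mulr_gt0 ?expR_gt0// subr_gt0 -expR0 ltr_expR oppr_lt0.
have C0 : 0 <= 2 * B / eta ^+ 2 by apply: divr_ge0; [exact: mulr_ge0|exact: sqr_ge0].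
exists (2 * B / eta ^+ 2) => //.
near=> y => s s0.
have xy : ball x d y by near: y; exact: nbhsx_ballx.
have [sd|ds] := leP (`|s - t|) d.
  by apply: le_trans (kP y xy s s0 sd) _; rewrite lerDl mulr_ge0// sqr_ge0.
have etas : eta <= `|expR (- s) - expR (- t)|.
  have mono (a b : R) : a <= t -> d <= b - a -> eta <= expR (- a) - expR (- b).
    move=> at' dba; rewrite (_ : - b = - a + - (b - a)); last by ring.
    rewrite expRD -{1}[expR (- a)]mulr1 -mulrBr ler_pM ?expR_ge0//.
    - by rewrite subr_ge0 -expR0 ler_expR oppr_le0 ltW.
    - by rewrite ler_expR lerN2.
    - by rewrite lerD2l lerN2 ler_expR lerN2.
  have [st|ts] := leP s t.
    apply: le_trans (ler_norm _); apply: mono => //.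
    by move: ds; rewrite distrC ger0_norm ?subr_ge0// => /ltW.
  rewrite distrC; apply: le_trans (ler_norm _); apply: mono => //.
  by move: ds; rewrite gtr0_norm ?subr_gt0// => /ltW.
apply: (@le_trans _ _ (2 * B)).
  apply: le_trans (ler_normB _ _) _.
  have := transition_norm_le P s y gB; have := transition_norm_le P t x gB; lra.
have : eta ^+ 2 <= (expR (- s) - expR (- t)) ^+ 2.
  by rewrite -[leRHS]real_normK ?num_real// lerXn2r ?nnegrE// ltW.
move=> h; have : 2 * B <= 2 * B / eta ^+ 2 * (expR (- s) - expR (- t)) ^+ 2.
  by rewrite -{1}[2 * B](@mulfVK _ (eta ^+ 2)) ?expf_neq0 ?gt_eqF// ler_wpM2l.
by lra.
Unshelve. all: by end_near. Qed.

End chebyshev.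

(** * Convergence of the iterates *)

Section strict_topology.
Context (R : realType).

Lemma strict_seminorm_le (T : topologicalType) (a : nat -> R) (K : nat -> set T) (f : T -> R) (b : R) :
  0 <= b -> (forall n, 0 <= a n) -> (forall n x, K n x -> a n * `|f x| <= b) ->
  strict_seminorm a K f <= b.
Proof.
move=> b0 a0 ab; apply: ge_sup; first by exists (a 0%N * sup [set `|f x| | x in K 0%N]), 0%N.
move=> _ [n _ <-]; have [->|/set0P[x Kx]] := eqVneq (K n) set0.
  by rewrite image_set0 sup0 mulr0.
have [an0|an] := eqVneq (a n) 0; first by rewrite an0 mul0r.
have {}an : 0 < a n by rewrite lt_def an a0.
rewrite mulrC -ler_pdivlMr//; apply: ge_sup; first by exists `|f x|, x.
by move=> _ [y Ky <-]; rewrite ler_pdivlMr// mulrC; exact: ab.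
Qed.

Lemma le_strict_seminorm (T : topologicalType) (a : nat -> R) (K : nat -> set T) (f : T -> R) (B M : R) n x :
  (forall n, 0 <= a n) -> (forall n, a n <= M) -> (forall x, `|f x| <= B) -> K n x ->
  a n * `|f x| <= strict_seminorm a K f.
Proof.
move=> a0 aM fB Kx.
have ubK m : has_ubound [set `|f x| | x in K m] by exists B => _ [y _ <-].
have B0 : 0 <= B by apply: le_trans (fB x).
apply: (@le_trans _ _ (a n * sup [set `|f x| | x in K n])).
  by apply: ler_wpM2l => //; apply: ub_le_sup => //; exists x.
apply: ub_le_sup; last by exists n.
exists (M * B) => _ [m _ <-].
have [->|/set0P[y Ky]] := eqVneq (K m) set0.
  by rewrite image_set0 sup0 mulr0 mulr_ge0// (le_trans (a0 0%N)).
apply: ler_pM => //.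
  by apply: le_trans (ub_le_sup (ubK m) _); [exact: (normr_ge0 (f y))|exists y].
by apply: ge_sup; [exists `|f y|, y|move=> _ [z _ <-]].
Qed.

(** Subbasic balls may be centred anywhere, so every ball containing [f] has to be tested, not only
    those centred at [f]. *)
Lemma cvg_subbase (T : topologicalType) (f_ : nat -> Cb R T) (f : Cb R T) :
  (forall g a K r, strict_admissible a K -> 0 < r -> strict_seminorm a K (f - g : Cb R T) < r ->
    \forall n \near \oo, strict_seminorm a K (f_ n - g : Cb R T) < r) ->
  f_ n @[n --> \oo] --> f.
Proof.
move=> h A /=; rewrite nbhsE => -[U [oU Uf] UA].
move: oU => [D' D'sub DU]; move: Uf; rewrite -DU => -[V D'V Vf].
have [J Jsub JV] := D'sub V D'V.
have : \forall n \near \oo, V (f_ n).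
  rewrite -JV; rewrite -JV in Vf.
  apply: (@filter_bigI _ _ J (fun i => [set n | strict_seminorm i.1.2.1 i.1.2.2 (f_ n - i.1.1 : Cb R T) < i.2])).
  move=> i iJ; have := Jsub i iJ; rewrite inE => -[adm r0].
  by apply: h => //; exact: Vf.
by apply: filterS => n Vn; apply: UA; rewrite -DU; exists V.
Qed.

(** For all but finitely many indices of a seminorm the uniform bound [B] and a_n --> 0 suffice; for
    each remaining one, compactness of K_n turns local uniformity into uniformity on K_n. *)
Lemma cvg_strict (T : topologicalType) (f_ : nat -> Cb R T) (f : Cb R T) (B : R) :
  (forall n x, `|f_ n x - f x| <= B) ->
  (forall (x : T) (e : R), 0 < e -> \forall y \near x & n \near \oo, `|f_ n y - f y| <= e) ->
  f_ n @[n --> \oo] --> f.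
Proof.
move=> fB ffe; apply: cvg_subbase => g a K r [a0 acvg cK] r0 fgr.
have subE (u v : Cb R T) x : (u - v : Cb R T) x = u x - v x by [].
have [M aM] : exists M, forall n, a n <= M.
  have /cvg_seq_bounded[M [_ h]] := cvgP _ acvg.
  exists (M + 1) => n; apply: le_trans (ler_norm _) _.
  by apply: (h (M + 1)) => //; rewrite ltrDl.
have [C C0 fgC] := Cb_bounded (f - g : Cb R T).
pose b := Num.max 0 (strict_seminorm a K (f - g : Cb R T)).
have b0 : 0 <= b by rewrite le_max lexx.
have br : b < r by rewrite gt_max r0.
pose eta := (r - b) / 2; have eta0 : 0 < eta by rewrite /eta divr_gt0// subr_gt0.
suff : \forall m \near \oo, forall n x, K n x -> a n * `|f_ m x - f x| <= eta.
  apply: filterS => m hm.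
  apply: (@le_lt_trans _ _ (b + eta)); last by rewrite /eta; move: br; lra.
  apply: strict_seminorm_le => // [|n x Kx]; first by rewrite addr_ge0// ltW.
  have h2 := hm n x Kx; have h1 : a n * `|(f - g : Cb R T) x| <= b.
    by rewrite le_max (le_strict_seminorm a0 aM fgC Kx) orbT.
  rewrite subE in h1; rewrite subE (_ : f_ m x - g x = (f x - g x) + (f_ m x - f x)); last by ring.
  apply: le_trans (ler_wpM2l (a0 n) (ler_normD _ _)) _.
  by rewrite mulrDr lerD.
have B0 : 0 <= `|B| + 1 by rewrite addr_ge0.
have Bp : 0 < `|B| + 1 by rewrite ltr_wpDl.
have [N aN] : exists N, forall n, (N <= n)%N -> a n * (`|B| + 1) <= eta.
  move/cvgrPdist_le : acvg => /(_ (eta / (`|B| + 1))); rewrite divr_gt0// => /(_ isT)[N _ hN].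
  exists N => n Nn; have := hN n Nn; rewrite /= sub0r normrN ger0_norm// => h.
  by rewrite -ler_pdivlMr.
have small n : \forall m \near \oo, forall x, K n x -> a n * `|f_ m x - f x| <= eta.
  have M0 : 0 < `|M| + 1 by rewrite ltr_wpDl.
  have e0 : 0 < eta / (`|M| + 1) by rewrite divr_gt0.
  have := (compact_near_coveringP (K n)).1 (cK n) nat \oo
    (fun m x => `|f_ m x - f x| <= eta / (`|M| + 1)) eventually_filter (fun x _ => ffe x _ e0).
  apply: filterS => m hm x Kx.
  have h1 := hm x Kx; apply: (@le_trans _ _ ((`|M| + 1) * (eta / (`|M| + 1)))).
    by apply: ler_pM => //; apply: le_trans (aM n) _; apply: le_trans (ler_norm _) _; rewrite lerDl.
  by rewrite mulrCA divff ?mulr1// gt_eqF.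
have smallN k : \forall m \near \oo, forall n x, (n < k)%N -> K n x -> a n * `|f_ m x - f x| <= eta.
  elim: k => [|k IH]; first by near=> m.
  have := small k; apply: filterS2 IH => m h1 h2 n x; rewrite ltnS leq_eqVlt => /predU1P[->|nk].
    exact: h2.
  exact: h1.
have := smallN N; apply: filterS => m hm n x Kx; have [nN|Nn] := ltnP n N; first exact: hm.
apply: le_trans (aN n Nn); apply: ler_wpM2l => //.
by apply: le_trans (fB m x) _; apply: le_trans (ler_norm _) _; rewrite lerDl.
Unshelve. all: by end_near. Qed.

End strict_topology.

(** * Initial data smoothed by a resolvent *)

Section smoothing.
Context (R : realType) (E : pseudoPMetricType R).
Local Notation D := (borel (skorokhod E)).
Local Notation time := (measurableTypeR R).
Variable P : E -> probability D R.
Hypothesis PM : markov_family P.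

Let lip (g : E -> R) (L : R) := forall y d, 0 <= d -> `|transition P d g y - g y| <= L * d.

Let lip_linear_resolvent (c : {posnum R}) (g : Cb R E) L : lip g L -> lip (linear_resolvent P c g) L.
Proof.
move=> gL y d d0; rewrite (transition_linear_resolvent PM c g y d0).
have b0 := bmfun_transition_time P g y.
have bd : bmfun (fun r : time => transition P (r + d) g y) by exact: (bmfun_comp b0 (measurable_shift d)).
rewrite -RintB// -[L * d]mulr1 -(mass_exp_law c) -Rint_cst.
apply: Rint_exp_law_norm_le => [||r r0]; [exact: bmfunB|exact: bmfun_cst|].
have rd : 0 <= r <= r + d by rewrite r0 lerDl.
by apply: le_trans (transition_lip PM y gL rd) _; rewrite addrAC subrr add0r.
Qed.

(** The increment over time [r] is at most L r and at most 2 B, hence at most K r / (1 + r) <= K (1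
    - exp(- r)), a bounded function whose exponential mean is K / (c + 1). *)
Lemma linear_resolvent_sub_le (c : {posnum R}) (g : Cb R E) (L B : R) y : 0 <= L ->
  (forall y, `|g y| <= B) -> lip g L ->
  `|linear_resolvent P c g y - g y| <= (2 * L + 4 * B) / c%:num.
Proof.
move=> L0 gB gL; have B0 : 0 <= B by apply: le_trans (gB y).
set K := 2 * L + 4 * B; have K0 : 0 <= K by rewrite /K addr_ge0 ?mulr_ge0.
have b0 := bmfun_transition_time P g y; have bd := bmfun_exp_decay (ler0n R 1).
rewrite (_ : _ - _ = \int[exp_law c]_r (transition P r g y - g y)); last first.
  by rewrite RintB//; [rewrite Rint_cst mass_exp_law mulr1|exact: bmfun_cst].
have b1 : bmfun (fun r : time => 1 - exp_decay 1 r) by apply: bmfunB => //; exact: bmfun_cst.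
apply: (@le_trans _ _ (\int[exp_law c]_r (K * (1 - exp_decay 1 r)))).
  apply: Rint_exp_law_norm_le => [||r r0]; [by apply: bmfunB => //; exact: bmfun_cst|exact: bmfunZ|].
  rewrite /exp_decay max_r// mul1r.
  have er : r / (1 + r) <= 1 - expR (- r).
    rewrite expRN lerBrDr -lerBrDl (_ : 1 - r / (1 + r) = (1 + r)^-1); last first.
      by field; rewrite gt_eqF// ltr_pwDl.
    by rewrite lef_pV2 ?posrE ?expR_gt0 ?ltr_pwDl// expR_ge1Dx.
  apply: (@le_trans _ _ (K * (r / (1 + r)))); last by rewrite ler_wpM2l.
  rewrite mulrA ler_pdivlMr ?ltr_pwDl//.
  have h1 := gL y r r0.
  have h2 : `|transition P r g y - g y| <= 2 * B.
    apply: le_trans (ler_normB _ _) _; have := gB y.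
    by have := transition_norm_le P r y gB; lra.
  move: h1 h2; move: (`|_ - _|) => z h1 h2.
  have g1 : z * r <= 2 * B * r by rewrite ler_wpM2r.
  have g2 : 0 <= L * r by rewrite mulr_ge0.
  have g3 : 0 <= B * r by rewrite mulr_ge0.
  by rewrite /K; lra.
rewrite RintZ// RintB//; last exact: bmfun_cst.
rewrite Rint_cst mass_exp_law mul1r Rint_exp_decay//.
rewrite (_ : 1 - _ = (c%:num + 1)^-1); last by field; rewrite gt_eqF// addr_gt0.
by rewrite ler_wpM2l// lef_pV2 ?posrE ?addr_gt0// lerDl.
Qed.

Lemma expR_inj_lip (H a b : R) : - H <= a -> - H <= b -> `|a - b| <= expR H * `|expR a - expR b|.
Proof.
wlog ab : a b / b <= a => [h Ha Hb|Ha Hb].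
  have [ab|/ltW ab] := leP b a; first exact: h.
  by rewrite distrC [`|expR a - _|]distrC; exact: h.
rewrite !ger0_norm ?subr_ge0 ?ler_expR//.
rewrite (_ : expR a = expR b * expR (a - b)); last by rewrite -expRD; congr expR; ring.
rewrite -[X in _ <= _ * (_ - X)]mulr1 -mulrBr mulrA -expRD.
have h1 : a - b <= expR (a - b) - 1 by have := expR_ge1Dx (a - b); lra.
apply: (le_trans h1); rewrite ler_peMl ?subr_ge0 -?[X in X <= _](@expR0 R) ?ler_expR ?subr_ge0//.
by rewrite addrC -lerBlDr sub0r.
Qed.

(** The Lipschitz constant in time of L_b exp(h) is inherited by all its images under L_c, so [K]
    depends on neither [c] nor [j]. The logarithm costs a factor exp(H). *)
Lemma log_resolvent_iter_step (b : {posnum R}) (h : Cb R E) : exists2 K, 0 <= K &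
  forall (c : {posnum R}) j y,
    `|iter j (log_resolvent PM c) (log_resolvent PM b h) y -
      iter j.+1 (log_resolvent PM c) (log_resolvent PM b h) y| <= K / c%:num.
Proof.
have [H H0 hH] := Cb_bounded h.
pose B := expR H; have B0 : 0 <= B by exact: expR_ge0.
pose L := 2 * B * b%:num; have L0 : 0 <= L by rewrite /L !mulr_ge0.
exists (B * (2 * L + 4 * B)); first by rewrite mulr_ge0// addr_ge0// mulr_ge0.
move=> c j y; set k := log_resolvent PM b h.
have bound i z : `|iter i (log_resolvent PM c) k z| <= H.
  elim: i z => [|i IH] z; first exact: log_resolvent_bound.
  exact: log_resolvent_bound.
have bound' i z : - H <= iter i (log_resolvent PM c) k z.
  by have := bound i z; rewrite ler_norml => /andP[].
apply: le_trans (expR_inj_lip (bound' j y) (bound' j.+1 y)) _.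
rewrite -mulrA ler_wpM2l//.
have e1 := iter_log_resolventE PM c j k y.
have e2 : expR (iter j.+1 (log_resolvent PM c) k y) =
    linear_resolvent P c (iter j (linear_resolvent P c) (fun z => expR (k z))) y.
  exact: iter_log_resolventE PM c j.+1 k y.
rewrite distrC [X in `|X - _|]e2 [X in `|_ - X|]e1.
pose g := MkCb (iter_linear_resolvent_Cb PM c (MkCb (exp_Cb k)) j).
apply: (@linear_resolvent_sub_le c g) => //.
  move=> z; rewrite /g /= -(iter_log_resolventE PM c j k z) ger0_norm ?expR_ge0// ler_expR.
  by apply: le_trans (bound j z); exact: ler_norm.
rewrite /g /=; clear e1 e2; elim: j @g => [|j IH] g /=.
  rewrite (_ : (fun z => expR (k z)) = linear_resolvent P b (fun z => expR (h z))); last first.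
    by apply/funext => z; exact: log_resolventE.
  move=> z d d0; apply: (@linear_resolvent_lip _ _ _ PM b (MkCb (exp_Cb h))) => // w.
  by rewrite /= ger0_norm ?expR_ge0// ler_expR (le_trans (ler_norm _)).
exact: (@lip_linear_resolvent c (MkCb (iter_linear_resolvent_Cb PM c (MkCb (exp_Cb k)) j))).
Qed.

(** The Chebyshev bound for a single exponential time at t = 0, where [cheb] is at most 2 / (n +
    1). *)
Lemma log_resolvent_cvg (h : Cb R E) y :
  expR (log_resolvent PM (PosNum (ltr0Sn R n)) h y) @[n --> \oo] --> expR (h y).
Proof.
apply/cvgrPdist_le => e e0; have e20 : 0 < e / 2 by rewrite divr_gt0.
pose g := MkCb (exp_Cb h).
have [C C0 /nbhs_singleton near_y] := transition_near PM g y (lexx 0) e20.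
near=> n; rewrite log_resolventE distrC.
have near_y' s : 0 <= s -> `|transition P s g y - g y| <= e / 2 + C * (expR (- s) - expR (- 0)) ^+ 2.
  by move=> s0; have := near_y s s0; rewrite (transition0 PM).
have := iter_linear_resolvent_near PM (PosNum (ltr0Sn R n)) 1 near_y' (lexx 0).
pose g1 := MkCb (iter_linear_resolvent_Cb PM (PosNum (ltr0Sn R n)) g 1).
rewrite (transition0 PM g1) /= => h1; apply: (le_trans h1).
have hC : C * cheb n.+1%:R 0 1 0 <= C * (2 / n.+1%:R).
  rewrite ler_wpM2l// /cheb !expr1 !mulr0 !oppr0 !expR0 !mulr1.
  have p0 : 0 < n.+1%:R :> R by [].
  move: p0; move: (n.+1%:R : R) => p p0.
  have q2 : p / (p + 2) <= 1 by rewrite ler_pdivrMr ?mul1r ?lerDl// addr_gt0.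
  have q1 : 1 - p^-1 <= p / (p + 1).
    rewrite (_ : p / (p + 1) = 1 - (p + 1)^-1); last by field; rewrite gt_eqF// addr_gt0.
    by rewrite lerD2l lerN2 lef_pV2 ?posrE ?addr_gt0// lerDl.
  by lra.
have : C * (2 / n.+1%:R) <= e / 2.
  rewrite mulrA ler_pdivrMr// -ler_pdivrMl//.
  by apply: le_trans (_ : n%:R <= _); [near: n; exact: nbhs_infty_ger|rewrite ler_nat].
move=> h2; have := le_trans hC h2.
by move: (C * cheb _ _ _ _) => v; lra.
Unshelve. all: by end_near. Qed.

End smoothing.

(* A lower bound at [u] passes to [h] by convexity and the upper bound at [v], where
   [2 u <= h + v]. *)
Lemma near_convex_squeeze (R : realType) (T : Type) (G : set_system T) (FG : Filter G)
    (Fh Fu Fv Lh Lu Lv d : T -> R) (a b b' e : R) :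
  `|a - b| <= e / 8 -> `|a - b'| <= e / 8 ->
  (forall p, Fh p <= Lh p) -> (forall p, Fv p <= Lv p) ->
  (forall p, 2 * Fu p <= Fh p + Fv p) ->
  (\forall p \near G, `|a - Lh p| <= e / 8) -> (\forall p \near G, `|b - Lu p| <= e / 8) ->
  (\forall p \near G, `|b' - Lv p| <= e / 8) -> (\forall p \near G, Lu p - d p <= Fu p) ->
  (\forall p \near G, `|0 - d p| <= e / 8) ->
  \forall p \near G, `|a - Fh p| <= e.
Proof.
move=> v1 v2 le_h le_v cv nh nu nv low nd.
(* The fraction 1/8 is exactly consumed: 2 Fu - Fv loses twice 3/8 (from [b], [Lu] and [d]) and once
   2/8 (from [b'] and [Lv]). *)
apply: filterS3 (filterI nh nu) (filterI nv low) nd => p [+ +] [].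
move: (le_h p) (le_v p) (cv p) v1 v2; rewrite sub0r normrN.
move: (Fh p) (Fu p) (Fv p) (Lh p) (Lu p) (Lv p) (d p); clear => a1 a2 a3 a4 a5 a6 a7.
rewrite !ler_norml => ? ? ? /andP[? ?] /andP[? ?] /andP[? ?] /andP[? ?] /andP[? ?] ? /andP[? ?].
by apply/andP; split; lra.
Qed.

(** * Locally uniform convergence of the iterates *)

Section trotter_limit.
Context (R : realType) (E : pseudoPMetricType R).
Local Notation D := (borel (skorokhod E)).
Variable P : E -> probability D R.
Hypothesis PM : markov_family P.
Variable t : R.
Hypothesis t0 : 0 < t.

(** The rate 1/lambda for lambda = t / m with m = n + 1, so that [n] iterations too few would be the
    error to avoid: every iterate below has exponent n + 1. *)
Let c (n : nat) : {posnum R} := PosNum (divr_gt0 (ltr0Sn R n) t0).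

Let inv_exp_bounds (u : R) : 0 <= u -> expR (- u) <= (1 + u)^-1 <= expR (- u + u ^+ 2).
Proof.
move=> u0; have u1 : 0 < 1 + u by rewrite ltr_pwDl.
apply/andP; split; first by rewrite expRN lef_pV2 ?posrE ?expR_gt0// expR_ge1Dx.
rewrite -[- u + _]opprK expRN lef_pV2 ?posrE ?expR_gt0//.
set v := - (- u + u ^+ 2).
have v1 : 0 < 1 - v by rewrite /v; have := sqr_ge0 (u - 1 / 2); rewrite sqrrB; lra.
have h : expR v * (1 - v) <= 1.
  have := expR_ge1Dx (- v); rewrite expRN => h.
  by rewrite mulrC -ler_pdivlMr ?expR_gt0// mul1r.
rewrite -(ler_pM2r v1); apply: (le_trans h).
rewrite (_ : (1 + u) * (1 - v) = 1 + u ^+ 3); last by rewrite /v; ring.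
by rewrite lerDl exprn_ge0.
Qed.

(** With m = n + 1, it comes from (1 + 2 t/m)^(-m) <= exp(- 2 t + 4 t^2/m) and (1 + t/m)^(-m) >=
    exp(- t) inserted in [cheb]. *)
Let cheb_err (n : nat) : R := expR (- (2 * t)) * (expR (4 * t ^+ 2 / n.+1%:R) - 1).

Let cheb_le n : cheb (c n)%:num t n.+1 0 <= cheb_err n.
Proof.
have n0 : 0 < n.+1%:R :> R by [].
have ratio rho : 0 <= rho -> (c n)%:num / ((c n)%:num + rho) = (1 + rho * t / n.+1%:R)^-1.
  move=> rho0; rewrite /c /=; field; rewrite !gt_eqF//=.
  by rewrite ltr_pwDl// mulr_ge0// ltW.
have pow (z : R) : expR z ^+ n.+1 = expR (n.+1%:R * z) by rewrite expRM_natl.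
rewrite /cheb !ratio// mulr0 oppr0 expR0 !mulr1.
have u2 : 0 <= 2 * t / n.+1%:R by rewrite divr_ge0// mulr_ge0// ltW.
have u1 : 0 <= 1 * t / n.+1%:R by rewrite divr_ge0// mulr_ge0// ltW.
have /andP[_ b2] := inv_exp_bounds u2; have /andP[b1 _] := inv_exp_bounds u1.
have h2 : (1 + 2 * t / n.+1%:R)^-1 ^+ n.+1 <= expR (- (2 * t)) * expR (4 * t ^+ 2 / n.+1%:R).
  apply: (@le_trans _ _ (expR (- (2 * t / n.+1%:R) + (2 * t / n.+1%:R) ^+ 2) ^+ n.+1)).
    by rewrite lerXn2r ?nnegrE ?expR_ge0// invr_ge0 addr_ge0.
  rewrite pow -expRD le_eqVlt; apply/orP; left; apply/eqP; congr expR.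
  by field; rewrite gt_eqF.
have h1 : expR (- t) <= (1 + 1 * t / n.+1%:R)^-1 ^+ n.+1.
  apply: (@le_trans _ _ (expR (- (1 * t / n.+1%:R)) ^+ n.+1)).
    rewrite pow le_eqVlt; apply/orP; left; apply/eqP; congr expR.
    by field; rewrite gt_eqF.
  by rewrite lerXn2r ?nnegrE ?expR_ge0// invr_ge0 addr_ge0.
have h3 := ler_wpM2l (expR_ge0 (- t)) h1.
have e2 : expR (- (2 * t)) = expR (- t) * expR (- t) by rewrite -expRD; congr expR; ring.
rewrite /cheb_err mulrBr mulr1; move: h2 h3; rewrite e2.
move: (_ ^-1 ^+ _) (_ ^-1 ^+ _) (expR (- t)) (expR (_ / _)) => z2 z1 et ez.
by lra.
Qed.

Let cheb_err_cvg (C : R) : C * cheb_err n @[n --> \oo] --> (0 : R).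
Proof.
rewrite -[X in _ --> X](mulr0 C) -[X in _ --> C * X](mulr0 (expR (- (2 * t)))).
apply: cvgM; first exact: cvg_cst.
apply: cvgM; first exact: cvg_cst.
rewrite -[X in _ --> X](subrr (1 : R)); apply: cvgB; last exact: cvg_cst.
have h0 : 4 * t ^+ 2 * n.+1%:R^-1 @[n --> \oo] --> 4 * t ^+ 2 * 0.
  by apply: cvgM; [exact: cvg_cst|exact: cvg_harmonic].
rewrite mulr0 in h0; rewrite -[X in _ --> X](@expR0 R).
exact: (cvg_comp _ _ h0 (@continuous_expR R 0)).
Qed.

Local Notation near_pair x := (filter_prod (nbhs x) (nbhs \oo)).

Let near_fst (x : E) (Q : E -> Prop) : (\forall y \near x, Q y) ->
  \forall p \near near_pair x, Q p.1.
Proof. by move=> h; exists (Q, setT); [split => //; exact: filterT|move=> p []]. Qed.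

Let near_snd (x : E) (Q : nat -> Prop) : (\forall n \near \oo, Q n) ->
  \forall p \near near_pair x, Q p.2.
Proof. by move=> h; exists (setT, Q); [split => //; exact: filterT|move=> p []]. Qed.

(** Convergence jointly in the starting point and in the number of steps is what [cvg_strict]
    consumes; [transition_near] supplies it because its bound holds for all starting points near
    [x]. *)
Lemma iter_linear_resolvent_cvg (g : Cb R E) x :
  iter p.2.+1 (linear_resolvent P (c p.2)) g p.1 @[p --> near_pair x] --> transition P t g x.
Proof.
apply/cvgrPdist_le => e e0; have e20 : 0 < e / 2 by rewrite divr_gt0.
have [C C0 nearx] := transition_near PM g x (ltW t0) e20.
have := cheb_err_cvg C; move/cvgrPdist_le/(_ _ e20) => small.
near=> p; rewrite distrC.
have h1 : forall s, 0 <= s -> `|transition P s g p.1 - transition P t g x| <=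
    e / 2 + C * (expR (- s) - expR (- t)) ^+ 2 by near: p; exact: near_fst nearx.
have h2 : `|0 - C * cheb_err p.2| <= e / 2 by near: p; exact: near_snd small.
move: h1 h2; move: p.1 p.2 => y n h1 h2.
have := iter_linear_resolvent_near PM (c n) n.+1 h1 (lexx 0).
pose k := MkCb (iter_linear_resolvent_Cb PM (c n) g n.+1).
rewrite (transition0 PM k) => h3; apply: (le_trans h3).
have h4 := ler_wpM2l C0 (cheb_le n).
move: h2 h4; rewrite sub0r normrN => h2 h4.
have := ler_norm (C * cheb_err n).
by move: h2 h4; move: (C * cheb_err n) (C * cheb _ _ _ _) => u v; lra.
Unshelve. all: by end_near. Qed.

Lemma transition_exp_gt0 (h : Cb R E) x : 0 < transition P t (fun y => expR (h y)) x.
Proof.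
have [H H0 hH] := Cb_bounded h; apply: lt_le_trans (expR_gt0 (- H)) _.
apply: prob_ge; first exact: (bmfun_coord (MkCb (exp_Cb h)) t).
by move=> X; rewrite ler_expR; have := hH ((X : skorokhod E) t); rewrite ler_norml => /andP[].
Qed.

Lemma iter_log_resolvent_cvg (h : Cb R E) x :
  iter p.2.+1 (log_resolvent PM (c p.2)) h p.1 @[p --> near_pair x] -->
  ln (transition P t (fun y => expR (h y)) x).
Proof.
have lnE (p : E * nat) : iter p.2.+1 (log_resolvent PM (c p.2)) h p.1 =
    ln (iter p.2.+1 (linear_resolvent P (c p.2)) (fun y => expR (h y)) p.1).
  by rewrite -iter_log_resolventE expRK.
rewrite (funext lnE).
have cln := continuous_ln (transition_exp_gt0 h x).
exact: (cvg_comp _ _ (@iter_linear_resolvent_cvg (MkCb (exp_Cb h)) x) cln).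
Qed.

Variable F : nat -> Cb R E -> Cb R E.
Hypothesis FP : forall n h, resolvent_pair P (c n) (F n h) h.

(** On smoothed data a step of the logarithmic iteration moves by at most K t / (n + 1), so n + 1
    steps lose in total 2 (K t)^2 / (n + 1). *)
Let iter_lower (b : {posnum R}) (h : Cb R E) : exists2 d_ : nat -> R, d_ n @[n --> \oo] --> 0 &
  \forall n \near \oo, forall y,
    iter n.+1 (log_resolvent PM (c n)) (log_resolvent PM b h) y - d_ n <=
    iter n.+1 (F n) (log_resolvent PM b h) y.
Proof.
have [K K0 step] := log_resolvent_iter_step PM b h.
exists (fun n => 2 * (K * t) ^+ 2 * n.+1%:R^-1).
  rewrite -[X in _ --> X](mulr0 (2 * (K * t) ^+ 2)).
  by apply: cvgM; [exact: cvg_cst|exact: cvg_harmonic].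
near=> n => y; have n0 : 0 < n.+1%:R :> R by [].
have cK : K / (c n)%:num = K * t / n.+1%:R by rewrite /c /=; field; rewrite !gt_eqF.
have e2 : K / (c n)%:num <= 1 / 2.
  rewrite cK ler_pdivrMr// -ler_pdivrMl//.
  by apply: le_trans (_ : n%:R <= _); [near: n; exact: nbhs_infty_ger|rewrite ler_nat].
have := iter_ge_log (PM := PM) (FP n) n.+1 y e2 (step (c n)).
apply: le_trans; rewrite lerD2l lerN2 -mulr_natr cK.
by rewrite le_eqVlt; apply/orP; left; apply/eqP; field; rewrite gt_eqF.
Unshelve. all: by end_near. Qed.

Lemma iter_resolvent_cvg (h : Cb R E) x :
  iter p.2.+1 (F p.2) h p.1 @[p --> near_pair x] --> ln (transition P t (fun y => expR (h y)) x).
Proof.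
pose V (k : Cb R E) := ln (transition P t (fun y => expR (k y)) x).
pose hb (k : nat) := log_resolvent PM (PosNum (ltr0Sn R k)) h.
(* The reflection of [h] about [hb k], so that [hb k] is the midpoint of [h] and [kb k] as
   [iter_convex] requires; it also tends to [h]. *)
pose kb k := MkCb (Cb_lincomb 2 (-1) (hb k) h).
have [H H0 hH] := Cb_bounded h.
have hbH k y : `|hb k y| <= H by exact: log_resolvent_bound.
have Vcvg (u : nat -> Cb R E) (B : R) : (forall k y, `|u k y| <= B) ->
    (forall y, expR (u k y) @[k --> \oo] --> expR (h y)) -> V (u k) @[k --> \oo] --> V h.
  move=> uB uh; have cln := continuous_ln (transition_exp_gt0 h x).
  suff tr : transition P t (fun y => expR (u k y)) x @[k --> \oo] --> transition P t (fun y => expR (h y)) x.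
    exact: (cvg_comp _ _ tr cln).
  apply: (@bounded_cvg_RintT _ _ _ (P x) (fun k (X : D) => expR (u k ((X : skorokhod E) t))) _ (expR B)) => [k|k X|X].
  - exact: (bmfun_coord (MkCb (exp_Cb (u k))) t).1.
  - by rewrite ger0_norm ?expR_ge0// ler_expR (le_trans (ler_norm _)).
  - exact: uh.
have V1 : V (hb k) @[k --> \oo] --> V h.
  by apply: (Vcvg _ H) => // y; exact: log_resolvent_cvg.
have V2 : V (kb k) @[k --> \oo] --> V h.
  apply: (Vcvg _ (3 * H)) => [k y|y].
    have := hbH k y; have := hH y; rewrite /kb /= !ler_norml.
    by move=> /andP[? ?] /andP[? ?]; apply/andP; split; lra.
  have e1 k : expR (kb k y) = expR (hb k y) * expR (hb k y) * expR (- h y).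
    by rewrite -!expRD; congr expR; rewrite /kb /=; ring.
  rewrite (funext e1) (_ : expR (h y) = expR (h y) * expR (h y) * expR (- h y)); last first.
    by rewrite -!expRD; congr expR; ring.
  have lc := @log_resolvent_cvg _ _ _ PM h y.
  by apply: cvgM; [exact: (cvgM lc lc)|exact: cvg_cst].
apply/cvgrPdist_le => e e0; have e80 : 0 < e / 8 by rewrite divr_gt0.
have /cvgrPdist_le/(_ _ e80) n1 := V1; have /cvgrPdist_le/(_ _ e80) n2 := V2.
(* The smoothing index is fixed before the number of steps grows: the loss in [iter_lower] is
   controlled only for fixed smoothing. *)
have [k _ /(_ k (leqnn k))/= [v1 v2]] := filterI n1 n2.
have low : exists2 d_ : nat -> R, d_ n @[n --> \oo] --> 0 & \forall n \near \oo, forall y,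
    iter n.+1 (log_resolvent PM (c n)) (hb k) y - d_ n <= iter n.+1 (F n) (hb k) y.
  exact: iter_lower.
have hbkb z : 2 * hb k z <= h z + kb k z.
  by rewrite -[kb k z]/(2 * hb k z + -1 * h z) mulN1r addrC subrK.
move: (hb k) (kb k) v1 v2 low hbkb => u v v1 v2 [d_ d0 low] huv.
have /cvgrPdist_le/(_ _ e80) upper_h := @iter_log_resolvent_cvg h x.
have /cvgrPdist_le/(_ _ e80) upper_u := @iter_log_resolvent_cvg u x.
have /cvgrPdist_le/(_ _ e80) upper_v := @iter_log_resolvent_cvg v x.
have /cvgrPdist_le/(_ _ e80) dsmall := d0.
have le_h (p : E * nat) := iter_le_log PM (FP p.2) p.2.+1 h p.1.
have le_v (p : E * nat) := iter_le_log PM (FP p.2) p.2.+1 v p.1.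
have cv (p : E * nat) := iter_convex PM (FP p.2) p.2.+1 p.1 huv.
have low' : \forall p \near near_pair x,
    iter p.2.+1 (log_resolvent PM (c p.2)) u p.1 - d_ p.2 <= iter p.2.+1 (F p.2) u p.1.
  by apply: filterS (near_snd x low) => p; exact.
pose iF k (p : E * nat) := iter p.2.+1 (F p.2) k p.1.
pose iL k (p : E * nat) := iter p.2.+1 (log_resolvent PM (c p.2)) k p.1.
exact: (@near_convex_squeeze R _ (near_pair x) _ (iF h) (iF u) (iF v) (iL h) (iL u) (iL v)
  (fun p => d_ p.2) (V h) (V u) (V v) e v1 v2 le_h le_v cv upper_h upper_u upper_v low'
  (near_snd x dsmall)).
Qed.

End trotter_limit.

Lemma solves_Rint_init (R : realType) (E : pseudoPMetricType R) (A : set (Cb R E * Cb R E))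
    (x : E) (Q : probability (borel (skorokhod E)) R) (f : borel E -> R) :
  solves_martingale_problem A (@dirac _ (borel E) x R) Q -> bmfun f ->
  \int[Q]_X f ((X : skorokhod E) 0) = f x.
Proof.
move=> [init _] bf; have m0 := @measurable_coord R E 0 (lexx 0).
rewrite -(Rint_pushforward Q m0 bf) /Rintegral.
rewrite (eq_measure_integral (@dirac _ (borel E) x R)); last by move=> B mB _; exact: init.
rewrite integral_dirac//; last by apply/measurable_EFinP; exact: bf.1.
by rewrite diracT mul1e.
Qed.

Lemma martingale_markov_family (R : realType) (E : pseudoPMetricType R)
    (A : set (Cb R E * Cb R E)) (P : E -> probability (borel (skorokhod E)) R) :
  well_posed A ->
  (forall x, solves_martingale_problem A (@dirac _ (borel E) x R) (P x)) ->
  continuous (P : E -> prob_weak R (skorokhod E)) -> markov_family P.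
Proof.
move=> wp sol cont; split.
- by move=> x f bf; exact: solves_Rint_init (sol x) bf.
- by move=> G; exact: continuous_Rint_Cb cont G.
- exact (@bmfun_Rint_P R E P cont).
- exact: (markov wp sol cont).
Qed.

Lemma resolventE (R : realType) (E : pseudoPMetricType R)
    (P : E -> probability (borel (skorokhod E)) R) (PM : markov_family P)
    (c : {posnum R}) (lam : R) (f h : Cb R E) :
  lam^-1 = c%:num -> resolvent_pair P c f h -> resolvent P lam h = f :> (E -> R).
Proof.
move=> lamE pair; rewrite /resolvent ifF; last first.
  by apply/eqP => lam0; have : 0 < c%:num by []; rewrite -lamE lam0 invr0 ltxx.
apply/funext => x.
have -> : resolvent_ereal P lam h x = (f x)%:E; last by [].
apply/eqP; rewrite eq_le (resolvent_ereal_ge PM x lamE pair) andbT.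
exact: resolvent_ereal_le x lamE (resolvent_pair_super pair).
Qed.

Lemma iter_resolventE (R : realType) (E : pseudoPMetricType R)
    (P : E -> probability (borel (skorokhod E)) R) (PM : markov_family P)
    (c : {posnum R}) (lam : R) (F : Cb R E -> Cb R E) (h : Cb R E) j :
  lam^-1 = c%:num -> (forall k, resolvent_pair P c (F k) k) ->
  iter j (resolvent P lam) h = iter j F h :> (E -> R).
Proof.
by move=> lamE FP; elim: j => // j IH; rewrite !iterS IH (resolventE PM lamE (FP _)).
Qed.

(** Comparison with the zero solution, shifted by [H] and by [- H]. *)
Lemma resolvent_pair_bound (R : realType) (E : pseudoPMetricType R)
    (P : E -> probability (borel (skorokhod E)) R) (PM : markov_family P)
    (c : {posnum R}) (f h : Cb R E) (H : R) :
  resolvent_pair P c f h -> (forall y, `|h y| <= H) -> forall y, `|f y| <= H.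
Proof.
move=> pair hH y; pose z := MkCb (Cb_cst E (0 : R)).
have pz : resolvent_pair P c z z.
  move=> x t t0; rewrite (_ : feynman_kac _ _ _ = cst 1).
    by rewrite Rint_cst mass_probability mulr1 expR0.
  apply/funext => X; rewrite /feynman_kac /time_integral.
  rewrite (_ : (fun s => _) = cst 0); last by apply/funext => s; rewrite /rate subrr mulr0.
  by rewrite Rintegral_cst// mul0r subrr expR0.
have h1 : f y <= z y + H.
  by apply: (resolvent_comparison_shift PM y pair pz) => w; rewrite /= add0r (le_trans (ler_norm _)).
have h2 : z y <= f y + H.
  apply: (resolvent_comparison_shift PM y pz pair) => w /=.
  by have := hH w; rewrite ler_norml => /andP[]; lra.
by move: h1 h2; rewrite /= ler_norml => ? ?; apply/andP; split; lra.
Qed.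

Theorem proposition3p6 (R : realType) (E : completePseudoMetricType R)
    (E_hausdorff : hausdorff_space E) (E_separable : separable E)
    (A : set (Cb R E * Cb R E)) (A_linear : linear_operator A)
    (A_well_posed : well_posed A)
    (P : E -> probability (borel (skorokhod E)) R)
    (P_solution : forall x : E,
       solves_martingale_problem A (@dirac _ (borel E) x R) (P x))
    (P_continuous : continuous (P : E -> prob_weak R (skorokhod E)))
    (h : Cb R E) (t : R) (t_ge0 : 0 <= t) :
  exists (Rh : nat -> Cb R E) (Vh : Cb R E),
    [/\ forall m : nat,
          Rh m = iter m (resolvent P (t / m%:R)) h :> (E -> R),
        Vh = semigroup P t h :> (E -> R) &
        Rh m @[m --> \oo] --> Vh].
Proof.
have PM := martingale_markov_family A_well_posed P_solution P_continuous.
have semiE x : semigroup P t h x = ln (transition P t (fun y => expR (h y)) x).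
  by rewrite /semigroup unlock.
have [H H0 hH] := Cb_bounded h.
move: t_ge0; rewrite le_eqVlt => /predU1P[t0|t0].
  exists (fun=> h), h; split.
  - move=> m; rewrite -t0 mul0r; elim: m => //= m <-.
    by rewrite /resolvent eqxx.
  - apply/funext => x; rewrite semiE -t0 (transition0 PM (MkCb (exp_Cb h))).
    by rewrite /= expRK.
  - exact: cvg_cst.
pose c n : {posnum R} := PosNum (divr_gt0 (ltr0Sn R n) t0).
have /choice[F FP] : forall n, exists Fn : Cb R E -> Cb R E, forall k, resolvent_pair P (c n) (Fn k) k.
  by move=> n; have /choice[Fn FnP] := resolvent_pair_exists PM (c n); exists Fn.
pose g := MkCb (exp_Cb h).
have gH y : expR (- H) <= transition P t g y.
  apply: prob_ge; first exact: (bmfun_coord g t).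
  by move=> X; rewrite ler_expR; have := hH ((X : skorokhod E) t); rewrite ler_norml => /andP[].
pose Vh := MkCb (@ln_Cb _ _ _ (MkCb (transition_Cb PM g (ltW t0))) (expR_gt0 (- H)) gH).
(* The solution maps are indexed by [n] with step t / (n + 1), hence the shift; for m = 0 the
   composition is empty. *)
pose Rh m := if m is n.+1 then iter n.+1 (F n) h else h.
exists Rh, Vh; split.
- case=> [|n] //; rewrite (iter_resolventE PM h n.+1 _ (FP n))//.
  by rewrite invf_div.
- by apply/funext => x; rewrite semiE.
rewrite -(@cvg_shiftS (Cb R E)).
have FH n j y : `|iter j (F n) h y| <= H.
  by elim: j y => [|j IH] y //; exact: resolvent_pair_bound (FP n _) IH y.
have [B B0 VB] := Cb_bounded Vh.
apply: (@cvg_strict _ _ _ _ (H + B)) => [n x|x e e0].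
  by apply: le_trans (ler_normB _ _) _; rewrite lerD// FH.
have e20 : 0 < e / 2 by rewrite divr_gt0.
have cF := @iter_resolvent_cvg _ _ _ PM t t0 F FP h x.
move/cvgrPdist_le/(_ _ e20) : cF => nF.
have /cvgrPdist_le/(_ _ e20) nV := @Cb_continuous _ _ Vh x.
have nV' : \forall p \near filter_prod (nbhs x) \oo, `|Vh x - Vh p.1| <= e / 2.
  by exists ([set y | `|Vh x - Vh y| <= e / 2], setT); [split => //; exact: filterT|move=> p []].
apply: filterS2 nF nV' => p; rewrite -[ln _]/(Vh x).
rewrite -[X in _ -> _ -> `|X - _| <= _]/(iter p.2.+1 (F p.2) h p.1).
move: (iter p.2.+1 (F p.2) h p.1 : R) (Vh x) (Vh p.1) => a1 a2 a3 k1 k2.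
rewrite (_ : a1 - a3 = a2 - a3 - (a2 - a1)); last by ring.
by rewrite (le_trans (ler_normB _ _))// [e]splitr lerD.
Qed.
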